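(* Let $(L\rightrightarrows L_M;G\rightrightarrows M)$ be an LBG. For any multiplicative $1$-form $\theta\in \Omega^1(G,L)$, the diagram $(TG\oplus L\rightrightarrows TM \oplus L_M;G\rightrightarrows M)$ with the following structure maps is a VBG over $G\rightrightarrows M$ (called the Morita kernel $\mathsf MK_\theta$ of $\theta$): source and target $s(v,\lambda)=(s(v),s(\lambda))$, $t(v,\lambda)=\big(t(v), t(\lambda +\theta(v))\big)$ for $v\in TG$, $\lambda\in L$ over the same point; unit $u(v,\lambda)=(u(v),u(\lambda))$ for $v\in TM$, $\lambda\in L_M$; inverse $(v,\lambda)^{-1}= \left(v^{-1}, s_{g^{-1}}^{-1}\left(t(\lambda+ \theta(v))\right)\right)$ for $v\in T_gG$, $\lambda\in L_g$; and multiplication of composable arrows $(v,\lambda)\in T_gG\oplus L_g$, $(v',\lambda')\in T_{g'}G\oplus L_{g'}$ given by $(v,\lambda)\cdot(v',\lambda')=\left(vv', s_{gg'}^{-1}(s(\lambda'))\right)$.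
   Context: Lie groupoids are Hausdorff; $s,t,m,u,i$ are source, target, multiplication, unit, inversion; $gh$ is defined when $s(g)=t(h)$; $G^{(2)}$ is the manifold of composable pairs. $TG\rightrightarrows TM$ is the tangent groupoid, with structure maps the differentials of those of $G$ (denoted by the same letters; $vv'$ is its multiplication). A VB-groupoid (VBG) $(V\rightrightarrows V_M;G\rightrightarrows M)$ consists of Lie groupoids $V\rightrightarrows V_M$, $G\rightrightarrows M$ and vector bundles $V\to G$, $V_M\to M$ such that all structure maps of $V$ are vector bundle morphisms covering those of $G$. A line bundle-groupoid (LBG) is a VBG $(L\rightrightarrows L_M;G\rightrightarrows M)$ with $L\to G$, $L_M\to M$ line bundles; its structure maps are then fibrewise isomorphisms; $s_g\colon L_g\to L_{M,s(g)}$ is the restriction of the source of $L$. For a fibrewise isomorphism of line bundles $(F,f)\colon(E\to X)\to(E'\to X')$ and $\theta\in\Omega^k(X',E')$, $(F^*\theta)_x(v_1,\dots)=F_x^{-1}(\theta_{f(x)}(df(v_1),\dots))$. A form $\theta\in\Omega^k(G,L)$ is multiplicative if $m^*\theta=\mathrm{pr}_1^*\theta+\mathrm{pr}_2^*\theta$ in $\Omega^k(G^{(2)},L^{(2)})$, where $m,\mathrm{pr}_1,\mathrm{pr}_2\colon L^{(2)}\to L$ are multiplication and projections on the line bundle $L^{(2)}\to G^{(2)}$ of composable pairs of $L$. *)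

(* Defs.v *)
From mathcomp Require Import all_boot all_order all_algebra.
From mathcomp Require Import all_classical all_reals all_analysis.
Import Order.TTheory GRing.Theory Num.Theory.
Import numFieldNormedType.Exports.

Set Implicit Arguments.
Unset Strict Implicit.
Unset Printing Implicit Defensive.

Local Open Scope classical_set_scope.
Local Open Scope ring_scope.

Fixpoint Ck (R : realType) (k j : nat) (U : set 'rV[R]_k) (phi : 'rV[R]_k -> R)
    : Prop :=
  match j with
  | 0 => forall a, U a -> {for a, continuous phi}
  | j'.+1 => (forall a, U a -> differentiable phi a) /\
      forall i : 'I_k, Ck j' U (fun a => 'D_(delta_mx 0 i) phi a)
  end.

Definition Cinfty (R : realType) (k : nat) (U : set 'rV[R]_k)
  (phi : 'rV[R]_k -> R) : Prop := forall j, Ck j U phi.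

(* A smooth structure on a set is presented by real functions generating it.
   The points of the space are the elements of [carr]; values of maps and of
   functions outside [carr] are irrelevant. The topology is the coarsest one
   making the functions in [coords] continuous, and the smooth functions are
   those that are locally of the form phi(h_1, ..., h_k), with phi smooth and
   the h_i in [coords]. A (Hausdorff, paracompact) manifold M in the usual sense
   is presented by coords = C^oo(M), and its smooth functions are then exactly
   those in C^oo(M); subspaces, products and tangent bundles are presented by
   the evident generators. *)
Record smoothSpace (R : realType) := SmoothSpace {
  points :> pointedType;
  carr : set points;
  coords : set (points -> R) }.

Section Spaces.
Variable R : realType.
Implicit Types X Y Z : smoothSpace R.

Definition tuple_map X (k : nat) (h : 'I_k -> X -> R) (x : X) : 'rV[R]_k :=
  \row_i h i x.

Definition smooth_fun X (f : X -> R) : Prop :=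
  forall x, carr x ->
  exists (k : nat) (h : 'I_k -> X -> R) (U : set 'rV[R]_k)
    (phi : 'rV[R]_k -> R),
    [/\ forall i, coords (h i), open U, U (tuple_map h x), Cinfty U phi &
        forall y, carr y -> U (tuple_map h y) -> f y = phi (tuple_map h y)].

Definition is_open X (O : set X) : Prop :=
  forall x, carr x -> O x ->
  exists (k : nat) (h : 'I_k -> X -> R) (U : set 'rV[R]_k),
    [/\ forall i, coords (h i), open U, U (tuple_map h x) &
        forall y, carr y -> U (tuple_map h y) -> O y].

Definition smooth_map X Y (F : X -> Y) : Prop :=
  (forall x, carr x -> carr (F x)) /\
  (forall h, coords h -> smooth_fun (h \o F)).

Definition diffeo X Y (F : X -> Y) (F' : Y -> X) : Prop :=
  [/\ smooth_map F, smooth_map F', forall x, carr x -> F' (F x) = x &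
      forall y, carr y -> F (F' y) = y].

Definition sub_space X (A : set X) : smoothSpace R :=
  @SmoothSpace R X (@carr R X `&` A) (@coords R X).

Definition prod_space X Y : smoothSpace R :=
  @SmoothSpace R (X * Y)%type [set p | carr p.1 /\ carr p.2]
    ([set h \o fst | h in @coords R X] `|` [set h \o snd | h in @coords R Y]).

Definition real_line : smoothSpace R := @SmoothSpace R R setT [set id].

Definition euclidean (n : nat) : smoothSpace R :=
  @SmoothSpace R 'rV[R]_n setT [set (fun a : 'rV[R]_n => a ord0 i) | i in setT].

Definition hausdorff X : Prop :=
  forall x y : X, carr x -> carr y -> x <> y ->
  exists O O' : set X, [/\ is_open O, is_open O', O x, O' y &
    forall z, carr z -> ~ (O z /\ O' z)].

Definition second_countable_space X : Prop :=
  exists B : nat -> set X, (forall n, is_open (B n)) /\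
  forall (O : set X) x, is_open O -> carr x -> O x ->
    exists n, B n x /\ forall y, carr y -> B n y -> O y.

Definition locally_euclidean (n : nat) X : Prop :=
  forall x : X, carr x ->
  exists (O : set X) (U : set (euclidean n))
    (F : X -> euclidean n) (F' : euclidean n -> X),
    [/\ is_open O, O x, open (U : set 'rV[R]_n) &
        @diffeo (sub_space O) (sub_space U) F F'].

Definition is_manifold X : Prop :=
  [/\ hausdorff X, second_countable_space X & exists n, locally_euclidean n X].

(* [vadd e e'] is only meaningful if e and e' are in the same fibre. *)
Record vbundle X := VBundle {
  total :> smoothSpace R;
  bproj : total -> X;
  vadd : total -> total -> total;
  vscale : R -> total -> total }.

(* The fibrewise linear bijections with R^k make every fibre a vector space. *)
Definition is_vbundle X (k : nat) (E : vbundle X) : Prop :=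
  [/\ smooth_map (@bproj X E),
      forall e e' : E, carr e -> carr e' -> bproj e = bproj e' ->
        carr (vadd e e') /\ bproj (vadd e e') = bproj e,
      forall (a : R) (e : E), carr e ->
        carr (vscale a e) /\ bproj (vscale a e) = bproj e &
      forall x : X, carr x ->
      exists (W : set X) (F : E -> X * 'rV[R]_k) (F' : X * 'rV[R]_k -> E),
        [/\ is_open W, W x,
            @diffeo (sub_space (@bproj X E @^-1` W))
              (prod_space (sub_space W) (euclidean k)) F F' &
            forall e : E, carr e -> W (bproj e) ->
            [/\ (F e).1 = bproj e,
                forall e', carr e' -> bproj e = bproj e' ->
                  (F (vadd e e')).2 = (F e).2 + (F e').2 &
                forall a, (F (vscale a e)).2 = a *: (F e).2]]].

Definition vb_morphism X Y (E : vbundle X) (E' : vbundle Y)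
    (F : E -> E') (f : X -> Y) : Prop :=
  [/\ smooth_map F, smooth_map f,
      forall e, carr e -> bproj (F e) = f (bproj e),
      forall e e', carr e -> carr e' -> bproj e = bproj e' ->
        F (vadd e e') = vadd (F e) (F e') &
      forall a e, carr e -> F (vscale a e) = vscale a (F e)].

Definition whitney_sum X (E E' : vbundle X) : vbundle X :=
  @VBundle X
    (@sub_space (prod_space E E')
       [set p : prod_space E E' | bproj p.1 = bproj p.2])
    (fun p => bproj p.1)
    (fun p q => (vadd p.1 q.1, vadd p.2 q.2))
    (fun a p => (vscale a p.1, vscale a p.2)).

(* The inverse of the fibrewise isomorphism F, from the fibre containing e' to
   the fibre of E over x. *)
Definition fibre_inv X (E : vbundle X) (Y : Type) (F : E -> Y) (x : X) (e' : Y)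
  : E := get [set e : E | [/\ carr e, bproj e = x & F e = e']].

(* Tangent vectors are velocities of smooth curves, seen as functionals on
   smooth functions; extending these functionals by 0 to all functions makes
   equality of tangent vectors Leibniz equality. *)

Definition velocity X (c : real_line -> X) : (X -> R) -> R :=
  fun f => if `[< smooth_fun f >] then derive1 (f \o c) 0 else 0.

Definition tangent_space X : smoothSpace R :=
  @SmoothSpace R (X * ((X -> R) -> R))%type
    [set v | exists c : real_line -> X,
       [/\ smooth_map c, c 0 = v.1 & velocity c = v.2]]
    ([set (fun v : X * ((X -> R) -> R) => h v.1) | h in @coords R X] `|`
     [set (fun v : X * ((X -> R) -> R) => v.2 h) | h in @coords R X]).

Definition tangent X : vbundle X :=
  @VBundle X (tangent_space X) fst
    (fun v w => (v.1, fun f => v.2 f + w.2 f))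
    (fun a v => (v.1, fun f => a * v.2 f)).

Definition tmap X Y (F : X -> Y) (v : tangent X) : tangent Y :=
  (F v.1, fun f => if `[< smooth_fun f >] then v.2 (f \o F) else 0).

Definition submersion X Y (F : X -> Y) : Prop :=
  forall x, carr x -> forall w : tangent Y, carr w -> bproj w = F x ->
  exists v : tangent X, [/\ carr v, bproj v = x & tmap F v = w].

(* [gmul a b] is only meaningful if gsrc a = gtgt b. *)
Record gpd (G M : smoothSpace R) := Gpd {
  gsrc : G -> M;
  gtgt : G -> M;
  gmul : G -> G -> G;
  gunit : M -> G;
  ginv : G -> G }.

Definition composable (G M : smoothSpace R) (g : gpd G M) : smoothSpace R :=
  @sub_space (prod_space G G)
    [set p : prod_space G G | gsrc g p.1 = gtgt g p.2].

Definition gmul2 (G M : smoothSpace R) (g : gpd G M) (p : composable g) : G :=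
  gmul g p.1 p.2.

Definition gpr1 (G M : smoothSpace R) (g : gpd G M) (p : composable g) : G :=
  p.1.

Definition gpr2 (G M : smoothSpace R) (g : gpd G M) (p : composable g) : G :=
  p.2.

Record is_groupoid (G M : smoothSpace R) (g : gpd G M) : Prop := {
  src_mul : forall a b, carr a -> carr b -> gsrc g a = gtgt g b ->
    gsrc g (gmul g a b) = gsrc g b;
  tgt_mul : forall a b, carr a -> carr b -> gsrc g a = gtgt g b ->
    gtgt g (gmul g a b) = gtgt g a;
  mul_assoc : forall a b c, carr a -> carr b -> carr c ->
    gsrc g a = gtgt g b -> gsrc g b = gtgt g c ->
    gmul g (gmul g a b) c = gmul g a (gmul g b c);
  src_unit : forall x, carr x -> gsrc g (gunit g x) = x;
  tgt_unit : forall x, carr x -> gtgt g (gunit g x) = x;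
  mul_unitr : forall a, carr a -> gmul g a (gunit g (gsrc g a)) = a;
  mul_unitl : forall a, carr a -> gmul g (gunit g (gtgt g a)) a = a;
  src_inv : forall a, carr a -> gsrc g (ginv g a) = gtgt g a;
  tgt_inv : forall a, carr a -> gtgt g (ginv g a) = gsrc g a;
  mul_invr : forall a, carr a -> gmul g a (ginv g a) = gunit g (gtgt g a);
  mul_invl : forall a, carr a -> gmul g (ginv g a) a = gunit g (gsrc g a) }.

Record is_lie_groupoid (G M : smoothSpace R) (g : gpd G M) : Prop := {
  arrows_manifold : is_manifold G;
  objects_manifold : is_manifold M;
  src_smooth : smooth_map (gsrc g);
  tgt_smooth : smooth_map (gtgt g);
  src_submersion : submersion (gsrc g);
  tgt_submersion : submersion (gtgt g);
  mul_smooth : smooth_map (@gmul2 G M g);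
  unit_smooth : smooth_map (gunit g);
  inv_smooth : smooth_map (ginv g);
  groupoid_laws : is_groupoid g }.

Section VBGroupoids.
Variables (G M : smoothSpace R) (g : gpd G M).

(* V^(2) -> G^(2) *)
Definition composable_vb (V : vbundle G) (VM : vbundle M) (gV : gpd V VM)
    : vbundle (composable g) :=
  @VBundle (composable g) (composable gV)
    (fun p => (bproj p.1, bproj p.2))
    (fun p q => (vadd p.1 q.1, vadd p.2 q.2))
    (fun a p => (vscale a p.1, vscale a p.2)).

Record is_vbg (V : vbundle G) (VM : vbundle M) (gV : gpd V VM) : Prop := {
  vbg_base : is_lie_groupoid g;
  vbg_total : is_lie_groupoid gV;
  vbg_arrows : exists k, is_vbundle k V;
  vbg_objects : exists k, is_vbundle k VM;
  vbg_composable : exists k, is_vbundle k (composable_vb gV);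
  vbg_src : vb_morphism (gsrc gV) (gsrc g);
  vbg_tgt : vb_morphism (gtgt gV) (gtgt g);
  vbg_mul :
    @vb_morphism _ _ (composable_vb gV) V (@gmul2 _ _ gV) (@gmul2 _ _ g);
  vbg_unit : vb_morphism (gunit gV) (gunit g);
  vbg_inv : vb_morphism (ginv gV) (ginv g) }.

Definition is_lbg (L : vbundle G) (LM : vbundle M) (gL : gpd L LM) : Prop :=
  [/\ is_vbg gL, is_vbundle 1 L & is_vbundle 1 LM].

End VBGroupoids.

(* An E-valued 1-form on X is a smooth bundle map TX -> E over the identity;
   [pullback1] is only meaningful when F is a fibrewise isomorphism. *)

Definition is_form1 X (E : vbundle X) (theta : tangent X -> E) : Prop :=
  vb_morphism theta id.

Definition pullback1 X Y (E : vbundle X) (E' : vbundle Y) (F : E -> E')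
    (f : X -> Y) (theta : tangent Y -> E') : tangent X -> E :=
  fun v => fibre_inv F (bproj v) (theta (tmap f v)).

Section MoritaKernel.
Variables (G M : smoothSpace R) (g : gpd G M).
Variables (L : vbundle G) (LM : vbundle M) (gL : gpd L LM).
Variable theta : tangent G -> L.

Definition multiplicative1 : Prop :=
  is_form1 theta /\
  let L2 := composable_vb g gL in
  forall w : tangent (composable g), carr w ->
    @pullback1 _ _ L2 L (@gmul2 _ _ gL) (@gmul2 _ _ g) theta w =
    vadd (@pullback1 _ _ L2 L (@gpr1 _ _ gL) (@gpr1 _ _ g) theta w)
         (@pullback1 _ _ L2 L (@gpr2 _ _ gL) (@gpr2 _ _ g) theta w).

(* The product of composable v, v' is dm(w), where w is the tangent vector of
   G^(2) with projections v and v'. *)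
Definition tangent_mul (v v' : tangent G) : tangent G :=
  tmap (@gmul2 _ _ g)
    (get [set w : tangent (composable g) |
            [/\ carr w, tmap (@gpr1 _ _ g) w = v & tmap (@gpr2 _ _ g) w = v']]).

Definition tangent_gpd : gpd (tangent G) (tangent M) :=
  @Gpd (tangent G) (tangent M) (tmap (gsrc g)) (tmap (gtgt g)) tangent_mul
    (tmap (gunit g)) (tmap (ginv g)).

Definition morita_kernel
    : gpd (whitney_sum (tangent G) L) (whitney_sum (tangent M) LM) :=
  let T := tangent_gpd in
  @Gpd (whitney_sum (tangent G) L) (whitney_sum (tangent M) LM)
    (fun p => let: (v, l) := p in (gsrc T v, gsrc gL l))
    (fun p => let: (v, l) := p in (gtgt T v, gtgt gL (vadd l (theta v))))
    (fun p p' => let: (v, l) := p in let: (v', l') := p' in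
       (gmul T v v',
        fibre_inv (gsrc gL) (gmul g (bproj v) (bproj v')) (gsrc gL l')))
    (fun p => let: (v, l) := p in (gunit T v, gunit gL l))
    (fun p => let: (v, l) := p in
       (ginv T v,
        fibre_inv (gsrc gL) (ginv g (bproj v)) (gtgt gL (vadd l (theta v))))).

End MoritaKernel.

End Spaces.

(* Main.v *)
Require Import Defs.
From mathcomp Require Import all_boot all_order all_algebra.
From mathcomp Require Import all_classical all_reals all_analysis.
From mathcomp Require Import ring lra.
From HB Require Import structures.
Import Order.TTheory GRing.Theory Num.Theory.
Import numFieldNormedType.Exports.

Set Implicit Arguments.
Unset Strict Implicit.
Unset Printing Implicit Defensive.

Local Open Scope classical_set_scope.
Local Open Scope ring_scope.

(** Only the target of the Morita kernel is twisted by theta: its source is the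
direct sum of the sources of TG and L. The source of L is bijective on fibres
([line_src_inj], [line_src_onto]), so an arrow (v, l) is determined by v and by
s(l), and a groupoid identity amounts to the same identity in TG together with
an equality of sources in L, which the formula for the multiplication makes
immediate. What remains are the identities about the target. Evaluating the
multiplicativity of theta on a composable pair gives
theta(v v') = (theta v + l1) (theta v' + l2), where l1 and l2 are the elements
making (l1, theta v') and (theta v, l2) composable ([form_mul]). Hence theta
vanishes on units ([form_unit]), s(theta v) and t(theta(v^-1)) are opposite
([form_inv]), and the target of a product is that of its left factor
([mk_tgt_mul]).

The differential geometry behind this consists of four facts.

- Tangent vectors are velocities of curves, and composable tangent vectors are
  velocities of composable curves ([tangent_composable]). So the laws of TG are
  those of G, applied along curves and differentiated. The reason is that curves
  lift through a submersion with any compatible initial velocity ([curve_lift]),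
  a consequence of the inverse function theorem ([inverse_function]).
- The tangent bundle of a manifold is a vector bundle ([tangent_vbundle]), so are
  Whitney sums ([whitney_vbundle]), and the total space of a vector bundle over
  a manifold is a manifold ([vbundle_manifold]).
- A bundle map that is onto on fibres and covers a submersion is a submersion
  ([bundle_submersion]), which applies to the source; the target is the source
  composed with the inversion ([target_submersion]).
- The composable pairs form a vector bundle, because the condition
  s(p) = t(q) is linear of constant rank on fibres ([composable_vbundle]).

The structure maps are bundle maps since they are built from those of TG and L:
the target of (v, l) is t(l + theta v) ([twist_morphism]), its inverse is the
pair of inverses of v and l + theta v ([mk_invE]), and the product involves the
inverse of s on fibres, which is smooth by Cramer's rule ([fibre_inv_smooth]). *)

(** * Differentials and the chain rule in coordinates *)

Section Differential.
Variables (R : realType) (V W : normedModType R).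

Lemma differential_eps (f : V -> W) (A : {linear V -> W}) a : continuous A ->
  (forall e, 0 < e -> \forall h \near 0, `|f (h + a) - (f a + A h)| <= e * `|h|) ->
  differentiable f a /\ 'd f a = A :> (V -> W).
Proof.
move=> cA H.
have fE : f \o shift a = cst (f a) + A +o_ 0 id by apply/eqaddoP => e /H.
have dA := diff_unique cA fE.
by split => //; apply/diff_locallyP; rewrite dA; split.
Qed.

Lemma differentiable_eps (f : V -> W) a : differentiable f a ->
  forall e, 0 < e ->
  \forall h \near 0, `|f (h + a) - (f a + 'd f a h)| <= e * `|h|.
Proof. by move=> /diff_locallyP[_ /eqaddoP H] e /H. Qed.

Lemma near_eq_differentiable (f g : V -> W) a :
  {near a, f =1 g} -> differentiable f a -> differentiable g a.
Proof.
move=> fg df.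
apply: (proj1 (@differential_eps g ('d f a) a _ _)); first exact: diff_continuous.
move=> e e0; have := differentiable_eps df e0.
have fga : f a = g a by exact: (nbhs_singleton fg).
have : \forall z \near 0, f (z + (a - 0)) = g (z + (a - 0)).
  by move: fg; rewrite {1}/prop_near1 /= -[X in X -> _]/(\near a, f a = g a) (near_shift 0 a).
rewrite subr0; apply: filterS2 => h E; by rewrite E fga.
Qed.
End Differential.

Section MatrixNorm.
Variable R : realType.

Lemma mx_entry_le_norm m n (A : 'M[R]_(m, n)) i j : `|A i j| <= `|A|.
Proof. by rewrite [leRHS]mx_normrE; exact: (le_bigmax _ _ (i, j)). Qed.

Lemma mx_norm_le m n (A : 'M[R]_(m, n)) e :
  0 <= e -> (forall i j, `|A i j| <= e) -> `|A| <= e.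
Proof.
by move=> e0 H; rewrite [leLHS]mx_normrE (bigmax_le _ e0)// => -[i j] _; exact: H.
Qed.

Lemma mulmx_norm_le m n (x : 'rV[R]_m) (A : 'M[R]_(m, n)) :
  `|x *m A| <= m%:R * `|A| * `|x|.
Proof.
apply: mx_norm_le => [|i j]; first by rewrite !mulr_ge0.
rewrite mxE; apply: le_trans (ler_norm_sum _ _ _) _.
apply: (@le_trans _ _ (\sum_(k < m) (`|A| * `|x|))); last first.
  by rewrite sumr_const card_ord -[leLHS]mulr_natl mulrA.
apply: ler_sum => k _; rewrite normrM mulrC.
by rewrite ler_pM// mx_entry_le_norm.
Qed.

Lemma mulmxr_continuous m n (A : 'M[R]_(m, n)) :
  continuous (mulmxr A : 'rV[R]_m -> 'rV[R]_n).
Proof.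
apply: (bounded_linear_continuous (f := mulmxr A)).
apply/linear_boundedP; exists (m%:R * `|A|); split; first exact: num_real.
move=> r /ltW rA x; apply: le_trans (mulmx_norm_le _ _) _.
by apply: ler_wpM2r.
Qed.

Lemma row_continuous_nbhs (T : topologicalType) m (F : 'I_m -> T -> R) a (A : set 'rV[R]_m) :
  (forall i, {for a, continuous (F i)}) -> nbhs (\row_i F i a) A ->
  \forall b \near a, A (\row_i F i b).
Proof.
move=> FC [B BM BA] /=.
have : forall i, \forall b \near a, B 0 i (F i b).
  by move=> i; apply: (FC i); have := BM 0 i; rewrite mxE.
move/filter_forall; apply: filterS => b Bb; apply: BA => i' i /=.
by rewrite ord1 mxE.
Qed.

Variable V : normedModType R.

Lemma row_fun_sum n (F : 'I_n -> V -> R) :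
  (fun x => \row_j F j x) = \sum_j (fun x => F j x *: delta_mx 0 j) :> (V -> 'rV_n).
Proof.
apply/funext => x; rewrite [LHS]row_sum_delta fct_sumE.
by apply: eq_bigr => j _; rewrite mxE.
Qed.

Lemma differentiable_row n (F : 'I_n -> V -> R) a :
  (forall j, differentiable (F j) a) ->
  differentiable (fun x => \row_j F j x : 'rV_n) a.
Proof.
move=> dF; rewrite row_fun_sum; apply: differentiable_sum => j.
by apply: differentiableZl.
Qed.

Lemma diff_row n (F : 'I_n -> V -> R) a v :
  (forall j, differentiable (F j) a) ->
  'd (fun x => \row_j F j x : 'rV_n) a v = \row_j 'D_v (F j) a.
Proof.
move=> dF; rewrite -deriveE; last exact: differentiable_row.
rewrite derive_mx; last exact/diff_derivable/differentiable_row.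
apply/rowP => j; rewrite [LHS]mxE [RHS]mxE.
by congr (derive _ a v); apply/funext => x; rewrite mxE.
Qed.

Lemma diff_rowE n (phi : 'rV[R]_n -> R) (a v : 'rV[R]_n) : differentiable phi a ->
  'd phi a v = \sum_j v 0 j * 'D_(delta_mx 0 j) phi a.
Proof.
move=> dphi; rewrite {1}(row_sum_delta v) linear_sum; apply: eq_bigr => j _.
by rewrite linearZ -deriveE.
Qed.

(** Stated coordinatewise because classes C^k are defined by partial derivatives. *)
Lemma chain_rule n (F : 'I_n -> V -> R) (phi : 'rV[R]_n -> R) a v :
  (forall j, differentiable (F j) a) -> differentiable phi (\row_j F j a) ->
  differentiable (fun x => phi (\row_j F j x)) a /\
  'D_v (fun x => phi (\row_j F j x)) a =
    \sum_j 'D_v (F j) a * 'D_(delta_mx 0 j) phi (\row_j F j a).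
Proof.
move=> dF dphi; set G := fun x => \row_j F j x : 'rV_n.
have dG : differentiable G a by exact: differentiable_row.
have dpG : differentiable (phi \o G) a by exact: differentiable_comp.
split => //; rewrite -[X in derive X]/(phi \o G) deriveE // diff_comp //=.
rewrite diff_row // diff_rowE //; apply: eq_bigr => j _; by rewrite mxE.
Qed.
End MatrixNorm.

(** * Functions of class C^k on open subsets of R^n *)

Section CkCalculus.
Variables (R : realType) (n : nat) (U : set 'rV[R]_n).
Implicit Types f g : 'rV[R]_n -> R.

Lemma Ck_sub (V : set 'rV[R]_n) j f : V `<=` U -> Ck j U f -> Ck j V f.
Proof.
elim: j f => [|j IH] f VU /=; first by move=> H a /VU; exact: H.
by move=> [H1 H2]; split=> [a /VU|i]; [exact: H1|apply: IH].
Qed.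

Lemma CkW j f : Ck j.+1 U f -> Ck j U f.
Proof.
elim: j f => [|j IH] f.
  by move=> [H _] a /H; exact: differentiable_continuous.
by move=> [H1 H2]; split=> // i; apply: IH.
Qed.

Lemma Ck_cst j (c : R) : Ck j U (fun=> c).
Proof.
elim: j c => [|j IH] c; first by move=> a _; exact: cst_continuous.
split=> [a _|i]; first exact: differentiable_cst.
have -> : (fun a : 'rV[R]_n => 'D_(delta_mx 0 i) (fun=> c) a) = (fun=> 0).
  by apply/funext => a; exact: (derive_cst c).
exact: IH.
Qed.

Lemma derive_coord (a v : 'rV[R]_n) k : 'D_v (fun x : 'rV[R]_n => x 0 k) a = v 0 k.
Proof.
rewrite -[RHS](_ : 'D_v (fun x : 'rV[R]_n => \row_i x 0 i) a 0 k = v 0 k).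
  rewrite derive_mx ?mxE; last first.
    by apply/diff_derivable/differentiable_row => i; exact: differentiable_coord.
  by congr (derive _ a v); apply/funext => x; rewrite mxE.
have -> : (fun x : 'rV[R]_n => \row_i x 0 i) = id.
  by apply/funext => x; apply/rowP => i; rewrite mxE.
by rewrite derive_id.
Qed.

Lemma Ck_coord j k : Ck j U (fun a => a 0 k).
Proof.
case: j => [a _|j]; first exact: coord_continuous.
split=> [a _|i]; first exact: differentiable_coord.
have -> : (fun a => 'D_(delta_mx 0 i) (fun a : 'rV[R]_n => a 0 k) a) =
    (fun=> (delta_mx 0 i : 'rV[R]_n) 0 k).
  by apply/funext => a; rewrite derive_coord.
exact: Ck_cst.
Qed.

Hypothesis oU : open U.

Lemma Ck_ext j f g : (forall a, U a -> f a = g a) -> Ck j U f -> Ck j U g.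
Proof.
elim: j f g => [|j IH] f g fg /=.
  move=> H a Ua; have fga : {near nbhs a, f =1 g}.
    by move/open_nbhs_nbhs: (conj oU Ua); apply: filterS => z; exact: fg.
  change (g @ a --> g a); rewrite -(fg _ Ua); apply: cvg_trans (H a Ua).
  exact: (near_eq_cvg fga).
move=> [H1 H2]; split=> [a Ua|i].
  apply: near_eq_differentiable (H1 a Ua).
  by move/open_nbhs_nbhs: (conj oU Ua); apply: filterS => z; exact: fg.
apply: IH (H2 i) => a Ua; apply: near_eq_derive.
by move/open_nbhs_nbhs: (conj oU Ua); apply: filterS => z; exact: fg.
Qed.

Lemma Ck_add j f g : Ck j U f -> Ck j U g -> Ck j U (fun a => f a + g a).
Proof.
elim: j f g => [|j IH] f g.
  by move=> H1 H2 a Ua; apply: continuousD; [exact: H1|exact: H2].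
move=> [f1 f2] [g1 g2]; split=> [a Ua|i].
  by apply: differentiableD; [exact: f1|exact: g1].
apply: Ck_ext (IH _ _ (f2 i) (g2 i)) => a Ua /=.
by rewrite -deriveD //; apply: diff_derivable; [exact: f1|exact: g1].
Qed.

Lemma Ck_mul j f g : Ck j U f -> Ck j U g -> Ck j U (fun a => f a * g a).
Proof.
elim: j f g => [|j IH] f g.
  by move=> H1 H2 a Ua; apply: continuousM; [exact: H1|exact: H2].
move=> fC gC; have [f1 f2] := fC; have [g1 g2] := gC; split=> [a Ua|i].
  by apply: differentiableM; [exact: f1|exact: g1].
have := Ck_add (IH _ _ (CkW fC) (g2 i)) (IH _ _ (CkW gC) (f2 i)).
apply: Ck_ext => a Ua /=.
by rewrite -[RHS]/('D__ (f * g) a) deriveM //; apply: diff_derivable; [exact: f1|exact: g1].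
Qed.

Lemma Ck_sum j m (F : 'I_m -> 'rV[R]_n -> R) :
  (forall i, Ck j U (F i)) -> Ck j U (fun a => \sum_i F i a).
Proof.
move=> H; have -> : (fun a => \sum_i F i a) = \sum_i F i.
  by apply/funext => a; rewrite fct_sumE.
by elim/big_ind: _ => [|f g|//]; [exact: Ck_cst|exact: Ck_add].
Qed.

Lemma Ck_inv j f : (forall a, U a -> f a != 0) -> Ck j U f ->
  Ck j U (fun a => (f a)^-1).
Proof.
move=> f0; elim: j => [|j IH] fC.
  by move=> a Ua; apply: continuousV; [exact: f0|exact: fC].
have [f1 f2] := fC; split=> [a Ua|i].
  by apply: differentiableV; [exact: f1|exact: f0].
have IC := IH (CkW fC).
have := Ck_mul (Ck_mul (Ck_cst j (-1)) (Ck_mul IC IC)) (f2 i).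
apply: Ck_ext => a Ua /=.
rewrite -[RHS]/('D__ (fun y => (f y)^-1) a) deriveV //; last first.
- by apply/diff_derivable/f1.
- exact: f0.
by rewrite mulN1r expr2 invfM.
Qed.

(** By induction on j: the partial derivatives of the composite are polynomial in
those of the F i and the composites of the partial derivatives of phi. *)
Lemma Ck_comp j m (V : set 'rV[R]_m) (F : 'I_m -> 'rV[R]_n -> R) phi :
  (forall a, U a -> V (\row_i F i a)) -> (forall i, Ck j U (F i)) -> Ck j V phi ->
  Ck j U (fun a => phi (\row_i F i a)).
Proof.
move=> FV; elim: j phi => [|j IH] phi FC pC.
  move=> a Ua; apply: (@continuous_comp _ _ _ (fun a => \row_i F i a) phi).
    by move=> A FA; exact: (row_continuous_nbhs (fun i => FC i a Ua) FA).
  exact/pC/FV.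
have [p1 p2] := pC; split=> [a Ua|i].
  by apply: (proj1 (chain_rule 0 _ _)) => [k|]; [exact: (FC k).1|exact/p1/FV].
have : Ck j U (fun a => \sum_k 'D_(delta_mx 0 i) (F k) a
    * 'D_(delta_mx 0 k) phi (\row_k F k a)).
  apply: Ck_sum => k; apply: Ck_mul; first exact: (FC k).2.
  by apply: (IH (fun b => 'D_(delta_mx 0 k) phi b)) => [l|]; [exact: CkW|exact: p2].
apply: Ck_ext => a Ua /=; symmetry; apply: (proj2 (chain_rule _ _ _)) => [k|].
  exact: (FC k).1.
exact/p1/FV.
Qed.

End CkCalculus.

Lemma Ck_local (R : realType) n (U : set 'rV[R]_n) j f :
  (forall a, U a -> exists V, [/\ open V, V a & Ck j V f]) -> Ck j U f.
Proof.
elim: j f => [|j IH] f H; first by move=> a /H[V [_ Va]]; exact.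
split=> [a /H[V [_ Va [+ _]]]|i]; first exact.
by apply: IH => a /H[V [oV Va [_ +]]] => /(_ i); exists V.
Qed.

Section AffineMaps.
Variable R : realType.

Lemma derive1_affine n (b a : 'rV[R]_n) i :
  derive1 (fun t : R => (b + t *: a) 0 i) 0 = a 0 i.
Proof.
have -> : (fun t : R => (b + t *: a) 0 i) = (cst (b 0 i) + (fun t => a 0 i * t)).
  by apply/funext => y; rewrite !mxE mulrC.
rewrite derive1E deriveD //.
- rewrite derive_cst add0r -[X in derive X]/(a 0 i *: (id : R -> R)) deriveZ //.
  by rewrite derive_id; exact: mulr1.
Qed.

Lemma derive_along_line n (f : 'rV[R]_n -> R) b v :
  'D_v f b = derive1 (fun t : R => f (b + t *: v)) 0.
Proof.
rewrite /derive /derive1.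
have -> // : (fun h : R => h^-1 *: ((f \o shift b) (h *: v) - f b)) =
    (fun h : R => h^-1 *: (f (b + (h + 0) *: v) - f (b + 0 *: v))).
by apply/funext => h /=; rewrite scale0r !addr0 [h *: v + b]addrC.
Qed.

Lemma derive_affine n k (a0 : 'rV[R]_n) (K : 'M[R]_(k, n)) (b v : 'rV[R]_k) i :
  'D_v (fun b => (a0 + b *m K) 0 i) b = (v *m K) 0 i.
Proof.
rewrite derive_along_line -(derive1_affine (a0 + b *m K)); congr (derive1 _ 0).
by apply/funext => t; rewrite mulmxDl -scalemxAl addrA.
Qed.

Lemma Cinfty_affine n k (U : set 'rV[R]_k) (a0 : 'rV[R]_n) (K : 'M[R]_(k, n)) i :
  open U -> Cinfty U (fun b => (a0 + b *m K) 0 i).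
Proof.
move=> oU j.
have -> : (fun b : 'rV[R]_k => (a0 + b *m K) 0 i) =
    (fun b => a0 0 i + \sum_l b 0 l * K l i).
  by apply/funext => b; rewrite !mxE.
apply: (Ck_add oU (@Ck_cst _ _ _ _ _)).
apply: (Ck_sum oU) => l; exact: (Ck_mul oU (@Ck_coord _ _ _ _ _) (@Ck_cst _ _ _ _ _)).
Qed.
End AffineMaps.

(** * Algebras of functions, inverse matrices and the mean value inequality *)

(** The entries of products of matrices, of adjugates and the determinant are
polynomials in the entries; this applies to functions of class C^k and to germs
of smooth functions. *)
Section FunctionAlgebra.
Variables (R : realType) (T : Type) (P : (T -> R) -> Prop).
Hypotheses (Pcst : forall c, P (fun=> c))
  (Padd : forall f g, P f -> P g -> P (fun x => f x + g x))
  (Pmul : forall f g, P f -> P g -> P (fun x => f x * g x)).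

Lemma algebra_sum (I : finType) (Q : pred I) (F : I -> T -> R) :
  (forall i, P (F i)) -> P (fun x => \sum_(i | Q i) F i x).
Proof.
move=> H; elim: (index_enum I) => [|i s IH].
  by under [X in P X]eq_fun do rewrite big_nil.
under [X in P X]eq_fun do rewrite big_cons.
by case: (Q i) => //; exact: Padd.
Qed.

Lemma algebra_prod (I : finType) (Q : pred I) (F : I -> T -> R) :
  (forall i, P (F i)) -> P (fun x => \prod_(i | Q i) F i x).
Proof.
move=> H; elim: (index_enum I) => [|i s IH].
  by under [X in P X]eq_fun do rewrite big_nil.
under [X in P X]eq_fun do rewrite big_cons.
by case: (Q i) => //; exact: Pmul.
Qed.

Lemma algebra_det n (A : T -> 'M[R]_n) :
  (forall i j, P (fun x => A x i j)) -> P (fun x => \det (A x)).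
Proof.
move=> H; rewrite /determinant; apply: algebra_sum => s.
by apply: Pmul => //; apply: algebra_prod => i.
Qed.

Lemma algebra_adj n (A : T -> 'M[R]_n) i j :
  (forall i j, P (fun x => A x i j)) -> P (fun x => (\adj (A x)) i j).
Proof.
move=> H; under [X in P X]eq_fun do rewrite mxE /cofactor.
apply: Pmul => //; apply: algebra_det => k l.
by under [X in P X]eq_fun do rewrite !mxE.
Qed.

Lemma algebra_mulmx m n p (A : T -> 'M[R]_(m, n)) (B : T -> 'M[R]_(n, p)) i j :
  (forall i j, P (fun x => A x i j)) -> (forall i j, P (fun x => B x i j)) ->
  P (fun x => (A x *m B x) i j).
Proof.
move=> HA HB; under [X in P X]eq_fun do rewrite mxE.
by apply: algebra_sum => k; exact: Pmul.
Qed.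
End FunctionAlgebra.

(** Cramer's rule. *)
Lemma Ck_invmx (R : realType) n m (U : set 'rV[R]_n) (A : 'rV[R]_n -> 'M[R]_m) k i j :
  open U -> (forall a, U a -> \det (A a) != 0) ->
  (forall i j, Ck k U (fun a => A a i j)) -> Ck k U (fun a => invmx (A a) i j).
Proof.
move=> oU A0 CA.
have Pc : forall c, Ck k U (fun=> c) by exact: Ck_cst.
have Pa := @Ck_add R n U oU k; have Pm := @Ck_mul R n U oU k.
have := Pm _ _ (@Ck_inv _ _ _ oU _ _ A0 (algebra_det Pc Pa Pm CA))
  (algebra_adj Pc Pa Pm i j CA).
apply: Ck_ext => // a /A0 dA; rewrite /invmx unitmxE unitfE dA.
by rewrite [RHS]mxE.
Qed.

Section MeanValue.
Variables (R : realType) (n : nat) (S : 'rV[R]_n -> R) (p : 'rV[R]_n) (r c : R).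
Hypotheses (dS : forall a : 'rV[R]_n, `|a - p| <= r -> differentiable S a)
  (DS : forall a v : 'rV[R]_n, `|a - p| <= r -> `|'D_v S a| <= c * `|v|).

Lemma mean_value_ball (z z' : 'rV[R]_n) : `|z - p| <= r -> `|z' - p| <= r ->
  `|S z - S z'| <= c * `|z - z'|.
Proof.
move=> zr z'r; pose v : 'rV[R]_n := z - z'.
pose l : R -> 'rV[R]_n := fun s => z' + s *: v.
have lr (s : R) : s \in `[0, 1]%R -> `|l s - p| <= r.
  rewrite in_itv /= => /andP[s0 s1].
  have -> : l s - p = s *: (z - p) + (1 - s) *: (z' - p).
    by apply/rowP => k; rewrite !mxE; ring.
  apply: le_trans (ler_normD _ _) _; rewrite !normrZ.
  rewrite (ger0_norm s0) ger0_norm ?subr_ge0 //.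
  apply: (@le_trans _ _ (s * r + (1 - s) * r)); last by rewrite -mulrDl addrCA subrr addr0 mul1r.
  by apply: lerD; apply: ler_wpM2l => //; rewrite subr_ge0.
have dl s : differentiable l s.
  by apply: differentiableD; [exact: differentiable_cst|exact: differentiableZl].
have dl1 s : 'd l s 1 = v.
  rewrite -deriveE // deriveD; last exact/derivable1_diffP/differentiableZl.
    rewrite derive_cst add0r deriveE; last exact: differentiableZl.
    by rewrite (@diff_val _ _ _ _ _ _ _ (is_diff_scalel _ _)) scale1r.
  exact: derivable_cst.
have H (s : R) : s \in `[0, 1]%R -> is_derive s 1 (S \o l) ('D_v S (l s)).
  move=> s01; have dSl := dS (lr s s01).
  have dc : differentiable (S \o l) s by exact: differentiable_comp.
  split; first exact: diff_derivable.
  by rewrite deriveE // diff_comp //= dl1 deriveE.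
have D (s : R) : s \in `]0, 1[%R -> is_derive s 1 (S \o l) ('D_v S (l s)).
  by rewrite in_itv /= => /andP[s0 s1]; apply: H; rewrite in_itv /= !ltW.
have C : {within `[0, 1], continuous (S \o l)}.
  by apply: derivable_within_continuous => s s01; have [] := H s s01.
have [s s01] := MVT_segment (@ler01 R) D C.
rewrite subr0 mulr1 /= => E.
have <- : l 1 = z by rewrite /l /v scale1r subrKC.
have <- : l 0 = z' by rewrite /l scale0r addr0.
rewrite E /l scale1r scale0r addr0 (_ : _ - z' = v); last by rewrite addrC addKr.
exact/DS/lr.
Qed.
End MeanValue.

(** * The inverse function theorem *)

(* completeness of R^n, for the contraction principle *)
HB.instance Definition _ (R : realType) (n : nat) := Complete.on 'rV[R]_n.

Section InverseFunction.
Variables (R : realType) (n : nat) (U : set 'rV[R]_n).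
Variables (Phi : 'I_n -> 'rV[R]_n -> R) (p : 'rV[R]_n).
Hypotheses (oU : open U) (Up : U p) (CPhi : forall i, Cinfty U (Phi i)).

Let f (a : 'rV[R]_n) : 'rV[R]_n := \row_j Phi j a.

Definition jacobian_mx (a : 'rV[R]_n) : 'M[R]_n :=
  \matrix_(i, j) 'D_(delta_mx 0 i) (Phi j) a.

Local Notation J := jacobian_mx.

Hypothesis Jp : \det (J p) != 0.

Let B := invmx (J p).

(* If the entries of 1 - J a *m B are at most c near p, then z |-> z - f z *m B
   is 1/2-Lipschitz there, n entries being summed; n.+1 also covers n = 0. *)
Let c : R := (2 * n.+1%:R)^-1.

Let c_gt0 : 0 < c. Proof. by rewrite invr_gt0. Qed.

Let CJ k i j : Ck k U (fun a => J a i j).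
Proof.
have [_ /(_ i)] := CPhi j k.+1; congr (Ck k U _).
by apply/funext => a; rewrite mxE.
Qed.

Let Pc k := @Ck_cst R n U k.
Let Pa k := @Ck_add R n U oU k.
Let Pm k := @Ck_mul R n U oU k.

Let good_radius : exists r : R, 0 < r /\ forall a, `|a - p| <= r ->
  [/\ U a, \det (J a) != 0 & forall i j, `|(1%:M - J a *m B) i j| <= c].
Proof.
have near1 : \forall a \near p, [/\ U a, \det (J a) != 0 &
    forall i j, `|(1%:M - J a *m B) i j| <= c].
  have H1 : \forall a \near p, U a by exact: open_nbhs_nbhs.
  have H2 : \forall a \near p, \det (J a) != 0.
    have : {for p, continuous (fun a => \det (J a))}.
      exact: (algebra_det (Pc 0) (Pa (k := 0)) (Pm (k := 0)) (CJ 0)).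
    by move=> dc; exact: (cvgr_neq0 _ dc Jp).
  have H3 : \forall a \near p, forall i j, `|(1%:M - J a *m B) i j| <= c.
    apply: (@filter_forall _ _ (fun i a => forall j, `|(1%:M - J a *m B) i j| <= c) (nbhs p)) => i.
    apply: (@filter_forall _ _ (fun j a => `|(1%:M - J a *m B) i j| <= c) (nbhs p)) => j.
    have : Ck 0 U (fun a => (J a *m B) i j).
      by apply: (algebra_mulmx (Pc 0) (Pa (k := 0)) (Pm (k := 0)) i j (CJ 0)) => k l; exact: Pc.
    move=> /(_ p Up).
    move=> /cvgrPdist_le /(_ c c_gt0); apply: filterS => a.
    have E : J p *m B = 1%:M by rewrite mulmxV // unitmxE unitfE.
    by rewrite E => H; rewrite [X in `|X|]mxE [X in _ + X]mxE.
  by near=> a; split; near: a.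
have /nbhs_normP[r /= r0 Hr] := near1.
exists (r / 2); rewrite divr_gt0 //; split => // a ar; apply: Hr => /=.
rewrite distrC; apply: le_lt_trans ar _; rewrite ltr_pdivrMr // mulr2n; lra.
Unshelve. all: by end_near. Qed.

Let r := projT1 (cid good_radius).
Let r_gt0 : 0 < r. Proof. exact: (projT2 (cid good_radius)).1. Qed.
Let r_good a : `|a - p| <= r ->
  [/\ U a, \det (J a) != 0 & forall i j, `|(1%:M - J a *m B) i j| <= c].
Proof. exact: (projT2 (cid good_radius)).2. Qed.

Let K : R := n%:R * `|B|.

(* The fixed points of z |-> S z + y *m B are the solutions of f z = y. *)
Let S (z : 'rV[R]_n) := z - f z *m B.

Let dPhi a j : U a -> differentiable (Phi j) a.
Proof. by have [H _] := CPhi j 1%N; exact: H. Qed.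

Let df a : U a -> differentiable f a.
Proof. by move=> Ua; apply: differentiable_row => j; exact: dPhi. Qed.

Let dfE a v : U a -> 'd f a v = v *m J a.
Proof.
move=> Ua; rewrite diff_row; last by move=> j; exact: dPhi.
apply/rowP => j; rewrite !mxE deriveE; last exact: dPhi.
rewrite diff_rowE; last exact: dPhi.
by apply: eq_bigr => k _; rewrite mxE.
Qed.

Let S_contr z z' : `|z - p| <= r -> `|z' - p| <= r ->
  `|S z - S z'| <= 2^-1 * `|z - z'|.
Proof.
move=> zr z'r; apply: mx_norm_le => [|i' j]; first by rewrite mulr_ge0.
rewrite ord1 mxE [in X in _ + X]mxE => {i'}.
have aB : Cinfty setT (fun b : 'rV[R]_n => (0 + b *m B) 0 j) by apply/Cinfty_affine/openT.
pose x : 'rV[R]_n -> R := fun a => a 0 j.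
pose q : 'rV[R]_n -> R := fun a => (0 + (\row_k Phi k a) *m B) 0 j.
have SE : (fun a => S a 0 j) = x - q.
  by apply/funext => a; rewrite [LHS]mxE [X in _ + X]mxE -[f a *m B]add0r.
have dx a : differentiable x a by exact: differentiable_coord.
have dB v a (Ua : U a) := chain_rule v (fun k => dPhi k Ua) ((aB 1%N).1 _ I).
have dS a : U a -> differentiable (fun a => S a 0 j) a.
  by move=> Ua; have [d _] := dB 0 a Ua; rewrite SE; exact: differentiableB.
have DS a v : U a -> 'D_v (fun a => S a 0 j) a = (v *m (1%:M - J a *m B)) 0 j.
  move=> Ua; have [d D] := dB v a Ua.
  rewrite SE deriveB; [|exact: diff_derivable|exact: diff_derivable].
  rewrite derive_coord D mulmxBr mulmx1 mulmxA [RHS]mxE [in X in _ = _ + X]mxE -dfE //.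
  congr (_ - _); rewrite mxE; apply: eq_bigr => k _.
  by rewrite derive_affine -rowE mxE diff_row ?mxE // => l; exact: dPhi.
apply: le_trans (_ : 2^-1 * `|z - z'| <= _) => //.
apply: (@mean_value_ball R n (fun a => S a 0 j) p r) => // [a ar|a v ar].
  by have [Ua _ _] := r_good ar; exact: dS.
have [Ua _ Jc] := r_good ar; rewrite DS // mxE.
apply: le_trans (ler_norm_sum _ _ _) _.
apply: (@le_trans _ _ (\sum_(k < n) (`|v| * c))).
  by apply: ler_sum => k _; rewrite normrM ler_pM // mx_entry_le_norm.
rewrite sumr_const card_ord -[leLHS]mulr_natl mulrCA mulrC ler_wpM2r //.
rewrite /c invfM mulrCA ler_piMr // ler_pdivrMr // mul1r ler_nat; exact: leqnSn.
Qed.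

Let f_inj z z' : `|z - p| <= r -> `|z' - p| <= r ->
  `|z - z'| <= 2 * K * `|f z - f z'|.
Proof.
move=> zr z'r.
have E : z - z' = (S z - S z') + (f z - f z') *m B.
  by rewrite /S mulmxBl; apply/rowP => k; rewrite !mxE; ring.
have := ler_normD (S z - S z') ((f z - f z') *m B); rewrite -E.
have := S_contr zr z'r; have := mulmx_norm_le (f z - f z') B; rewrite -/K.
move: (`|S z - _|) (`|_ *m B|) (`|z - z'|) (`|f z - _|) => x1 x2 x3 x4; lra.
Qed.

(* For y within d of f p the map z |-> S z + y *m B preserves the closed ball of
   radius r about p; K + 1 rather than K because K = 0 when n = 0. *)
Let d : R := r / (2 * (K + 1)).
Let K_ge0 : 0 <= K. Proof. by rewrite mulr_ge0. Qed.
Let d_gt0 : 0 < d. Proof. by rewrite divr_gt0 // mulr_gt0 // ltr_wpDl. Qed.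

Let f_surj y : `|y - f p| < d -> exists z, `|z - p| <= r /\ f z = y.
Proof.
move=> yd; pose C := [set z : 'rV[R]_n | `|z - p| <= r].
pose T z := S z + y *m B.
have TC : {homo T : z / C z >-> C z}.
  move=> z zr; rewrite /C /= in zr *.
  have pr : `|p - p| <= r by rewrite subrr normr0 ltW.
  have -> : T z - p = (S z - S p) + (y - f p) *m B.
    by rewrite /T /S mulmxBl; apply/rowP => k; rewrite !mxE; ring.
  apply: le_trans (ler_normD _ _) _.
  have H1 := S_contr zr pr; have H2 := mulmx_norm_le (y - f p) B; rewrite -/K in H2.
  have H3 : K * `|y - f p| <= r / 2.
    apply: (@le_trans _ _ (K * d)); first by rewrite ler_wpM2l // ltW.
    have -> : K * d = (r / 2) * (K / (K + 1)).
      by rewrite /d; field; rewrite gt_eqF // ltr_wpDl.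
    rewrite ler_piMr ?divr_ge0 ?(ltW r_gt0) // ler_pdivrMr ?mul1r ?lerDl //.
    by rewrite ltr_wpDl.
  move: H1 H2 H3 zr; move: (`|S z - _|) (`|_ *m B|) (K * _) (`|z - p|) => x1 x2 x3 x4; lra.
have [|||z Cz zE] := @banach_fixed_point R 'rV[R]_n C (mkfun_fun TC).
- exists (2^-1)%:nng; split => /=; first by rewrite invf_lt1 // ltr1n.
  move=> [z z'] [/= Cz Cz']; rewrite /mkfun /T.
  rewrite [X in X <= _](_ : _ = `|S z - S z'|); first exact: S_contr.
  by congr `|_|; rewrite opprD addrACA subrr addr0.
- have -> : C = [set z | `|p - z| <= r] by apply/seteqP; split => z; rewrite /C /= distrC.
  exact: (@closed_closed_ball_ R 'rV[R]_n p r).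
- by exists p; rewrite /C /= subrr normr0 ltW.
exists z; split => //; move: zE; rewrite /= /mkfun /T /S.
move=> /(congr1 (fun x => (z - x) *m J p)); rewrite subrr mul0mx.
rewrite opprD opprB addrA [z + _]addrC subrK mulmxBl -!mulmxA.
by rewrite mulVmx ?unitmxE ?unitfE // !mulmx1 => /esym/eqP; rewrite subr_eq0 => /eqP.
Qed.

(** The local inverse Psi is Lipschitz by [f_inj], hence differentiable with the
inverse Jacobian at Psi as derivative. This is a smooth expression in Psi, so that
Psi is of class C^(k+1) whenever it is of class C^k. *)
Theorem inverse_function : exists (V : set 'rV[R]_n) (Psi : 'rV[R]_n -> 'rV[R]_n),
  [/\ open V, V (\row_j Phi j p), Psi (\row_j Phi j p) = p,
      forall y, V y -> U (Psi y) /\ \row_j Phi j (Psi y) = y &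
      forall i, Cinfty V (fun y => Psi y 0 i)].
Proof.
pose V := [set y : 'rV[R]_n | `|f p - y| < d].
pose Psi y : 'rV[R]_n := get [set z : 'rV[R]_n | `|z - p| <= r /\ f z = y].
have PsiP y : V y -> `|Psi y - p| <= r /\ f (Psi y) = y.
  move=> Vy; have [|z Hz] := @f_surj y; first by rewrite distrC.
  exact: (@getI _ [set z : 'rV[R]_n | `|z - p| <= r /\ f z = y] z).
have oV : open V by have := @ball_open R 'rV[R]_n (f p) d; rewrite -ball_normE.
have Vp : V (f p) by rewrite /V /= subrr normr0.
have PsiU y : V y -> U (Psi y) by move=> /PsiP[/r_good[]].
have PsiJ y : V y -> \det (J (Psi y)) != 0 by move=> /PsiP[/r_good[]].
have nV y : V y -> \forall k \near 0, V (k + y).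
  move=> Vy; have : \forall z \near y, V z by exact: open_nbhs_nbhs.
  by rewrite (near_shift 0 y) subr0.
have Psi_lip y k : V y -> V (k + y) -> `|Psi (k + y) - Psi y| <= 2 * K * `|k|.
  move=> /PsiP[y1 y2] /PsiP[k1 k2]; have := f_inj k1 y1.
  by rewrite k2 y2 addrK.
have dPsi y : V y -> differentiable Psi y /\
    'd Psi y = mulmxr (invmx (J (Psi y))) :> ('rV[R]_n -> 'rV[R]_n).
  move=> Vy; apply: differential_eps; first exact: mulmxr_continuous.
  move=> e e0; set Ji := invmx _.
  (* with h = Psi (k + y) - Psi y, the error is -(f (Psi y + h) - f (Psi y) - h *m J) *m Ji,
     and |h| <= 2 K |k| *)
  pose L := n%:R * `|Ji| * (2 * K) + 1.
  have L0 : 0 < L by rewrite ltr_wpDl // !mulr_ge0.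
  have eL : 0 < e / L by rewrite divr_gt0.
  have := differentiable_eps (df (PsiU _ Vy)) eL.
  move=> /nbhs_normP[/= g g0 Hg].
  have : \forall k \near (0 : 'rV[R]_n), `|k| < g / (2 * K + 1).
    have g1 : 0 < g / (2 * K + 1) by rewrite divr_gt0 // ltr_wpDl // mulr_ge0.
    have := @nbhs0_lt R 'rV[R]_n _ g1.
    by [].
  have := nV _ Vy; apply: filterS2 => k Vk kg /=.
  set h := Psi (k + y) - Psi y.
  have hk : `|h| <= 2 * K * `|k| by exact: Psi_lip.
  have := Hg h; rewrite /= sub0r normrN => H.
  have hg : `|h| < g.
    apply: le_lt_trans hk _; move: kg; rewrite ltr_pdivlMr; last by rewrite ltr_wpDl // mulr_ge0.
    by apply: le_lt_trans; rewrite mulrDr mulr1 mulrC lerDl.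
  have {}H := H hg.
  rewrite {1}/h subrK (PsiP _ Vk).2 (PsiP _ Vy).2 dfE in H; last exact: PsiU.
  have -> : Psi (k + y) - (Psi y + k *m Ji) = - ((k + y - (y + h *m J (Psi y))) *m Ji).
    have -> : k + y - (y + h *m J (Psi y)) = k - h *m J (Psi y).
      by apply/rowP => i; rewrite !mxE; ring.
    rewrite mulmxBl -mulmxA mulmxV ?unitmxE ?unitfE ?PsiJ // mulmx1 /h.
    by apply/rowP => i; rewrite !mxE; ring.
  rewrite normrN; apply: le_trans (mulmx_norm_le _ _) _.
  apply: (@le_trans _ _ (n%:R * `|Ji| * (e / L * (2 * K * `|k|)))).
    rewrite ler_wpM2l ?mulr_ge0 //; apply: le_trans H _.
    by rewrite ler_wpM2l // ltW.
  rewrite [leLHS](_ : _ = e * `|k| * ((L - 1) / L)); last by rewrite /L; field; rewrite gt_eqF.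
  by rewrite ler_piMr ?mulr_ge0 // ?(ltW e0) // ler_pdivrMr // mul1r gerBl.
exists V, Psi; split => //.
- have [h1 h2] := PsiP _ Vp; apply/eqP; rewrite -subr_eq0 -normr_le0.
  have pr : `|p - p| <= r by rewrite subrr normr0 ltW.
  by have := f_inj h1 pr; rewrite h2 subrr normr0 mulr0.
- by move=> y Vy; split; [exact: PsiU|exact: (PsiP _ Vy).2].
move=> i k; move: i; elim: k => [|k IH] i.
  move=> y Vy; have [dP _] := dPsi _ Vy.
  apply: (@continuous_comp _ _ _ Psi (fun x : 'rV[R]_n => x 0 i)); first exact: differentiable_continuous.
  exact: coord_continuous.
split => [y Vy|l].
  apply: (@differentiable_comp _ _ _ _ Psi (fun x : 'rV[R]_n => x 0 i)).
    exact: (dPsi _ Vy).1.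
  exact: differentiable_coord.
have CJPsi i' j' : Ck k V (fun y => J (Psi y) i' j').
  have := @Ck_comp R n V oV k n U (fun i y => Psi y 0 i) (fun a => J a i' j').
  have PE y : \row_i Psi y 0 i = Psi y by apply/rowP => ?; rewrite mxE.
  move=> /(_ _ IH (CJ k i' j')).
  have -> : (fun a => J (\row_i0 Psi a 0 i0) i' j') = (fun y => J (Psi y) i' j').
    by apply/funext => y; rewrite PE.
  by apply => y Vy; rewrite PE; exact: PsiU.
have := Ck_invmx l i oV PsiJ CJPsi.
apply: (Ck_ext oV) => y Vy.
have [dP dE] := dPsi _ Vy.
have -> : 'D_(delta_mx 0 l) (fun y => Psi y 0 i) y = ('D_(delta_mx 0 l) Psi y) 0 i.
  by rewrite derive_mx ?mxE //; exact: diff_derivable.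
by rewrite deriveE // dE /= -rowE mxE.
Qed.

End InverseFunction.

(** * Germs of smooth functions and maps *)

Section Spaces.
Variable R : realType.

Lemma open_near (T : topologicalType) (A B C : set T) :
  (forall a, C a -> (\forall b \near a, A b) /\ \forall b \near a, B b) ->
  (forall a, A a -> B a -> C a) -> open C.
Proof.
move=> H ABC; rewrite openE => a /H[HA HB].
exact: (@filterS2 _ (nbhs a) _ A B C ABC HA HB).
Qed.

Lemma differentiable_lsub (k1 k2 : nat) (a : 'rV[R]_(k1 + k2)) :
  {for a, continuous (@lsubmx R 1 k1 k2)}.
Proof. exact/differentiable_continuous/differentiable_lsubmx. Qed.

Lemma differentiable_rsub (k1 k2 : nat) (a : 'rV[R]_(k1 + k2)) :
  {for a, continuous (@rsubmx R 1 k1 k2)}.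
Proof. exact/differentiable_continuous/differentiable_rsubmx. Qed.

Definition join_set (k1 k2 : nat) (U1 : set 'rV[R]_k1) (U2 : set 'rV[R]_k2) :
  set 'rV[R]_(k1 + k2) := [set a | U1 (lsubmx a) /\ U2 (rsubmx a)].

Lemma open_join k1 k2 (U1 : set 'rV[R]_k1) (U2 : set 'rV[R]_k2) :
  open U1 -> open U2 -> open (join_set U1 U2).
Proof.
move=> o1 o2; apply: (open_near (A := fun a => U1 (lsubmx a)) (B := fun a => U2 (rsubmx a))) => //.
move=> a [a1 a2]; split.
  exact: (differentiable_lsub (open_nbhs_nbhs (conj o1 a1))).
exact: (differentiable_rsub (open_nbhs_nbhs (conj o2 a2))).
Qed.

Lemma Cinfty_lsub k1 k2 (U1 : set 'rV[R]_k1) (U2 : set 'rV[R]_k2) phi :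
  open U1 -> open U2 -> Cinfty U1 phi ->
  Cinfty (join_set U1 U2) (fun a => phi (lsubmx a)).
Proof.
move=> o1 o2 C1 j; have E (a : 'rV[R]_(k1 + k2)) : lsubmx a = \row_i a 0 (lshift k2 i).
  by apply/rowP => i; rewrite !mxE.
under [X in Ck _ _ X]eq_fun do rewrite E.
apply: (Ck_comp (open_join o1 o2) (V := U1)) => //.
  by move=> a [+ _]; rewrite E.
by move=> i; exact: Ck_coord.
Qed.

Lemma Cinfty_rsub k1 k2 (U1 : set 'rV[R]_k1) (U2 : set 'rV[R]_k2) phi :
  open U1 -> open U2 -> Cinfty U2 phi ->
  Cinfty (join_set U1 U2) (fun a => phi (rsubmx a)).
Proof.
move=> o1 o2 C1 j; have E (a : 'rV[R]_(k1 + k2)) : rsubmx a = \row_i a 0 (rshift k1 i).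
  by apply/rowP => i; rewrite !mxE.
under [X in Ck _ _ X]eq_fun do rewrite E.
apply: (Ck_comp (open_join o1 o2) (V := U2)) => //.
  by move=> a [_ +]; rewrite E.
by move=> i; exact: Ck_coord.
Qed.

Lemma Cinfty_comp n m (U : set 'rV[R]_n) (V : set 'rV[R]_m)
    (F : 'I_m -> 'rV[R]_n -> R) phi : open U ->
  (forall a, U a -> V (\row_i F i a)) -> (forall i, Cinfty U (F i)) -> Cinfty V phi ->
  Cinfty U (fun a => phi (\row_i F i a)).
Proof. by move=> oU H1 H2 H3 j; apply: (Ck_comp oU H1 _ (H3 j)) => i; exact: H2. Qed.

Lemma open_preimage_row n m (U : set 'rV[R]_n) (V : set 'rV[R]_m)
    (F : 'I_m -> 'rV[R]_n -> R) :
  open U -> open V -> (forall i, Cinfty U (F i)) ->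
  open (U `&` [set a | V (\row_i F i a)]).
Proof.
move=> oU oV FC; apply: (open_near (A := U) (B := fun a => V (\row_i F i a))) => //.
move=> a [Ua Va]; split; first exact: open_nbhs_nbhs.
apply: row_continuous_nbhs; last exact: open_nbhs_nbhs.
by move=> i; exact: (FC i 0%N).
Qed.

(** Neighbourhoods in the topology generated by the coordinate functions. They
form a filter, so that finitely many properties holding near x hold together. *)
Definition snbhs (X : smoothSpace R) (x : X) : set_system X := fun P =>
  exists (k : nat) (h : 'I_k -> X -> R) (U : set 'rV[R]_k),
    [/\ forall i, coords (h i), open U, U (tuple_map h x) &
        forall y, carr y -> U (tuple_map h y) -> P y].

(** The condition that [smooth_fun] imposes at the point x. Charts and
trivializations have components that are smooth on an open set only, and need not
extend to smooth functions on X. *)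
Definition smooth_near (X : smoothSpace R) (x : X) (f : X -> R) :=
  exists (k : nat) (h : 'I_k -> X -> R) (U : set 'rV[R]_k) (phi : 'rV[R]_k -> R),
    [/\ forall i, coords (h i), open U, U (tuple_map h x), Cinfty U phi &
        forall y, carr y -> U (tuple_map h y) -> f y = phi (tuple_map h y)].

Definition smap_near (X Y : smoothSpace R) (x : X) (F : X -> Y) :=
  (\forall y \near snbhs x, carr (F y)) /\
  forall h, coords h -> smooth_near x (h \o F).

Section OneSpace.
Variable X : smoothSpace R.
Implicit Types (x y : X) (P Q : set X) (f g : X -> R).

Definition join_coords k1 k2 (h1 : 'I_k1 -> X -> R) (h2 : 'I_k2 -> X -> R) :
    'I_(k1 + k2) -> X -> R :=
  fun i => match fintype.split i with inl j => h1 j | inr j => h2 j end.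

Lemma join_coordsP k1 k2 (h1 : 'I_k1 -> X -> R) (h2 : 'I_k2 -> X -> R) :
  (forall i, coords (h1 i)) -> (forall i, coords (h2 i)) ->
  forall i, coords (join_coords h1 h2 i).
Proof. by move=> c1 c2 i; rewrite /join_coords; case: fintype.split. Qed.

Lemma tuple_map_join k1 k2 (h1 : 'I_k1 -> X -> R) (h2 : 'I_k2 -> X -> R) y :
  tuple_map (join_coords h1 h2) y = row_mx (tuple_map h1 y) (tuple_map h2 y).
Proof.
by apply/rowP => i; rewrite !mxE /join_coords; case: fintype.split => j; rewrite mxE.
Qed.

Lemma join_setP k1 k2 (h1 : 'I_k1 -> X -> R) (h2 : 'I_k2 -> X -> R) U1 U2 y :
  join_set U1 U2 (tuple_map (join_coords h1 h2) y) <->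
  U1 (tuple_map h1 y) /\ U2 (tuple_map h2 y).
Proof. by rewrite /join_set /= tuple_map_join row_mxKl row_mxKr. Qed.

Lemma snbhs_filter x : Filter (snbhs x).
Proof.
split.
- exists 0%N, (fun=> fun=> 0), setT; split => //; [by case|exact: openT].
- move=> P Q [k1 [h1 [U1 [c1 o1 u1 H1]]]] [k2 [h2 [U2 [c2 o2 u2 H2]]]].
  exists (k1 + k2)%N, (join_coords h1 h2), (join_set U1 U2); split.
  + exact: join_coordsP.
  + exact: open_join.
  + exact/join_setP.
  + by move=> y cy /join_setP[y1 y2]; split; [exact: H1|exact: H2].
- by move=> P Q PQ [k [h [U [c o u H]]]]; exists k, h, U; split=> // y cy /H; auto.
Qed.
#[export] Existing Instance snbhs_filter.

Lemma snbhs_self x P : carr x -> snbhs x P -> P x.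
Proof. by move=> cx [k [h [U [c o u H]]]]; exact: H. Qed.

Lemma snbhs_carr x : \forall y \near snbhs x, carr y.
Proof.
by exists 0%N, (fun=> fun=> 0), setT; split => //; [case|exact: openT].
Qed.

Lemma snbhs_snbhs x P : snbhs x P -> \forall y \near snbhs x, snbhs y P.
Proof.
move=> [k [h [U [c o u H]]]]; exists k, h, U; split=> // y cy Uy.
by exists k, h, U; split.
Qed.

(** Finitely many functions that are smooth near x are simultaneously functions of
one tuple of coordinates: join the tuples. *)
Lemma smooth_near_common m (F : 'I_m -> X -> R) x P :
  snbhs x P -> (forall i, smooth_near x (F i)) ->
  exists k (h : 'I_k -> X -> R) (U : set 'rV[R]_k) (phi : 'I_m -> 'rV[R]_k -> R),
  [/\ forall i, coords (h i), open U, U (tuple_map h x), forall i, Cinfty U (phi i) &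
    forall y, carr y -> U (tuple_map h y) -> P y /\ forall i, F i y = phi i (tuple_map h y)].
Proof.
move=> xP; elim: m F => [|m IH] F HF.
  have [k [h [U [c o u H]]]] := xP.
  by exists k, h, U, (fun=> fun=> 0); split=> //; [case|move=> y cy /H Hy; split; [exact: Hy|case]].
have [k1 [h1 [U1 [phi1 [c1 o1 u1 C1 H1]]]]] := IH (fun i => F (lift ord0 i)) (fun i => HF _).
have [k2 [h2 [U2 [phi2 [c2 o2 u2 C2 H2]]]]] := HF ord0.
exists (k1 + k2)%N, (join_coords h1 h2), (join_set U1 U2),
  (fun i => match unlift ord0 i with
    | None => fun a => phi2 (rsubmx a) | Some j => fun a => phi1 j (lsubmx a) end).
split.
- exact: join_coordsP.
- exact: open_join.
- exact/join_setP.
- by move=> i; case: unlift => [j|]; [exact: Cinfty_lsub|exact: Cinfty_rsub].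
- move=> y cy /join_setP[y1 y2]; have [Py E1] := H1 _ cy y1; split => // i.
  rewrite tuple_map_join; case: unliftP => [j ->|->].
    by rewrite row_mxKl E1.
  by rewrite row_mxKr H2.
Qed.

Lemma smooth_near_ext x f g :
  (\forall y \near snbhs x, f y = g y) -> smooth_near x f -> smooth_near x g.
Proof.
move=> fg sf; have [k [h [U [phi [c o u C H]]]]] := @smooth_near_common 1 (fun=> f) x _ fg (fun=> sf).
exists k, h, U, (phi ord0); split=> // y cy Uy.
by have [/= <- /(_ ord0)] := H _ cy Uy.
Qed.

Lemma smooth_near_comp m (F : 'I_m -> X -> R) (V : set 'rV[R]_m) phi x :
  carr x -> (forall i, smooth_near x (F i)) -> open V -> V (\row_i F i x) ->
  Cinfty V phi -> smooth_near x (fun y => phi (\row_i F i y)).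
Proof.
move=> cx sF oV Vx Cphi.
have [k [h [U [psi [c o u C H]]]]] := smooth_near_common (@filterT _ _ (snbhs_filter x)) sF.
have E y : carr y -> U (tuple_map h y) -> \row_i F i y = \row_i psi i (tuple_map h y).
  by move=> cy Uy; apply/rowP => i; rewrite !mxE; have [_ ->] := H _ cy Uy.
pose U' := U `&` [set a | V (\row_i psi i a)].
exists k, h, U', (fun a => phi (\row_i psi i a)); split => //.
- exact: open_preimage_row.
- by split => //=; rewrite -E.
- apply: Cinfty_comp Cphi; first exact: open_preimage_row.
    by move=> a [].
  by move=> i j; apply: Ck_sub (C i j) => a [].
- by move=> y cy [Uy _]; rewrite E.
Qed.

Lemma smooth_near_continuous x f (A : set R) : carr x -> smooth_near x f ->
  nbhs (f x) A -> \forall y \near snbhs x, A (f y).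
Proof.
move=> cx [k [h [U [phi [c o u C H]]]]] fA.
exists k, h, (U `&` [set a | A° (phi a)]); split => //.
- apply: (open_near (A := U) (B := fun a => A° (phi a))) => // a [Ua Aa].
  split; first exact: open_nbhs_nbhs.
  by apply: (C 0%N a Ua); apply: open_nbhs_nbhs; split => //; exact: open_interior.
- by split=> //=; rewrite -H.
- by move=> y cy [Uy]; rewrite /= -H // => /interior_subset.
Qed.

Lemma smooth_near_cst x c : smooth_near x (fun=> c).
Proof.
exists 0%N, (fun=> fun=> 0), setT, (fun=> c); split => //; [by case|exact: openT|].
by move=> j; exact: Ck_cst.
Qed.

Lemma smooth_near_coords x h : coords h -> smooth_near x h.
Proof.
move=> ch; exists 1%N, (fun=> h), setT, (fun a => a 0 0); split => //; first exact: openT.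
  by move=> j; exact: Ck_coord.
by move=> y _ _; rewrite mxE.
Qed.

(** The binary case of [smooth_near_comp], with the pair of f and g indexed by 'I_2. *)
Lemma smooth_near_op2 (op : R -> R -> R) x f g : carr x ->
  Cinfty setT (fun a : 'rV[R]_2 => op (a 0 0) (a 0 1)) ->
  smooth_near x f -> smooth_near x g -> smooth_near x (fun y => op (f y) (g y)).
Proof.
move=> cx opC sf sg.
pose F (i : 'I_2) := if i == 0 then f else g.
have sF i : smooth_near x (F i) by rewrite /F; case: (i == 0).
have -> : (fun y => op (f y) (g y)) =
    (fun y => op ((\row_i F i y : 'rV_2) 0 0) ((\row_i F i y : 'rV_2) 0 1)).
  by apply/funext => y; rewrite !mxE.
exact: (smooth_near_comp cx sF openT I opC).
Qed.

Lemma smooth_near_add x f g : carr x -> smooth_near x f -> smooth_near x g ->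
  smooth_near x (fun y => f y + g y).
Proof.
move=> cx; apply: (smooth_near_op2 (op := +%R)) => // j.
by apply: Ck_add; [exact: openT|exact: Ck_coord|exact: Ck_coord].
Qed.

Lemma smooth_near_mul x f g : carr x -> smooth_near x f -> smooth_near x g ->
  smooth_near x (fun y => f y * g y).
Proof.
move=> cx; apply: (smooth_near_op2 (op := *%R)) => // j.
by apply: Ck_mul; [exact: openT|exact: Ck_coord|exact: Ck_coord].
Qed.

Lemma smooth_near_inv x f : carr x -> f x != 0 -> smooth_near x f ->
  smooth_near x (fun y => (f y)^-1).
Proof.
move=> cx fx0 sf; pose V := [set a : 'rV[R]_1 | a 0 0 != 0].
have oV : open V.
  rewrite openE => a Va; have := @coord_continuous R 1 1 0 0 a.
  by move=> dc; exact: (cvgr_neq0 _ dc Va).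
have CV : Cinfty V (fun a => (a 0 0)^-1).
  by move=> j; apply: Ck_inv => //; exact: Ck_coord.
have Vx : V (\row_i (fun=> f) i x) by rewrite /V /= mxE.
have := @smooth_near_comp 1 (fun=> f) V _ x cx (fun=> sf) oV Vx CV.
by under [X in smooth_near x X -> _]eq_fun do rewrite mxE.
Qed.

Lemma smooth_near_sum x (I : finType) (F : I -> X -> R) : carr x ->
  (forall i, smooth_near x (F i)) -> smooth_near x (fun y => \sum_i F i y).
Proof.
move=> cx; apply: algebra_sum; first exact: smooth_near_cst.
by move=> f g; exact: smooth_near_add.
Qed.

(** For row vectors this is local smoothness of a map into R^n, see [smap_near_mx];
matrices appear as the local expressions of bundle maps. *)
Definition smooth_mx m n x (A : X -> 'M[R]_(m, n)) :=
  forall i j, smooth_near x (fun y => A y i j).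

Lemma smooth_mx_cst x m n (A : 'M[R]_(m, n)) : smooth_mx x (fun=> A).
Proof. by move=> i j; exact: smooth_near_cst. Qed.

Lemma smooth_mx_ext x m n (A B : X -> 'M[R]_(m, n)) :
  (\forall y \near snbhs x, A y = B y) -> smooth_mx x A -> smooth_mx x B.
Proof.
by move=> AB sA i j; apply: smooth_near_ext (sA i j); move: AB; apply: filterS => y ->.
Qed.

Lemma smooth_mx_add x m n (A B : X -> 'M[R]_(m, n)) : carr x ->
  smooth_mx x A -> smooth_mx x B -> smooth_mx x (fun y => A y + B y).
Proof.
move=> cx sA sB i j; have := smooth_near_add cx (sA i j) (sB i j).
by congr smooth_near; apply/funext => y; rewrite mxE.
Qed.

Lemma smooth_mx_sub x m n (A B : X -> 'M[R]_(m, n)) : carr x ->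
  smooth_mx x A -> smooth_mx x B -> smooth_mx x (fun y => A y - B y).
Proof.
move=> cx sA sB; apply: smooth_mx_add => // i j.
have := smooth_near_mul cx (smooth_near_cst x (-1)) (sB i j).
by congr smooth_near; apply/funext => y; rewrite mxE mulN1r.
Qed.

Lemma smooth_mx_mul x m n p (A : X -> 'M[R]_(m, n)) (B : X -> 'M[R]_(n, p)) : carr x ->
  smooth_mx x A -> smooth_mx x B -> smooth_mx x (fun y => A y *m B y).
Proof.
move=> cx sA sB i j; move: sA sB.
exact: (algebra_mulmx (@smooth_near_cst x) (fun f g => smooth_near_add cx) (fun f g => smooth_near_mul cx)).
Qed.

Lemma smooth_near_det x n (A : X -> 'M[R]_n) : carr x -> smooth_mx x A ->
  smooth_near x (fun y => \det (A y)).
Proof.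
move=> cx; exact: (algebra_det (@smooth_near_cst x) (fun f g => smooth_near_add cx) (fun f g => smooth_near_mul cx)).
Qed.

Lemma det_near x n (A : X -> 'M[R]_n) : carr x -> smooth_mx x A -> \det (A x) != 0 ->
  \forall y \near snbhs x, \det (A y) != 0.
Proof.
move=> cx sA d; apply: (smooth_near_continuous (A := [set z | z != 0]) cx).
  exact: smooth_near_det.
exact: (cvgr_neq0 _ cvg_id d).
Qed.

Lemma smooth_mx_inv x n (A : X -> 'M[R]_n) : carr x -> smooth_mx x A ->
  \det (A x) != 0 -> smooth_mx x (fun y => invmx (A y)).
Proof.
move=> cx sA d i j.
have sadj : smooth_near x (fun y => (\adj (A y)) i j).
  exact: (algebra_adj (@smooth_near_cst x) (fun f g => smooth_near_add cx) (fun f g => smooth_near_mul cx)).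
have sdet := smooth_near_inv cx d (smooth_near_det cx sA).
apply: smooth_near_ext (smooth_near_mul cx sdet sadj).
have := det_near cx sA d; apply: filterS => y dy.
by rewrite /invmx unitmxE unitfE dy [RHS]mxE.
Qed.

Lemma smooth_mx_row x m n p (A : X -> 'M[R]_(m, n)) (B : X -> 'M[R]_(m, p)) :
  smooth_mx x A -> smooth_mx x B -> smooth_mx x (fun y => row_mx (A y) (B y)).
Proof.
move=> sA sB i j; rewrite -(splitK j); case: (fintype.split j) => k /=.
  by have := sA i k; congr smooth_near; apply/funext => y; rewrite row_mxEl.
by have := sB i k; congr smooth_near; apply/funext => y; rewrite row_mxEr.
Qed.

Lemma smooth_mx_lsub x m n p (A : X -> 'M[R]_(m, n + p)) :
  smooth_mx x A -> smooth_mx x (fun y => lsubmx (A y)).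
Proof.
move=> sA i j; have := sA i (lshift p j).
by congr smooth_near; apply/funext => y; rewrite mxE.
Qed.

Lemma smooth_mx_rsub x m n p (A : X -> 'M[R]_(m, n + p)) :
  smooth_mx x A -> smooth_mx x (fun y => rsubmx (A y)).
Proof.
move=> sA i j; have := sA i (rshift n j).
by congr smooth_near; apply/funext => y; rewrite mxE.
Qed.

End OneSpace.
#[export] Existing Instance snbhs_filter.

#[export] Instance near_snbhs_filter (X : smoothSpace R) (x : X) :
  Filter (nbhs (snbhs x)) := snbhs_filter x.

Section Maps.
Variables X Y Z : smoothSpace R.

Lemma smooth_mapP (F : X -> Y) :
  smooth_map F <-> forall x, carr x -> smap_near x F.
Proof.
split=> [[H1 H2] x cx|H].
  split; last by move=> h ch; exact: H2.
  by have := snbhs_carr x; apply: filterS.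
split=> [x cx|h ch x cx]; first by have [/(snbhs_self cx)] := H _ cx.
by have [_ /(_ _ ch)] := H _ cx.
Qed.

Lemma smooth_map_near (F : X -> Y) x : smooth_map F -> carr x -> smap_near x F.
Proof. by move=> /smooth_mapP sF; exact: sF. Qed.

Lemma smap_near_snbhs (F : X -> Y) x P : carr x -> smap_near x F ->
  snbhs (F x) P -> \forall y \near snbhs x, P (F y).
Proof.
move=> cx [cF sF] [k [h [U [c o u H]]]].
have [l [g [V [phi [gc oV Vx C E]]]]] :=
  smooth_near_common cF (fun i => sF _ (c i)).
have tE y : carr y -> V (tuple_map g y) ->
    tuple_map h (F y) = \row_i phi i (tuple_map g y).
  by move=> cy Vy; apply/rowP => i; rewrite !mxE; have [_ <-] := E _ cy Vy.
exists l, g, (V `&` [set a | U (\row_i phi i a)]); split => //.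
- exact: open_preimage_row.
- by split => //=; rewrite -tE.
- by move=> y cy [Vy /=]; rewrite -tE // => /H; apply; have [] := E _ cy Vy.
Qed.

Lemma smap_near_smooth (F : X -> Y) x f : carr x -> smap_near x F ->
  smooth_near (F x) f -> smooth_near x (f \o F).
Proof.
move=> cx sF [k [h [U [phi [c o u C H]]]]].
have E y : \row_i (h i \o F) y = tuple_map h (F y) by apply/rowP => i; rewrite !mxE.
have := @smooth_near_comp X k (fun i => h i \o F) U phi x cx.
rewrite E => /(_ _ o u C) S; have {}S := S (fun i => sF.2 _ (c i)).
apply: smooth_near_ext S.
have : \forall y \near snbhs x, phi (tuple_map h (F y)) = f (F y).
  apply: (smap_near_snbhs (P := fun z => phi (tuple_map h z) = f z) cx sF).
  by exists k, h, U; split => // y cy Uy; rewrite H.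
by apply: filterS => y; rewrite E.
Qed.

Lemma smap_near_comp (F : X -> Y) (G : Y -> Z) x : carr x ->
  smap_near x F -> smap_near (F x) G -> smap_near x (G \o F).
Proof.
move=> cx sF sG; split; first exact: (smap_near_snbhs cx sF sG.1).
by move=> h ch; exact: (smap_near_smooth (f := h \o G) cx sF (sG.2 _ ch)).
Qed.

Lemma smooth_mx_comp (F : X -> Y) x m n (A : Y -> 'M[R]_(m, n)) : carr x ->
  smap_near x F -> smooth_mx (F x) A -> smooth_mx x (fun y => A (F y)).
Proof. by move=> cx sF sA i j; exact: (smap_near_smooth cx sF (sA i j)). Qed.

Lemma smap_near_ext (F G : X -> Y) x : (\forall y \near snbhs x, F y = G y) ->
  smap_near x F -> smap_near x G.
Proof.
move=> FG [cF sF]; split; first by move: FG cF; apply: filterS2 => y ->.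
move=> h /sF; apply: smooth_near_ext; move: FG; apply: filterS => y /= ->; by [].
Qed.

End Maps.

Lemma smooth_map_comp (X Y Z : smoothSpace R) (F : X -> Y) (G : Y -> Z) :
  smooth_map F -> smooth_map G -> smooth_map (G \o F).
Proof.
move=> sF sG; apply/smooth_mapP => x cx; have cF := sF.1 _ cx.
by apply: smap_near_comp; rewrite ?smooth_map_near //; exact: smooth_map_near.
Qed.

Lemma smooth_map_ext (X Y : smoothSpace R) (F G : X -> Y) :
  (forall x, carr x -> F x = G x) -> smooth_map F -> smooth_map G.
Proof.
move=> FG /smooth_mapP sF; apply/smooth_mapP => x /sF; apply: smap_near_ext.
have := snbhs_carr x; apply: filterS; exact: FG.
Qed.

Lemma smooth_map_id (X : smoothSpace R) : smooth_map (id : X -> X).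
Proof. by split => // h ch x _; exact: smooth_near_coords. Qed.

Lemma smooth_map_fun (X Y : smoothSpace R) (F : X -> Y) f :
  smooth_map F -> smooth_fun f -> smooth_fun (f \o F).
Proof.
move=> sF sf x cx; apply: smap_near_smooth => //; first exact: (smooth_mapP F).1.
exact/sf/sF.1.
Qed.

End Spaces.
#[export] Existing Instance snbhs_filter.
#[export] Existing Instance near_snbhs_filter.

(** * Subspaces, products, R^n and the real line *)

Section StandardSpaces.
Variable R : realType.
Implicit Types X Y Z : smoothSpace R.

Section SubSpace.
Variables (X : smoothSpace R) (A : set X).

Lemma snbhs_sub x P : @snbhs R X x P -> @snbhs R (sub_space A) x P.
Proof.
by move=> [k [h [U [c o u H]]]]; exists k, h, U; split=> // y [cy _]; exact: H.
Qed.

Lemma smooth_near_sub x f : @smooth_near R X x f -> @smooth_near R (sub_space A) x f.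
Proof.
move=> [k [h [U [phi [c o u C H]]]]]; exists k, h, U, phi; split=> // y [cy _]; exact: H.
Qed.

Lemma smap_near_from_sub Y x (F : X -> Y) :
  @smap_near R X Y x F -> @smap_near R (sub_space A) Y x F.
Proof. by move=> [cF sF]; split; [exact: snbhs_sub|move=> h /sF; exact: smooth_near_sub]. Qed.

Lemma smap_near_to_sub Y (y : Y) (F : Y -> X) : snbhs y (F @^-1` A) ->
  @smap_near R Y X y F -> @smap_near R Y (sub_space A) y F.
Proof. by move=> AF [cF sF]; split => //; move: cF AF; apply: filterS2 => z; split. Qed.

Lemma snbhs_open_sub (x : X) P : @snbhs R X x A -> @snbhs R (sub_space A) x P -> @snbhs R X x P.
Proof.
move=> xA [k [h [U [c o u H]]]].
have H' : \forall y \near @snbhs R X x, carr y -> A y -> P y.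
  by exists k, h, U; split => // y cy Uy _ Ay; exact: H.
by move: xA (snbhs_carr x) H'; apply: filterS3 => y Ay cy; exact.
Qed.

Lemma smooth_near_open_sub (x : X) f : @snbhs R X x A ->
  @smooth_near R (sub_space A) x f -> @smooth_near R X x f.
Proof.
move=> xA [k [h [U [phi [c o u C H]]]]].
apply: (@smooth_near_ext R X x (fun y => phi (@tuple_map R X k h y))); last first.
  by exists k, h, U, phi; split.
apply: snbhs_open_sub => //; exists k, h, U; split => // y cy Uy.
by rewrite H.
Qed.

Lemma smap_near_open_sub Y (x : X) (F : X -> Y) : @snbhs R X x A ->
  @smap_near R (sub_space A) Y x F -> @smap_near R X Y x F.
Proof.
move=> xA [cF sF]; split; first exact: snbhs_open_sub.
by move=> h /sF; exact: smooth_near_open_sub.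
Qed.

Lemma smap_near_of_sub Y (y : Y) (F : Y -> X) :
  @smap_near R Y (sub_space A) y F -> @smap_near R Y X y F.
Proof. by move=> [cF sF]; split => //; move: cF; apply: filterS => z []. Qed.
End SubSpace.

Section ProdSpace.
Variables X Y : smoothSpace R.

Lemma smap_near_fst p : smap_near (X := prod_space X Y) p (fst : prod_space X Y -> X).
Proof.
split; first by have := snbhs_carr (p : prod_space X Y); apply: filterS => y [].
by move=> h ch; apply: smooth_near_coords; left; exists h.
Qed.

Lemma smap_near_snd p : smap_near (X := prod_space X Y) p (snd : prod_space X Y -> Y).
Proof.
split; first by have := snbhs_carr (p : prod_space X Y); apply: filterS => y [].
by move=> h ch; apply: smooth_near_coords; right; exists h.
Qed.

Lemma smap_near_pair Z (z : Z) (F : Z -> X) (G : Z -> Y) :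
  smap_near z F -> smap_near z G ->
  smap_near z ((fun w => (F w, G w)) : Z -> prod_space X Y).
Proof.
move=> [cF sF] [cG sG]; split; first by move: cF cG; apply: filterS2 => w; split.
by move=> _ [[h ch <-]|[h ch <-]]; [exact: sF|exact: sG].
Qed.

Lemma snbhs_prod (x : X) (y : Y) (P : set (prod_space X Y)) : carr x -> carr y ->
  @snbhs R (prod_space X Y) (x, y) P ->
  exists A B, [/\ snbhs x A, snbhs y B &
    forall a b, carr a -> carr b -> A a -> B b -> P (a, b)].
Proof.
move=> cx cy [k [h [U [c o u H]]]].
have [B BM BU] : nbhs (tuple_map h (x, y)) U by exact: open_nbhs_nbhs.
have S i : exists AB : set X * set Y, [/\ snbhs x AB.1, snbhs y AB.2 &
    forall a b, AB.1 a -> AB.2 b -> B 0 i (h i (a, b))].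
  have := BM 0 i; rewrite mxE; have [[g cg <-] /= gB|[g cg <-] /= gB] := c i.
    exists ((fun a => B 0 i (g a)), setT); split => //=; last exact: filterT.
    exact: smooth_near_continuous (smooth_near_coords _ cg) _.
  exists (setT, (fun a => B 0 i (g a))); split => //=; first exact: filterT.
  exact: smooth_near_continuous (smooth_near_coords _ cg) _.
have [AB HAB] := boolp.choice S.
exists (fun a => forall i, (AB i).1 a), (fun b => forall i, (AB i).2 b); split.
- apply: (@filter_forall _ _ (fun i => (AB i).1) _ (snbhs_filter x)) => i.
  by have [] := HAB i.
- apply: (@filter_forall _ _ (fun i => (AB i).2) _ (snbhs_filter y)) => i.
  by have [] := HAB i.
- move=> a b ca cb Aa Bb; apply: H; first by split.
  apply: BU => i' i; rewrite ord1 mxE; have [_ _] := HAB i; exact.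
Qed.

End ProdSpace.

Section Euclidean.
Variable n : nat.
Implicit Types (a : euclidean R n).

Lemma euclidean_coord_continuous (h : 'rV[R]_n -> R) : @coords R (euclidean R n) h ->
  continuous h.
Proof. by move=> [i _ <-]; exact: coord_continuous. Qed.

Lemma snbhs_euclidean (a : 'rV[R]_n) (P : set 'rV[R]_n) :
  @snbhs R (euclidean R n) a P <-> nbhs a P.
Proof.
split=> [[k [h [U [c o u H]]]]|aP].
  have : \forall b \near a, U (\row_i h i b).
    apply: row_continuous_nbhs; first by move=> i; exact: euclidean_coord_continuous.
    exact: open_nbhs_nbhs.
  by apply: filterS => b; exact: H.
have E b : @tuple_map R (euclidean R n) n (fun i (b : 'rV_n) => b 0 i) b = b.
  by apply/rowP => i; rewrite mxE.
exists n, (fun i (b : 'rV_n) => b 0 i), (P°); split.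
- by move=> i; exists i.
- exact: open_interior.
- by rewrite E.
- by move=> b _; rewrite E => /interior_subset.
Qed.

Lemma smooth_near_Cinfty (a : 'rV[R]_n) f : @smooth_near R (euclidean R n) a f ->
  exists V, [/\ open V, V a & Cinfty V f].
Proof.
move=> [k [h [U [phi [c o u C H]]]]].
have Ch i : Cinfty setT (h i).
  by have [l _ <-] := c i; move=> j; exact: Ck_coord.
have oV := open_preimage_row openT o Ch.
exists (setT `&` [set a | U (\row_i h i a)]); split => // j.
have C' i : Cinfty (setT `&` [set a | U (\row_i h i a)]) (h i).
  by move=> l; apply: Ck_sub (Ch i l).
apply: (Ck_ext oV) (Cinfty_comp oV _ C' C j) => [b [_ Ub]|b []//].
by rewrite -H.
Qed.

Lemma Cinfty_smooth_near (U : set 'rV[R]_n) (a : 'rV[R]_n) f : open U -> U a -> Cinfty U f ->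
  @smooth_near R (euclidean R n) a f.
Proof.
move=> oU Ua Cf.
have E b : @tuple_map R (euclidean R n) n (fun i (b : 'rV_n) => b 0 i) b = b.
  by apply/rowP => i; rewrite mxE.
exists n, (fun i (b : 'rV_n) => b 0 i), U, f; split => //.
- by move=> i; exists i.
- by rewrite E.
- by move=> y _; rewrite E.
Qed.

(** On an open subset of R^n, the smooth functions in the sense of generating
coordinates are the usual ones. *)
Lemma CinftyP (U : set 'rV[R]_n) f : open U ->
  (forall a, U a -> @smooth_near R (euclidean R n) a f) -> Cinfty U f.
Proof.
by move=> oU H j; apply: Ck_local => a /H/smooth_near_Cinfty[V [oV Va CV]]; exists V.
Qed.

Lemma smap_near_mx X x (F : X -> 'rV[R]_n) :
  smooth_mx x F <-> @smap_near R X (euclidean R n) x F.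
Proof.
split=> [H|[_ H] i j].
  by split; [exact: filterE|move=> _ [i _ <-]; exact: H].
by rewrite ord1; apply: (H (fun a => a ord0 j)); exists j.
Qed.

Lemma smooth_mx_euclidean (a : 'rV[R]_n) : @smooth_mx R (euclidean R n) 1 n a id.
Proof. by move=> i j; rewrite (ord1 i); apply: smooth_near_coords; exists j. Qed.

Lemma smooth_mx_snd X p : @smooth_mx R (prod_space X (euclidean R n)) 1 n p snd.
Proof. by apply/smap_near_mx; exact: smap_near_snd. Qed.

End Euclidean.

Section RealLine.

Lemma snbhs_real (t : R) (P : set R) : @snbhs R (real_line R) t P <-> nbhs t P.
Proof.
split=> [[k [h [U [c o u H]]]]|aP].
  have : \forall b \near t, U (\row_i h i b).
    apply: (row_continuous_nbhs (T := R)); last exact: open_nbhs_nbhs.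
    by move=> i; rewrite (c i); exact: cvg_id.
  by apply: filterS => b; exact: H.
exists 1%N, (fun=> id), ([set a : 'rV[R]_1 | P° (a 0 0)]); split => //.
- apply: (open_comp (f := fun a : 'rV[R]_1 => a 0 0)); last exact: open_interior.
  by move=> a _; exact: coord_continuous.
- by rewrite /= mxE.
- by move=> b _; rewrite /= mxE => /interior_subset.
Qed.

Lemma smooth_near_real_differentiable (t : R) f : @smooth_near R (real_line R) t f ->
  differentiable f t.
Proof.
move=> [k [h [U [phi [c o u C H]]]]].
apply: (near_eq_differentiable (f := fun s => phi (\row_i h i s))).
  apply/snbhs_real; exists k, h, U; split => // s cs Us.
  by rewrite [RHS]H.
apply: (proj1 (chain_rule (0 : R) _ _)) => [i|]; first by rewrite (c i).
exact: (C 1%N).1.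
Qed.

Lemma smooth_near_id (t : R) : @smooth_near R (real_line R) t id.
Proof. exact: smooth_near_coords. Qed.

End RealLine.
End StandardSpaces.

(** * Curves and tangent vectors *)

Section Curves.
Variable R : realType.
Implicit Types X Y Z : smoothSpace R.
Local Notation line := (real_line R).

(** Tangent vectors are velocities of curves defined on the whole line, but the
constructions below yield curves that are smooth only near 0; [germ_extend]
reconciles the two. *)
Definition germ_curve X (c : R -> X) :=
  \forall t \near (0 : R), @smap_near R line X t c.

Lemma germ_carr X (c : R -> X) : germ_curve c -> carr (c 0).
Proof. by move=> /nbhs_singleton[cc _]; exact: (@snbhs_self R line 0 (fun t => carr (c t)) I cc). Qed.

Lemma germ_smooth X (c : R -> X) f : germ_curve c -> smooth_near (c 0) f ->
  @smooth_near R line 0 (f \o c).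
Proof. by move=> /nbhs_singleton cc; exact: (@smap_near_smooth R line X). Qed.

Lemma germ_differentiable X (c : R -> X) f : germ_curve c -> smooth_near (c 0) f ->
  differentiable (f \o c) 0.
Proof. by move=> gc sf; exact/smooth_near_real_differentiable/germ_smooth. Qed.

Lemma smooth_germ X (c : R -> X) : @smooth_map R line X c -> germ_curve c.
Proof. by move=> /smooth_mapP sc; apply: (@filterE _ (nbhs (0 : R))) => t; exact: sc. Qed.

Lemma germ_near X (c : R -> X) (P : set X) : germ_curve c -> snbhs (c 0) P ->
  \forall t \near (0 : R), P (c t).
Proof.
move=> /nbhs_singleton gc cP.
by apply/snbhs_real; exact: (@smap_near_snbhs R line X _ 0).
Qed.

Lemma germ_comp X Y (c : R -> X) (F : X -> Y) : germ_curve c ->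
  (\forall x \near snbhs (c 0), smap_near x F) -> germ_curve (F \o c).
Proof.
move=> gc sF; have := germ_near gc sF.
by move: gc; rewrite /germ_curve; apply: filterS2 => t; exact: (@smap_near_comp R line X Y).
Qed.

Lemma germ_comp_smooth X Y (c : R -> X) (F : X -> Y) : germ_curve c ->
  smooth_map F -> germ_curve (F \o c).
Proof.
move=> gc /smooth_mapP sF; apply: germ_comp => //.
by have := snbhs_carr (c 0); apply: filterS.
Qed.

(** A diffeomorphism from a neighbourhood of 0 whose values all lie in the interval
]-e, e[, with derivative 1 at 0: precomposition turns a curve defined near 0 into
one defined on the whole line with the same velocity. *)
Definition squeeze (e t : R) : R := t * (1 + (t / e) ^+ 2)^-1.

Let den (e t : R) : 0 < 1 + (t / e) ^+ 2.
Proof. by rewrite ltr_wpDr // sqr_ge0. Qed.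

Lemma squeeze_lt e t : 0 < e -> `|squeeze e t| < e.
Proof.
move=> e0; rewrite /squeeze normrM normfV (gtr0_norm (den e t)) ltr_pdivrMr ?den //.
have -> : `|t| = e * `|t / e| by rewrite normrM normfV (gtr0_norm e0) mulrC divfK // gt_eqF.
rewrite ltr_pM2l // -real_normK ?num_real //.
by move: (`|t / e|) => u; nra.
Qed.

Let den_smooth e t : @smooth_near R line t (fun s => (1 + (s / e) ^+ 2)^-1).
Proof.
apply: (@smooth_near_inv R line) => //; first by rewrite gt_eqF // den.
apply: (@smooth_near_add R line) => //; first exact: smooth_near_cst.
have S : @smooth_near R line t (fun s => s * e^-1).
  by apply: (@smooth_near_mul R line) => //; [exact: smooth_near_id|exact: smooth_near_cst].
exact: (@smooth_near_mul R line t _ _ _ S S).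
Qed.

Lemma squeeze_smooth e : @smooth_map R line line (squeeze e).
Proof.
split=> // h -> t _.
exact: (@smooth_near_mul R line t _ _ I (smooth_near_id t) (den_smooth e t)).
Qed.

Lemma squeeze0 e : squeeze e 0 = 0. Proof. by rewrite /squeeze mul0r. Qed.

Lemma derive1_squeeze e : derive1 (squeeze e) 0 = 1.
Proof.
have d := smooth_near_real_differentiable (den_smooth e 0).
rewrite derive1E /squeeze -[X in derive X]/(id * (fun t => (1 + (t / e) ^+ 2)^-1)) deriveM //.
  by rewrite derive_id scale0r add0r mul0r expr0n addr0 invr1 scale1r.
exact: diff_derivable.
Qed.

(** Precompose with [squeeze]. *)
Lemma germ_extend X (c : R -> X) : germ_curve c -> exists c' : R -> X,
  [/\ @smooth_map R line X c', c' 0 = c 0 &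
    forall f, smooth_near (c 0) f -> derive1 (f \o c') 0 = derive1 (f \o c) 0].
Proof.
move=> gc; have /nbhs_ballP[e /= e0 He] := gc.
exists (c \o squeeze e); split.
- apply/smooth_mapP => t _; apply: (@smap_near_comp R line line X) => //.
    exact: (smooth_map_near (squeeze_smooth e) I).
  by apply: He; rewrite -ball_normE /= sub0r normrN squeeze_lt.
- by rewrite /= squeeze0.
- move=> f sf.
  rewrite -[X in derive1 X]/((f \o c) \o squeeze e) derive1_comp.
  + by rewrite squeeze0 derive1_squeeze mulr1.
  + apply/diff_derivable/smooth_near_real_differentiable.
    exact: ((squeeze_smooth e).2 id erefl 0 I).
  + by rewrite squeeze0; apply/diff_derivable/germ_differentiable.
Qed.

Definition Vel X (c : R -> X) : tangent X := (c 0, velocity c).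

Lemma velocity_smooth X (c : R -> X) f : smooth_fun f -> velocity c f = derive1 (f \o c) 0.
Proof. by move=> sf; rewrite /velocity asboolT. Qed.

Lemma velocity_nonsmooth X (c : R -> X) f : ~ smooth_fun f -> velocity c f = 0.
Proof. by move=> sf; rewrite /velocity asboolF. Qed.

Lemma coords_smooth_fun X (h : X -> R) : coords h -> smooth_fun h.
Proof. by move=> ch x _; exact: smooth_near_coords. Qed.

Lemma carr_Vel X (c : R -> X) : germ_curve c -> carr (Vel c).
Proof.
move=> gc; have [c' [sc' c'0 Ec']] := germ_extend gc.
exists c'; split=> //=; apply/funext => f.
have [sf|nsf] := pselect (smooth_fun f); last by rewrite !velocity_nonsmooth.
by rewrite !velocity_smooth // Ec' //; exact/sf/germ_carr.
Qed.

(** A smooth curve representing v; by [Vel_local] the choice is immaterial. *)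
Definition curve_of X (v : tangent X) : R -> X :=
  get [set c : R -> X | @smooth_map R line X c /\ Vel c = v].

Lemma curve_ofP X (v : tangent X) : carr v ->
  @smooth_map R line X (curve_of v) /\ Vel (curve_of v) = v.
Proof.
move=> [c [sc c0 cv]].
apply: (@getI _ [set c : R -> X | @smooth_map R line X c /\ Vel c = v] c).
by split=> //; rewrite /Vel c0 cv; case: v {c0 cv}.
Qed.

Lemma carr_base X (v : tangent X) : carr v -> carr v.1.
Proof. by move=> /curve_ofP[sc <-]; exact: (sc.1 0). Qed.

Lemma carr_tangentP X (v : tangent X) : carr v -> exists c, germ_curve c /\ v = Vel c.
Proof. by move=> /curve_ofP[/smooth_germ gc E]; exists (curve_of v). Qed.

Lemma derive_germ X (c : R -> X) m (F : 'I_m -> X -> R) (V : set 'rV[R]_m) phi f :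
  germ_curve c -> (forall i, smooth_near (c 0) (F i)) -> open V ->
  V (\row_i F i (c 0)) -> Cinfty V phi ->
  (\forall x \near snbhs (c 0), f x = phi (\row_i F i x)) ->
  derive1 (f \o c) 0 =
  \sum_i derive1 (F i \o c) 0 * 'D_(delta_mx 0 i) phi (\row_i F i (c 0)).
Proof.
move=> gc sF oV Vc Cphi /(germ_near gc) E.
rewrite derive1E (near_eq_derive (g := fun t => phi (\row_i (F i \o c) t)) 1 E).
have [|_ ->] := @chain_rule R R m (fun i => F i \o c) phi 0 1 _ ((Cphi 1%N).1 _ Vc).
  by move=> i; exact: germ_differentiable.
by apply: eq_bigr => i _; rewrite derive1E.
Qed.

Lemma derive_germ_eq X (c c' : R -> X) f : germ_curve c -> germ_curve c' ->
  c 0 = c' 0 -> (forall h, coords h -> derive1 (h \o c) 0 = derive1 (h \o c') 0) ->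
  smooth_near (c 0) f -> derive1 (f \o c) 0 = derive1 (f \o c') 0.
Proof.
move=> gc gc' c0 E [k [h [U [phi [ch o u C H]]]]].
have H' : \forall x \near snbhs (c 0), f x = phi (\row_i h i x).
  by exists k, h, U; split.
rewrite (derive_germ gc _ o u C H') => [|i]; last exact: smooth_near_coords.
rewrite c0 in u H'.
rewrite (derive_germ gc' _ o u C H') => [|i]; last exact: smooth_near_coords.
by apply: eq_bigr => i _; rewrite E // c0.
Qed.

(** Every function smooth near c 0 is locally a function of coordinates, so the
derivatives of the coordinates determine the velocity. *)
Lemma Vel_eq X (c c' : R -> X) : germ_curve c -> germ_curve c' ->
  c 0 = c' 0 -> (forall h, coords h -> derive1 (h \o c) 0 = derive1 (h \o c') 0) ->
  Vel c = Vel c'.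
Proof.
move=> gc gc' c0 E; rewrite /Vel c0; congr pair; apply/funext => f.
have [sf|nsf] := pselect (smooth_fun f); last by rewrite !velocity_nonsmooth.
rewrite !velocity_smooth //; apply: derive_germ_eq => //; exact/sf/germ_carr.
Qed.

(** The velocity of c only records derivatives of functions that are smooth
everywhere. It contains the coordinates, and thereby determines the derivatives of
locally smooth functions. *)
Lemma Vel_local X (c c' : R -> X) f : germ_curve c -> germ_curve c' ->
  Vel c = Vel c' -> smooth_near (c 0) f ->
  derive1 (f \o c) 0 = derive1 (f \o c') 0.
Proof.
move=> gc gc' [c0 E]; apply: derive_germ_eq => // h ch.
have sh := coords_smooth_fun ch.
by have := congr1 (fun v => v h) E; rewrite !velocity_smooth.
Qed.

Lemma Vel_near X (c c' : R -> X) : germ_curve c ->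
  {near (0 : R), c =1 c'} -> germ_curve c' /\ Vel c' = Vel c.
Proof.
move=> gc E.
have gc' : germ_curve c'.
  have := near_join E; move: gc; rewrite /germ_curve; apply: filterS2 => t sc Et.
  by apply: (smap_near_ext _ sc); exact/snbhs_real.
split => //; apply: Vel_eq => //.
  by have /= -> := nbhs_singleton E.
move=> h ch; rewrite !derive1E; apply: near_eq_derive.
by move: E; apply: filterS => t /= ->.
Qed.

(** A tangent vector vanishes by convention on functions that are not smooth
everywhere; [Dv] is its action on all functions that are smooth near its base
point, such as the components of a chart. *)
Definition Dv X (v : tangent X) (f : X -> R) : R := derive1 (f \o curve_of v) 0.

Lemma Dv_Vel X (c : R -> X) f : germ_curve c -> smooth_near (c 0) f ->
  Dv (Vel c) f = derive1 (f \o c) 0.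
Proof.
move=> gc sf; have [sc E] := curve_ofP (carr_Vel gc).
symmetry; apply: Vel_local => //; exact: smooth_germ.
Qed.

Lemma Dv_smooth X (v : tangent X) f : carr v -> smooth_fun f -> Dv v f = v.2 f.
Proof.
by move=> /curve_ofP[sc E] sf; rewrite -[in RHS]E /Vel /= velocity_smooth.
Qed.

Lemma Dv_chain X (v : tangent X) m (F : 'I_m -> X -> R) (V : set 'rV[R]_m) phi f :
  carr v -> (forall i, smooth_near v.1 (F i)) -> open V ->
  V (\row_i F i v.1) -> Cinfty V phi ->
  (\forall x \near snbhs v.1, f x = phi (\row_i F i x)) ->
  Dv v f = \sum_i Dv v (F i) * 'D_(delta_mx 0 i) phi (\row_i F i v.1).
Proof.
move=> /curve_ofP[/smooth_germ gc E].
have -> : v.1 = curve_of v 0 by rewrite -[in LHS]E.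
by move=> sF oV Vv Cphi H; exact: (derive_germ gc sF oV Vv Cphi H).
Qed.

Lemma smap_near_bproj X (v : tangent X) : smap_near v (fst : tangent X -> X).
Proof.
split; first by have := snbhs_carr v; apply: filterS => w; exact: carr_base.
by move=> h ch; apply: smooth_near_coords; left; exists h.
Qed.

(** In coordinates h the derivative of phi(h) along w is the sum of the w.2 (h i)
times partial derivatives of phi, and the w.2 (h i) are coordinates of [tangent X]. *)
Lemma smooth_near_Dv X (v : tangent X) f : carr v -> smooth_near v.1 f ->
  smooth_near v (fun w : tangent X => Dv w f).
Proof.
move=> cv [k [h [U [phi [ch o u C H]]]]].
have tE x : tuple_map h x = \row_i h i x by [].
have sphi i : @smooth_near R (tangent X) v
    (fun w => 'D_(delta_mx 0 i) phi (tuple_map h w.1)).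
  have Ci : Cinfty U (fun a => 'D_(delta_mx 0 i) phi a).
    by move=> j; exact: (C j.+1).2.
  apply: (smooth_near_comp (F := fun i (w : tangent X) => h i w.1) cv _ o u Ci) => j.
  by apply: smooth_near_coords; left; exists (h j).
have S : @smooth_near R (tangent X) v (fun w =>
    \sum_i w.2 (h i) * 'D_(delta_mx 0 i) phi (tuple_map h w.1)).
  apply: smooth_near_sum => // i; apply: smooth_near_mul => //.
  by apply: smooth_near_coords; right; exists (h i).
apply: smooth_near_ext S.
have : \forall x \near snbhs v.1, carr x /\ U (tuple_map h x) by exists k, h, U; split.
move=> /(smap_near_snbhs cv (smap_near_bproj v)) U1.
move: U1 (snbhs_carr v); apply: filterS2 => w [cw1 Uw] cw.
have H' : \forall x \near snbhs w.1, f x = phi (\row_i h i x).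
  by exists k, h, U; split.
rewrite (Dv_chain cw _ o Uw C H'); last by move=> i; exact: smooth_near_coords.
by apply: eq_bigr => i _; rewrite Dv_smooth //; exact: coords_smooth_fun.
Qed.

Lemma tangent_eq X (v w : tangent X) : carr v -> carr w -> v.1 = w.1 ->
  (forall h, coords h -> v.2 h = w.2 h) -> v = w.
Proof.
move=> /curve_ofP[/smooth_germ gc <-] /curve_ofP[/smooth_germ gd <-] /= E H.
apply: Vel_eq => // h ch; have := H _ ch.
by rewrite !velocity_smooth //; exact: coords_smooth_fun.
Qed.

Lemma tangent_nonsmooth X (v : tangent X) f : carr v -> ~ smooth_fun f -> v.2 f = 0.
Proof. by move=> /curve_ofP[_ <-] nf; exact: velocity_nonsmooth. Qed.

(** The coefficients c depend on the base point only, so that linear relations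
between tangent vectors may be checked on coordinates. *)
Lemma tangent_coords X (v : tangent X) f : carr v -> smooth_fun f ->
  exists (k : nat) (h : 'I_k -> X -> R) (c : 'I_k -> R), (forall i, coords (h i)) /\
  forall w : tangent X, carr w -> w.1 = v.1 -> w.2 f = \sum_i w.2 (h i) * c i.
Proof.
move=> cv sf; have [k [h [U [phi [ch o u C H]]]]] := sf _ (carr_base cv).
exists k, h, (fun i => 'D_(delta_mx 0 i) phi (\row_i h i v.1)); split => // w cw wv.
rewrite -Dv_smooth // (@Dv_chain X w k h U phi f cw _ o) // ?wv //.
- by apply: eq_bigr => i _; rewrite Dv_smooth //; exact: coords_smooth_fun.
- by move=> i; exact: smooth_near_coords.
- by exists k, h, U; split.
Qed.

Lemma tangent_vaddE X (w v v' : tangent X) : carr w -> carr v -> carr v' ->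
  w.1 = v.1 -> w.1 = v'.1 -> (forall h, coords h -> w.2 h = v.2 h + v'.2 h) ->
  w = @vadd _ _ (tangent X) v v'.
Proof.
move=> cw cv cv' e e' E; rewrite [LHS]surjective_pairing e; congr pair.
apply/funext => f; have [sf|nf] := pselect (smooth_fun f); last first.
  by rewrite !tangent_nonsmooth // addr0.
have [k [h [c [ch Hf]]]] := tangent_coords cw sf.
rewrite !Hf // -?e' -?e // -big_split; apply: eq_bigr => i _.
by rewrite E // mulrDl.
Qed.

Lemma tangent_vscaleE X (w v : tangent X) a : carr w -> carr v ->
  w.1 = v.1 -> (forall h, coords h -> w.2 h = a * v.2 h) ->
  w = @vscale _ _ (tangent X) a v.
Proof.
move=> cw cv e E; rewrite [LHS]surjective_pairing e; congr pair.
apply/funext => f; have [sf|nf] := pselect (smooth_fun f); last first.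
  by rewrite !tangent_nonsmooth // mulr0.
have [k [h [c [ch Hf]]]] := tangent_coords cw sf.
rewrite !Hf // -?e // mulr_sumr; apply: eq_bigr => i _.
by rewrite E // mulrA.
Qed.

Lemma tmap_Vel X Y (F : X -> Y) (c : R -> X) : smooth_map F ->
  tmap F (Vel c) = Vel (F \o c).
Proof.
move=> sF; rewrite /tmap /Vel; congr pair; apply/funext => f /=.
have [sf|nsf] := pselect (smooth_fun f); last by rewrite asboolF // velocity_nonsmooth.
rewrite asboolT // !velocity_smooth //; exact: (smooth_map_fun sF sf).
Qed.

Lemma tmap_carr X Y (F : X -> Y) v : smooth_map F -> carr v -> carr (tmap F v).
Proof.
move=> sF /curve_ofP[/smooth_germ gc <-]; rewrite tmap_Vel //.
by apply: carr_Vel; exact: germ_comp_smooth.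
Qed.

Lemma tmap_comp X Y Z (F : X -> Y) (G : Y -> Z) v : smooth_map F -> smooth_map G ->
  carr v -> tmap G (tmap F v) = tmap (G \o F) v.
Proof.
move=> sF sG /curve_ofP[_ <-]; rewrite !tmap_Vel //; exact: smooth_map_comp sG.
Qed.

Lemma tmap_ext X Y (F G : X -> Y) v : smooth_map F -> smooth_map G ->
  (forall x, carr x -> F x = G x) -> carr v -> tmap F v = tmap G v.
Proof.
move=> sF sG FG /curve_ofP[sc <-]; rewrite !tmap_Vel //.
congr Vel; apply/funext => t; apply: FG; exact: (sc.1 t).
Qed.

Lemma tmap_id X (v : tangent X) : carr v -> tmap id v = v.
Proof. by move=> /curve_ofP[_ <-]; rewrite tmap_Vel //; exact: smooth_map_id. Qed.

Lemma tmap_smooth X Y (F : X -> Y) : smooth_map F ->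
  @smooth_map R (tangent X) (tangent Y) (tmap F).
Proof.
move=> sF; split=> [v|_ [[h ch <-]|[h ch <-]] v cv]; first exact: tmap_carr.
  apply: (smap_near_smooth (f := h \o F) cv (smap_near_bproj v)).
  by apply: sF.2 => //; exact: carr_base.
have sh : smooth_fun (h \o F) by exact: sF.2.
have := smooth_near_Dv cv (sh _ (carr_base cv)).
apply: smooth_near_ext; have := snbhs_carr v; apply: filterS => w cw /=.
by rewrite Dv_smooth // asboolT //; exact: coords_smooth_fun.
Qed.

Lemma tmap_add X Y (F : X -> Y) v w :
  tmap F (@vadd _ _ (tangent X) v w) = @vadd _ _ (tangent Y) (tmap F v) (tmap F w).
Proof.
rewrite /tmap /=; congr pair; apply/funext => f.
by case: asboolP; rewrite ?addr0.
Qed.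

Lemma tmap_scale X Y (F : X -> Y) a v :
  tmap F (@vscale _ _ (tangent X) a v) = @vscale _ _ (tangent Y) a (tmap F v).
Proof.
rewrite /tmap /=; congr pair; apply/funext => f.
by case: asboolP; rewrite ?mulr0.
Qed.

End Curves.

(** * Charts *)

Section Charts.
Variable R : realType.
Implicit Types X Y Z : smoothSpace R.

(** A chart with inverse F', with smoothness expressed pointwise in X and in R^n
rather than in the subspaces O and U. *)
Record chart X n (O : set X) (U : set 'rV[R]_n) (F : X -> 'rV[R]_n)
    (F' : 'rV[R]_n -> X) : Prop := Chart {
  chart_open : is_open O;
  chart_range_open : open U;
  chart_in : forall x, carr x -> O x -> U (F x);
  chart_K : forall x, carr x -> O x -> F' (F x) = x;
  chart_smooth : forall x, carr x -> O x -> smooth_mx x F;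
  chart_carr : forall a, U a -> carr (F' a) /\ O (F' a);
  chart_invK : forall a, U a -> F (F' a) = a;
  chart_inv_smooth : forall a, U a -> @smap_near R (euclidean R n) X a F' }.

Lemma locally_euclideanP n X : locally_euclidean n X <->
  forall x, carr x -> exists Q U F F', @chart X n Q U F F' /\ Q x.
Proof.
split=> H x cx.
  case: (H x cx) => [Q [U [F [F' [oQ Qx oU [sF sF' FK FK']]]]]].
  exists Q, U, F, F'; split => //; split => //.
  - by move=> y cy Qy; have [] := sF.1 y (conj cy Qy).
  - by move=> y cy Qy; exact: FK.
  - move=> y cy Qy; have Qy' := oQ _ cy Qy; apply/smap_near_mx/(smap_near_open_sub Qy').
    apply: (smap_near_of_sub (A := U)).
    exact: (smooth_map_near sF (conj cy Qy)).
  - by move=> a Ua; exact: (sF'.1 a (conj I Ua)).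
  - by move=> a Ua; exact: FK'.
  - move=> a Ua; have Ua' : @snbhs R (euclidean R n) a U.
      by apply/snbhs_euclidean; exact: open_nbhs_nbhs.
    apply: (smap_near_open_sub Ua'); apply: (smap_near_of_sub (A := Q)).
    exact: (smooth_map_near sF' (conj I Ua)).
case: (H x cx) => [Q [U [F [F' [C Qx]]]]].
exists Q, U, F, F'; have [oQ oU Fin FK sF Fc FK' sF'] := C; split => //; split.
- apply/smooth_mapP => y [cy Qy].
  have OU : @snbhs R (sub_space Q) y (F @^-1` U).
    by have := @snbhs_carr R (sub_space Q) y; apply: filterS => z [cz Oz]; exact: Fin.
  by apply: smap_near_to_sub => //; apply: smap_near_from_sub; apply/smap_near_mx; exact: sF.
- apply/smooth_mapP => a [_ Ua].
  have UO : @snbhs R (@sub_space R (euclidean R n) U) a (F' @^-1` Q).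
    have := @snbhs_carr R (@sub_space R (euclidean R n) U) a; apply: filterS => z [_ Uz].
    by have [] := Fc _ Uz.
  by apply: smap_near_to_sub => //; apply: smap_near_from_sub; exact: sF'.
- by move=> y [cy Qy]; exact: FK.
- by move=> a [_ Ua]; exact: FK'.
Qed.

Section OneChart.
Variables (X : smoothSpace R) (n : nat) (O : set X) (U : set 'rV[R]_n).
Variables (F : X -> 'rV[R]_n) (F' : 'rV[R]_n -> X).
Hypothesis C : chart O U F F'.

Lemma chart_coord_smooth x i : carr x -> O x -> smooth_near x (fun y => F y 0 i).
Proof. by move=> cx Ox; exact: (chart_smooth C cx Ox). Qed.

Lemma chart_snbhs x : carr x -> O x -> snbhs x O.
Proof. exact: (chart_open C). Qed.

Lemma chart_Cinfty (f : X -> R) : (forall x, carr x -> O x -> smooth_near x f) ->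
  Cinfty U (f \o F').
Proof.
move=> sf; apply: CinftyP => [|a Ua]; first exact: chart_range_open C.
have [ca Oa] := chart_carr C Ua.
by apply: (@smap_near_smooth R (euclidean R n) X F' a f I (chart_inv_smooth C Ua)); exact: sf.
Qed.

Lemma chart_germ (c : R -> 'rV[R]_n) : @germ_curve R (euclidean R n) c -> U (c 0) ->
  germ_curve (F' \o c).
Proof.
move=> gc Uc; apply: (germ_comp gc); apply/snbhs_euclidean.
have : \forall a \near c 0, U a.
  by apply: open_nbhs_nbhs; split => //; exact: chart_range_open C.
by apply: filterS => a Ua; exact: (chart_inv_smooth C Ua).
Qed.

Lemma derive_chart (c : R -> X) f : germ_curve c -> O (c 0) ->
  (forall x, carr x -> O x -> smooth_near x f) ->
  derive1 (f \o c) 0 = \sum_i derive1 ((fun x => F x 0 i) \o c) 0 *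
    'D_(delta_mx 0 i) (f \o F') (F (c 0)).
Proof.
move=> gc Oc sf; have cc := germ_carr gc.
have rE x : \row_i F x 0 i = F x by apply/rowP => i; rewrite mxE.
have H : \forall x \near snbhs (c 0), f x = (f \o F') (\row_i F x 0 i).
  have := chart_snbhs cc Oc; have := snbhs_carr (c 0); apply: filterS2 => x cx Ox.
  by rewrite rE /= (chart_K C).
have := derive_germ gc (fun i => chart_coord_smooth i cc Oc) (chart_range_open C) _
  (chart_Cinfty sf) H.
by rewrite rE; apply; exact: (chart_in C).
Qed.

Lemma derive_coord_chart (c : R -> 'rV[R]_n) i : @germ_curve R (euclidean R n) c -> U (c 0) ->
  derive1 ((fun x => F x 0 i) \o (F' \o c)) 0 = derive1 (fun t => c t 0 i) 0.
Proof.
move=> gc Uc; rewrite !derive1E; apply: near_eq_derive.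
have Un : @snbhs R (euclidean R n) (c 0) U.
  by apply/snbhs_euclidean/open_nbhs_nbhs; split => //; exact: chart_range_open C.
have := germ_near gc Un; apply: filterS => t Ut /=.
by rewrite (chart_invK C).
Qed.

(** The derivatives of the components of a chart determine a velocity. *)
Lemma Vel_chart (c c' : R -> X) : germ_curve c -> germ_curve c' -> O (c 0) -> c 0 = c' 0 ->
  (forall i, derive1 ((fun x => F x 0 i) \o c) 0 = derive1 ((fun x => F x 0 i) \o c') 0) ->
  Vel c = Vel c'.
Proof.
move=> gc gc' Oc c0 E; apply: Vel_eq => // h ch.
rewrite !derive_chart // -?c0 //; try by move=> x _ _; exact: smooth_near_coords.
by apply: eq_bigr => i _; rewrite E.
Qed.

End OneChart.

Lemma germ_affine n (b a : 'rV[R]_n) :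
  @germ_curve R (euclidean R n) (fun t => b + t *: a).
Proof.
apply: (@filterE _ (nbhs (0 : R))) => t; apply/smap_near_mx.
apply: (@smooth_mx_add R (real_line R)) => //; first exact: smooth_mx_cst.
move=> i j; have := @smooth_near_mul R (real_line R) t _ _ I (smooth_near_id t)
  (@smooth_near_cst R (real_line R) t (a i j)).
by congr smooth_near; apply/funext => u; rewrite mxE.
Qed.

End Charts.

(** * Local trivializations of vector bundles *)

Section Trivializations.
Variable R : realType.
Implicit Types X Y Z : smoothSpace R.

(** A trivialization over W, as fibre coordinates psi and their inverse chi. The
smoothness of chi is required along all smooth families, which spares the use of
the product of W and R^k. *)
Record vtriv X k (E : vbundle X) (W : set X) (psi : E -> 'rV[R]_k)
    (chi : X -> 'rV[R]_k -> E) : Prop := Vtriv {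
  vt_open : is_open W;
  vt_psi_smooth : forall e, carr e -> W (bproj e) -> smooth_mx e psi;
  vt_chi : forall x a, carr x -> W x -> carr (chi x a) /\ bproj (chi x a) = x;
  vt_chiK : forall x a, carr x -> W x -> psi (chi x a) = a;
  vt_psiK : forall e, carr e -> W (bproj e) -> chi (bproj e) (psi e) = e;
  vt_chi_smooth : forall Z (z : Z) (f : Z -> X) (a : Z -> 'rV[R]_k), carr z -> W (f z) ->
    smap_near z f -> smooth_mx z a -> smap_near z (fun w => chi (f w) (a w));
  vt_add : forall e e', carr e -> carr e' -> W (bproj e) -> bproj e = bproj e' ->
    psi (vadd e e') = psi e + psi e';
  vt_scale : forall a e, carr e -> W (bproj e) -> psi (vscale a e) = a *: psi e }.

Lemma is_vbundleP k X (E : vbundle X) : is_vbundle k E <->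
  [/\ smooth_map (@bproj _ X E),
      forall e e' : E, carr e -> carr e' -> bproj e = bproj e' ->
        carr (vadd e e') /\ bproj (vadd e e') = bproj e,
      forall (a : R) (e : E), carr e ->
        carr (vscale a e) /\ bproj (vscale a e) = bproj e &
      forall x : X, carr x -> exists W psi chi, @vtriv X k E W psi chi /\ W x].
Proof.
split=> -[sb addc scalec H]; split => // x cx.
  case: (H x cx) => [W [F [F' [oW Wx [sF sF' FK FK'] Flin]]]].
  have sF1 e : carr e -> W (bproj e) -> @smap_near R E (prod_space X (euclidean R k)) e F.
    move=> ce We; have bW : snbhs e (@bproj _ X E @^-1` W).
      apply: (smap_near_snbhs ce (smooth_map_near sb ce)).
      by apply: oW => //; exact: sb.1.
    apply: (smap_near_open_sub bW).
    have [S1 S2] := smooth_map_near sF (conj ce We : @carr R (sub_space _) e); split.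
      by move: S1; apply: filterS => z [[cz _] c2]; split.
    exact: S2.
  have Fc y a : carr y -> W y -> carr (F' (y, a)) /\ W (bproj (F' (y, a))).
    by move=> cy Wy; have [] := sF'.1 (y, a) (conj (conj cy Wy) I).
  have FK1 y a : carr y -> W y -> F (F' (y, a)) = (y, a).
    by move=> cy Wy; exact: (FK' (y, a) (conj (conj cy Wy) I)).
  have F1 y a : carr y -> W y -> bproj (F' (y, a)) = y.
    move=> cy Wy; have [c1 w1] := Fc _ a cy Wy.
    by have [<- _ _] := Flin _ c1 w1; rewrite FK1.
  exists W, (fun e => (F e).2), (fun x a => F' (x, a)); split => //; split => //.
  - move=> e ce We; apply/smap_near_mx/(smap_near_comp ce (sF1 _ ce We)).
    exact: smap_near_snd.
  - by move=> y a cy Wy; split; [exact: (Fc _ _ cy Wy).1|exact: F1].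
  - by move=> y a cy Wy; rewrite FK1.
  - move=> e ce We; have [<- _ _] := Flin _ ce We; rewrite -surjective_pairing.
    exact: (FK e (conj ce We)).
  - move=> Z z f a cz Wf sf /smap_near_mx sa; have cf := snbhs_self cz sf.1.
    apply: (@smap_near_comp R Z (prod_space X (euclidean R k)) E (fun w => (f w, a w)) F') => //.
      exact: smap_near_pair.
    have Wn : @snbhs R (prod_space X (euclidean R k)) (f z, a z) [set p | W p.1].
      apply: (@smap_near_snbhs R (prod_space X (euclidean R k)) X fst (f z, a z) W) => //.
        exact: smap_near_fst.
      exact: oW.
    apply: (smap_near_open_sub Wn).
    have cfa : @carr R (prod_space (sub_space W) (euclidean R k)) (f z, a z) by [].
    have [S1 S2] := smooth_map_near sF' cfa.
    (* a product with the subspace W has the generators and the points of the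
       corresponding subspace of the product *)
    have sw P : @snbhs R (prod_space (sub_space W) (euclidean R k)) (f z, a z) P ->
        @snbhs R (@sub_space R (prod_space X (euclidean R k)) [set p | W p.1]) (f z, a z) P.
      move=> [l [h [U [c o u HU]]]]; exists l, h, U; split=> // y [[cy1 cy2] Wy] Uy.
      by apply: HU.
    split; first by apply: sw; move: S1; apply: filterS => y [].
    move=> h ch; have [l [g [U [phi [c o u Cp HU]]]]] := S2 h ch.
    exists l, g, U, phi; split=> // y [[cy1 cy2] Wy] Uy.
    by apply: HU.
  - by move=> e e' ce ce' We E'; have [_ + _] := Flin _ ce We; apply.
  - by move=> a e ce We; have [_ _ +] := Flin _ ce We; apply.
case: (H x cx) => [W [psi [chi [[oW sp chc chK pK sc pa ps] Wx]]]].
exists W, (fun e => (bproj e, psi e)), (fun p => chi p.1 p.2); split => //.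
  split.
  - apply/smooth_mapP => e [ce We].
    apply: (@smap_near_pair R (sub_space W) (euclidean R k)).
      apply: smap_near_to_sub; last by apply: smap_near_from_sub; exact: (smooth_map_near sb).
      by have := snbhs_carr (e : sub_space (@bproj _ X E @^-1` W)); apply: filterS => z [].
    by apply: smap_near_from_sub; apply/smap_near_mx; exact: sp.
  - apply/smooth_mapP => -[y a] [[cy Wy] _].
    apply: smap_near_to_sub.
      have := @snbhs_carr R (prod_space (sub_space W) (euclidean R k)) (y, a).
      apply: filterS => -[z b] [[cz Wz] _] /=.
      by have [_ ->] := chc _ b cz Wz.
    set PW := prod_space (sub_space W) (euclidean R k).
    have cya : @carr R PW (y, a) by [].
    apply: (@sc PW (y, a) fst snd) => //; last exact: smooth_mx_snd.
    exact: (smap_near_of_sub (@smap_near_fst R (sub_space W) (euclidean R k) (y, a))).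
  - by move=> e [ce We] /=; exact: pK.
  - by move=> [y a] [[cy Wy] _] /=; rewrite chK //; have [_ ->] := chc _ a cy Wy.
move=> e ce We; split=> //; last by move=> a; exact: ps.
by move=> e' ce' Ee; exact: pa.
Qed.

Section Bundle.
Variables (X : smoothSpace R) (k : nat) (E : vbundle X).
Hypothesis vE : is_vbundle k E.

Lemma bproj_smooth : smooth_map (@bproj _ X E). Proof. by have [] := vE. Qed.
Lemma bproj_carr e : carr e -> carr (@bproj _ X E e). Proof. exact: bproj_smooth.1. Qed.
Lemma bproj_near (e : E) : carr e -> smap_near e (@bproj _ X E).
Proof. exact: (smooth_map_near bproj_smooth). Qed.
Lemma vadd_carr (e e' : E) : carr e -> carr e' -> bproj e = bproj e' -> carr (vadd e e').
Proof. by move=> ce ce' Ee; have [_ + _ _] := vE => /(_ e e' ce ce' Ee)[]. Qed.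
Lemma vadd_bproj (e e' : E) : carr e -> carr e' -> bproj e = bproj e' ->
  bproj (vadd e e') = bproj e.
Proof. by move=> ce ce' Ee; have [_ + _ _] := vE => /(_ e e' ce ce' Ee)[]. Qed.
Lemma vscale_carr a (e : E) : carr e -> carr (vscale a e).
Proof. by move=> ce; have [_ _ + _] := vE => /(_ a e ce)[]. Qed.
Lemma vscale_bproj a (e : E) : carr e -> bproj (vscale a e) = bproj e.
Proof. by move=> ce; have [_ _ + _] := vE => /(_ a e ce)[]. Qed.
Lemma vtriv_at x : carr x -> exists W psi chi, @vtriv X k E W psi chi /\ W x.
Proof. by have [_ _ _ +] := (is_vbundleP _ _).1 vE; exact. Qed.

Section OneTriv.
Variables (W : set X) (psi : E -> 'rV[R]_k) (chi : X -> 'rV[R]_k -> E).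
Hypothesis T : vtriv W psi chi.

Lemma vt_near x : carr x -> W x -> snbhs x W. Proof. exact: (vt_open T). Qed.

Lemma vt_inj e e' : carr e -> carr e' -> W (bproj e) -> bproj e = bproj e' ->
  psi e = psi e' -> e = e'.
Proof.
move=> ce ce' We b p; rewrite -(vt_psiK T ce We) -(vt_psiK T ce') -?b //.
by rewrite p.
Qed.

Lemma chi_add x a b : carr x -> W x -> chi x (a + b) = vadd (chi x a) (chi x b).
Proof.
move=> cx Wx; have [ca ba] := vt_chi T a cx Wx; have [cb bb] := vt_chi T b cx Wx.
have [cab bab] := vt_chi T (a + b) cx Wx.
have Eb : bproj (chi x a) = bproj (chi x b) by rewrite ba bb.
apply: vt_inj => //; rewrite ?bab ?vadd_bproj ?ba //; first exact: vadd_carr.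
by rewrite (vt_chiK T) // (vt_add T) ?ba // !(vt_chiK T).
Qed.

Lemma chi_scale x a b : carr x -> W x -> chi x (a *: b) = vscale a (chi x b).
Proof.
move=> cx Wx; have [cb bb] := vt_chi T b cx Wx; have [cab bab] := vt_chi T (a *: b) cx Wx.
apply: vt_inj => //; rewrite ?bab ?vscale_bproj ?bb //; first exact: vscale_carr.
by rewrite (vt_chiK T) // (vt_scale T) ?bb // !(vt_chiK T).
Qed.

(** Apply [vt_chi_smooth] to the base point and the fibre coordinates of F. *)
Lemma smap_near_into Z (z : Z) (F : Z -> E) : carr z ->
  (\forall w \near snbhs z, carr (F w)) -> W (bproj (F z)) ->
  smap_near z (@bproj _ X E \o F) -> smooth_mx z (psi \o F) -> smap_near z F.
Proof.
move=> cz cF Wz sb sp; have cFz := snbhs_self cz cF.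
have S := vt_chi_smooth T cz Wz sb sp.
apply: smap_near_ext S.
have WF : \forall w \near snbhs z, W (bproj (F w)).
  apply: (smap_near_snbhs (F := @bproj _ X E \o F) cz sb).
  by apply: vt_near => //; exact: bproj_carr.
by move: cF WF; apply: filterS2 => w cw Ww /=; rewrite (vt_psiK T).
Qed.

End OneTriv.

(** The sum is smooth in a trivialization, where it is the sum of coordinates. *)
Lemma vadd_smooth_near Z (z : Z) (F G : Z -> E) : carr z ->
  smap_near z F -> smap_near z G ->
  (\forall w \near snbhs z, bproj (F w) = bproj (G w)) ->
  smap_near z (fun w => vadd (F w) (G w)).
Proof.
move=> cz sF sG FG; have cF := sF.1; have cG := sG.1.
have cFz := snbhs_self cz cF; have cGz := snbhs_self cz cG; have FGz := snbhs_self cz FG.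
have [W [psi [chi [T Wx]]]] := vtriv_at (bproj_carr cFz).
have sbF : smap_near z (@bproj _ X E \o F) by apply: smap_near_comp => //; exact: bproj_near.
have WF := smap_near_snbhs cz sbF (vt_near T (bproj_carr cFz) Wx).
apply: (smap_near_into T) => //.
- by move: cF cG FG; apply: filterS3 => w; exact: vadd_carr.
- by rewrite vadd_bproj.
- apply: smap_near_ext sbF; move: cF cG FG; apply: filterS3 => w c1 c2 e.
  by rewrite /= vadd_bproj.
- have sp : smooth_mx z (psi \o F).
    by apply: smooth_mx_comp => //; exact: (vt_psi_smooth T).
  have sq : smooth_mx z (psi \o G).
    by apply: smooth_mx_comp => //; apply: (vt_psi_smooth T) => //; rewrite -FGz.
  apply: smooth_mx_ext (smooth_mx_add cz sp sq).
  have cFG : \forall w \near snbhs z, carr (F w) /\ carr (G w).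
    by move: cF cG; apply: filterS2.
  move: cFG FG WF; apply: filterS3 => w [c1 c2] e Ww.
  by rewrite /= (vt_add T).
Qed.

End Bundle.

Section Whitney.
Variables (X : smoothSpace R) (k k' : nat) (E E' : vbundle X).
Hypotheses (vE : is_vbundle k E) (vE' : is_vbundle k' E').

Lemma whitney_fst (p : whitney_sum E E') :
  smap_near p (fst : whitney_sum E E' -> E).
Proof. by apply: smap_near_from_sub; exact: smap_near_fst. Qed.

Lemma whitney_snd (p : whitney_sum E E') :
  smap_near p (snd : whitney_sum E E' -> E').
Proof. by apply: smap_near_from_sub; exact: smap_near_snd. Qed.

Lemma whitney_pair Z (z : Z) (F : Z -> E) (G : Z -> E') :
  smap_near z F -> smap_near z G ->
  (\forall w \near snbhs z, bproj (F w) = bproj (G w)) ->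
  smap_near z ((fun w => (F w, G w)) : Z -> whitney_sum E E').
Proof.
by move=> sF sG FG; apply: smap_near_to_sub => //; exact: smap_near_pair.
Qed.

Lemma whitney_vbundle : is_vbundle (k + k') (whitney_sum E E').
Proof.
apply/is_vbundleP; split.
- apply/smooth_mapP => p [[c1 c2] e].
  apply: (@smap_near_comp R (whitney_sum E E') E X fst (@bproj _ X E)) => //.
    exact: whitney_fst.
  exact: (bproj_near vE).
- move=> p q [[p1 p2] pe] [[q1 q2] qe] /= b.
  have b' : bproj p.2 = bproj q.2 by rewrite -pe b.
  split; last exact: (vadd_bproj vE).
  split; first by split; [exact: (vadd_carr vE)|exact: (vadd_carr vE')].
  by rewrite /= (vadd_bproj vE) // (vadd_bproj vE').
- move=> a p [[p1 p2] pe]; split; last exact: (vscale_bproj vE).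
  split; first by split; [exact: (vscale_carr vE)|exact: (vscale_carr vE')].
  by rewrite /= (vscale_bproj vE) // (vscale_bproj vE').
move=> x cx; have [W [psi [chi [T Wx]]]] := vtriv_at vE cx.
have [W' [psi' [chi' [T' Wx']]]] := vtriv_at vE' cx.
exists (W `&` W'), (fun p => row_mx (psi p.1) (psi' p.2)),
  (fun x a => (chi x (lsubmx a), chi' x (rsubmx a))); split; last by split.
split.
- move=> y cy [Wy Wy']; apply: (@filterI _ _ (snbhs_filter y)).
    exact: (vt_open T). exact: (vt_open T').
- move=> p cp [Wp Wp']; have [[c1 c2] pe] := cp; apply: smooth_mx_row.
    by apply: (smooth_mx_comp cp (whitney_fst p)); exact: (vt_psi_smooth T).
  apply: (smooth_mx_comp cp (whitney_snd p)); apply: (vt_psi_smooth T') => //.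
  by rewrite -pe.
- move=> y a cy [Wy Wy']; have [h1 h2] := vt_chi T (lsubmx a) cy Wy.
  have [h3 h4] := vt_chi T' (rsubmx a) cy Wy'; split => //; split => //=.
  by rewrite h2 h4.
- by move=> y a cy [Wy Wy'] /=; rewrite (vt_chiK T) // (vt_chiK T') // hsubmxK.
- move=> [e e'] [[/= c1 c2] pe] [Wy Wy']; rewrite row_mxKl row_mxKr /=.
  by rewrite (vt_psiK T) // pe (vt_psiK T') // -pe.
- move=> Z z f a cz [Wf Wf'] sf sa; have cf := snbhs_self cz sf.1.
  apply: whitney_pair.
  + by apply: (vt_chi_smooth T) => //; exact: smooth_mx_lsub.
  + by apply: (vt_chi_smooth T') => //; exact: smooth_mx_rsub.
  + have n1 := smap_near_snbhs cz sf (vt_open T cf Wf).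
    have n2 := smap_near_snbhs cz sf (vt_open T' cf Wf').
    move: sf.1 n1 n2; apply: filterS3 => w cw w1 w2.
    by have [_ ->] := vt_chi T (lsubmx (a w)) cw w1; have [_ ->] := vt_chi T' (rsubmx (a w)) cw w2.
- move=> p q [[p1 p2] pe] [[q1 q2] qe] [Wy Wy'] /= b.
  rewrite (vt_add T) // (vt_add T') ?add_row_mx //; first by rewrite -pe.
  by rewrite -pe b.
- move=> a p [[p1 p2] pe] [Wy Wy'] /=.
  by rewrite (vt_scale T) // (vt_scale T') ?scale_row_mx // -pe.
Qed.

End Whitney.
End Trivializations.

(** * The tangent bundle and total spaces of vector bundles *)

Section TangentBundle.
Variable R : realType.
Variables (X : smoothSpace R) (n : nat) (O : set X) (U : set 'rV[R]_n).
Variables (F : X -> 'rV[R]_n) (F' : 'rV[R]_n -> X).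
Hypothesis C : chart O U F F'.

Let psi (v : tangent X) : 'rV[R]_n := \row_i Dv v (fun x => F x 0 i).
Let line (y : X) (a : 'rV[R]_n) : R -> X := F' \o (fun t => F y + t *: a).
Let chi (y : X) (a : 'rV[R]_n) : tangent X := Vel (line y a).

Let line0 y a : carr y -> O y -> line y a 0 = y.
Proof. by move=> cy Oy; rewrite /line /= scale0r addr0 (chart_K C). Qed.

Let line_germ y a : carr y -> O y -> germ_curve (line y a).
Proof.
move=> cy Oy; apply: (chart_germ C (@germ_affine R n _ _)).
by rewrite scale0r addr0; exact: (chart_in C).
Qed.

Let derive_line y a i : carr y -> O y ->
  derive1 ((fun x => F x 0 i) \o line y a) 0 = a 0 i.
Proof.
move=> cy Oy; rewrite (derive_coord_chart C) ?derive1_affine //.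
- exact: germ_affine.
- by rewrite scale0r addr0; exact: (chart_in C).
Qed.

Let chi_val y a f : carr y -> O y -> (forall x, carr x -> O x -> smooth_near x f) ->
  derive1 (f \o line y a) 0 =
  \sum_i a 0 i * 'D_(delta_mx 0 i) (f \o F') (F y).
Proof.
move=> cy Oy sf; rewrite (derive_chart C) ?line0 //; last exact: line_germ.
by apply: eq_bigr => i _; rewrite derive_line.
Qed.

Let chi_carr y a : carr y -> O y -> carr (chi y a).
Proof. by move=> cy Oy; apply/carr_Vel/line_germ. Qed.

Let psi_Vel c i : germ_curve c -> O (c 0) ->
  psi (Vel c) 0 i = derive1 ((fun x => F x 0 i) \o c) 0.
Proof.
move=> gc Oc; rewrite mxE Dv_Vel //; apply: (chart_coord_smooth C) => //.
exact: germ_carr.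
Qed.

Let chiK y a : carr y -> O y -> psi (chi y a) = a.
Proof.
move=> cy Oy; apply/rowP => i; rewrite psi_Vel ?line0 ?derive_line //.
exact: line_germ.
Qed.

Let psiK (v : tangent X) : carr v -> O v.1 -> chi v.1 (psi v) = v.
Proof.
move=> /[dup] cv /carr_tangentP[c [gc ->]] /= Oc; have cc := germ_carr gc.
apply: (Vel_chart C) => //; rewrite ?line0 //; first exact: line_germ.
by move=> i; rewrite derive_line // psi_Vel.
Qed.

Let tangent_val (v : tangent X) f : carr v -> O v.1 -> smooth_fun f ->
  v.2 f = \sum_i psi v 0 i * 'D_(delta_mx 0 i) (f \o F') (F v.1).
Proof.
move=> cv Ov sf; have /= <- := congr1 (fun w : tangent X => w.2 f) (psiK cv Ov).
rewrite velocity_smooth // chi_val //; first exact: carr_base.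
by move=> x cx _; exact: sf.
Qed.

(** A sum of velocities is defined as a functional; that it is again a velocity is
seen in a chart, where it is the velocity of a line. *)
Lemma tangent_add_carr (v w : tangent X) : carr v -> carr w -> O v.1 -> v.1 = w.1 ->
  chi v.1 (psi v + psi w) = @vadd _ _ (tangent X) v w.
Proof.
move=> cv cw Ov vw; have c1 := carr_base cv.
rewrite /chi /Vel line0 //; congr pair; apply/funext => f.
have [sf|nsf] := pselect (smooth_fun f); last first.
  by rewrite velocity_nonsmooth // !tangent_nonsmooth // addr0.
have sf' x : carr x -> O x -> smooth_near x f by move=> cx _; exact: sf.
have Ow : O w.1 by rewrite -vw.
rewrite velocity_smooth // chi_val // (tangent_val cv) // (tangent_val cw) // -vw -big_split.
by apply: eq_bigr => i _; rewrite mxE mulrDl.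
Qed.

Lemma tangent_scale_carr a (v : tangent X) : carr v -> O v.1 ->
  chi v.1 (a *: psi v) = @vscale _ _ (tangent X) a v.
Proof.
move=> cv Ov; have c1 := carr_base cv.
rewrite /chi /Vel line0 //; congr pair; apply/funext => f.
have [sf|nsf] := pselect (smooth_fun f); last first.
  by rewrite velocity_nonsmooth // !tangent_nonsmooth // mulr0.
have sf' x : carr x -> O x -> smooth_near x f by move=> cx _; exact: sf.
rewrite velocity_smooth // chi_val // (tangent_val cv) // mulr_sumr.
by apply: eq_bigr => i _; rewrite mxE mulrA.
Qed.

Lemma tangent_chart_add (v w : tangent X) : carr v -> carr w -> O v.1 -> v.1 = w.1 ->
  carr (@vadd _ _ (tangent X) v w).
Proof.
move=> cv cw Ov vw; rewrite -tangent_add_carr //; apply: chi_carr => //.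
exact: carr_base.
Qed.

Lemma tangent_chart_scale a (v : tangent X) : carr v -> O v.1 ->
  carr (@vscale _ _ (tangent X) a v).
Proof.
move=> cv Ov; rewrite -tangent_scale_carr //; apply: chi_carr => //.
exact: carr_base.
Qed.

(** The fibre coordinates are the derivatives of the components of the chart F. The
vector with coordinates a at y is the velocity at t = 0 of the curve whose image
under F is F y + t a. *)
Lemma tangent_triv : @vtriv R X n (tangent X) O psi chi.
Proof.
split.
- exact: (chart_open C).
- move=> v cv Ov i' i; have := smooth_near_Dv cv (chart_coord_smooth C i (carr_base cv) Ov).
  by congr smooth_near; apply/funext => w; rewrite mxE.
- by move=> y a cy Oy; split; [exact: chi_carr|exact: line0].
- exact: chiK.
- exact: psiK.
- move=> Z z f a cz Of sf sa; have cf := snbhs_self cz sf.1.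
  have nO : \forall w \near snbhs z, carr (f w) /\ O (f w).
    have nf := smap_near_snbhs cz sf (chart_open C cf Of).
    by move: sf.1 nf; apply: filterS2.
  split; first by move: nO; apply: filterS => w [c1 O1]; exact: chi_carr.
  move=> _ [[h ch <-]|[h ch <-]].
    apply: smooth_near_ext (sf.2 h ch).
    by move: nO; apply: filterS => w [c1 O1] /=; rewrite line0.
  have sh x : carr x -> O x -> smooth_near x h by move=> _ _; exact: smooth_near_coords.
  apply: (@smooth_near_ext R Z z
    (fun w => \sum_i a w 0 i * 'D_(delta_mx 0 i) (h \o F') (F (f w)))).
    move: nO; apply: filterS => w [c1 O1] /=.
    by rewrite velocity_smooth ?chi_val //; exact: coords_smooth_fun.
  apply: smooth_near_sum => // i; apply: smooth_near_mul => //.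
  have Ci : Cinfty U (fun b => 'D_(delta_mx 0 i) (h \o F') b).
    by move=> j; exact: (chart_Cinfty C sh j.+1).2.
  apply: (@smap_near_smooth R Z (euclidean R n) (F \o f) z
    (fun b => 'D_(delta_mx 0 i) (h \o F') b)) => //.
    by apply/smap_near_mx/smooth_mx_comp => //; exact: (chart_smooth C).
  apply: (Cinfty_smooth_near (chart_range_open C) _ Ci).
  exact: (chart_in C).
- move=> v w cv cw Ov vw; rewrite -tangent_add_carr // chiK //; exact: carr_base.
- move=> a v cv Ov; rewrite -tangent_scale_carr // chiK //; exact: carr_base.
Qed.

End TangentBundle.

Lemma tangent_vbundle (R : realType) (X : smoothSpace R) n :
  locally_euclidean n X -> is_vbundle n (tangent X).
Proof.
move=> /locally_euclideanP H; apply/is_vbundleP; split.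
- by apply/smooth_mapP => v _; exact: smap_near_bproj.
- move=> v w cv cw /= vw; split => //.
  have [Q [U [F [F' [C Qv]]]]] := H _ (carr_base cv).
  exact: (tangent_chart_add C).
- move=> a v cv; split => //.
  have [Q [U [F [F' [C Qv]]]]] := H _ (carr_base cv).
  exact: (tangent_chart_scale C).
- move=> x cx; have [Q [U [F [F' [C Qx]]]]] := H _ cx.
  by eexists Q, _, _; split; [exact: (tangent_triv C)|].
Qed.

Section BundleManifold.
Variables (R : realType) (X : smoothSpace R) (k : nat) (E : vbundle X).
Hypothesis vE : is_vbundle k E.

(** Points over distinct base points are separated in the base, points of one fibre
by a fibre coordinate. *)
Lemma vbundle_hausdorff : hausdorff X -> hausdorff E.
Proof.
move=> hX e e' ce ce' ne.
have [eb|nb] := pselect (bproj e = bproj e'); last first.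
  have [A [B [oA oB Ae Be' AB]]] := hX _ _ (bproj_carr vE ce) (bproj_carr vE ce') nb.
  exists (@bproj _ X E @^-1` A), (@bproj _ X E @^-1` B); split => //.
  - move=> f cf Af; apply: (smap_near_snbhs cf (bproj_near vE cf)).
    by apply: oA => //; exact: (bproj_carr vE).
  - move=> f cf Bf; apply: (smap_near_snbhs cf (bproj_near vE cf)).
    by apply: oB => //; exact: (bproj_carr vE).
  - by move=> f cf; apply: AB; exact: (bproj_carr vE).
have [W [psi [chi [T We]]]] := vtriv_at vE (bproj_carr vE ce).
have We' : W (bproj e') by rewrite -eb.
have [i ni] : exists i, psi e 0 i != psi e' 0 i.
  apply/not_existsP => H; apply: ne; apply: (vt_inj T) => //.
  by apply/rowP => i; apply/eqP/negP => /negP/H.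
have oP (P : set R) : open P -> is_open [set f : E | W (bproj f) /\ P (psi f 0 i)].
  move=> oP f cf [Wf Pf].
  have Wn : \forall g \near snbhs f, W (bproj g).
    apply: (smap_near_snbhs cf (bproj_near vE cf)).
    by apply: (vt_near T) => //; exact: (bproj_carr vE).
  have sp := vt_psi_smooth T cf Wf 0 i.
  have Pn := smooth_near_continuous cf sp (open_nbhs_nbhs (conj oP Pf)).
  by apply: (filterI Wn Pn).
pose m := (psi e 0 i + psi e' 0 i) / 2.
pose A := [set f | W (bproj f) /\ psi f 0 i < m].
pose A' := [set f | W (bproj f) /\ psi f 0 i > m].
have oA : is_open A by exact: (oP _ (open_lt (y := m))).
have oA' : is_open A' by exact: (oP _ (open_gt (y := m))).
have AA' z : ~ (A z /\ A' z) by move=> [[_ z1] [_ z2]]; move: (lt_trans z1 z2); rewrite ltxx.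
have [lt|lt|eq] := ltgtP (psi e 0 i) (psi e' 0 i); last by rewrite eq eqxx in ni.
- exists A, A'; split=> //.
    by split=> //; rewrite /m; lra.
  by split=> //; rewrite /m; lra.
- exists A', A; split=> // [||z _ [z1 z2]]; last exact: (AA' z).
    by split=> //; rewrite /m; lra.
  by split=> //; rewrite /m; lra.
Qed.

(** The charts are pairs of a chart of the base and fibre coordinates. *)
Lemma vbundle_locally_euclidean n : locally_euclidean n X -> locally_euclidean (n + k) E.
Proof.
move=> /locally_euclideanP H; apply/locally_euclideanP => e ce.
have [Q [U [F [F' [C Qx]]]]] := H _ (bproj_carr vE ce).
have [W [psi [chi [T We]]]] := vtriv_at vE (bproj_carr vE ce).
pose U' := join_set (U `&` F' @^-1` W) setT : set 'rV[R]_(n + k).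
have Q_near (f : E) : carr f -> Q (bproj f) -> W (bproj f) ->
    \forall g \near snbhs f, Q (bproj g) /\ W (bproj g).
  move=> cf Qf Wf.
  have cb := bproj_carr vE cf.
  have QW : snbhs (bproj f) (Q `&` W).
    by apply: filterI; [exact: (chart_open C)|exact: (vt_open T)].
  exact: (smap_near_snbhs cf (bproj_near vE cf) QW).
have cF' a : U' a -> [/\ U (lsubmx a), carr (F' (lsubmx a)), Q (F' (lsubmx a)) &
    W (F' (lsubmx a))].
  by move=> [[/= Ua Wa] _]; have [] := chart_carr C Ua.
exists [set f : E | Q (bproj f) /\ W (bproj f)], U',
  (fun f => row_mx (F (bproj f)) (psi f)), (fun a => chi (F' (lsubmx a)) (rsubmx a)).
split; last by []; split.
- by move=> f cf [Qf Wf]; exact: Q_near.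
- apply: open_join; last exact: openT.
  apply: (open_near (A := U) (B := F' @^-1` W)) => // a [Ua Wa].
  have oU := chart_range_open C; have [ca Qa] := chart_carr C Ua.
  split; first exact: open_nbhs_nbhs.
  apply/snbhs_euclidean; apply: (@smap_near_snbhs R (euclidean R n) X F' a W I).
    exact: (chart_inv_smooth C).
  exact: (vt_open T).
- move=> f cf [Qf Wf]; have cb := bproj_carr vE cf; rewrite /U' /join_set /= row_mxKl.
  by split=> //; split; [exact: (chart_in C)|rewrite /= (chart_K C)].
- move=> f cf [Qf Wf]; have cb := bproj_carr vE cf.
  by rewrite row_mxKl row_mxKr (chart_K C) // (vt_psiK T).
- move=> f cf [Qf Wf]; have cb := bproj_carr vE cf.
  apply: smooth_mx_row; last exact: (vt_psi_smooth T).
  by apply: (smooth_mx_comp cf (bproj_near vE cf)); exact: (chart_smooth C).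
- move=> a /cF'[Ua ca Qa Wa]; have [c1 c2] := vt_chi T (rsubmx a) ca Wa.
  by split=> //; rewrite /= c2.
- move=> a /cF'[Ua ca Qa Wa]; have [c1 c2] := vt_chi T (rsubmx a) ca Wa.
  by rewrite c2 (chart_invK C) // (vt_chiK T) // hsubmxK.
- move=> a /cF'[Ua ca Qa Wa].
  have sa := @smooth_mx_euclidean R (n + k) a.
  apply: (vt_chi_smooth T (Z := euclidean R (n + k))) => //; last exact: smooth_mx_rsub.
  apply: (@smap_near_comp R (euclidean R (n + k)) (euclidean R n) X (@lsubmx R 1 n k)) => //.
    by apply/smap_near_mx; exact: smooth_mx_lsub.
  exact: (chart_inv_smooth C).
Qed.

End BundleManifold.

(** * Second countability of total spaces *)

Lemma rational_approx (R : realType) k (a : 'rV[R]_k) (c : R) : 0 < c ->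
  exists q : 'rV[rat]_k, `|a - map_mx ratr q| < c.
Proof.
move=> c0; have H i : exists q : rat, `|a 0 i - ratr q| <= c / 2.
  have [|q] := @rat_in_itvoo R (a 0 i - c / 2) (a 0 i + c / 2); first by lra.
  rewrite in_itv /= => /andP[q1 q2]; exists q.
  by rewrite ler_norml; apply/andP; split; lra.
have [q Hq] := boolp.choice H; exists (\row_i q i).
apply: (@le_lt_trans _ _ (c / 2)); last by lra.
apply: mx_norm_le => [|i' i]; first lra.
by rewrite ord1 !mxE.
Qed.

Section SecondCountable.
Variables (R : realType) (X : smoothSpace R) (k : nat) (E : vbundle X).
Hypothesis vE : is_vbundle k E.

(** Choose a trivialization over each basic open set B n that admits one. The sets
of points over both B n and B i whose fibre coordinates over B n lie within 1/(r+1) of a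
rational vector q form a countable basis. *)
Lemma vbundle_second_countable : second_countable_space X -> second_countable_space E.
Proof.
move=> [B [oB HB]].
pose good n (psi : E -> 'rV[R]_k) := exists W chi,
  vtriv W psi chi /\ forall x, carr x -> B n x -> W x.
pose Psi n : E -> 'rV[R]_k := xget (fun=> 0) [set psi | good n psi].
pose BE (u : nat * nat * 'rV[rat]_k * nat) : set E :=
  [set e | [/\ good u.1.1.1 (Psi u.1.1.1), B u.1.1.1 (bproj e), B u.1.1.2 (bproj e) &
    `|Psi u.1.1.1 e - map_mx ratr u.1.2| < u.2.+1%:R^-1]].
exists (fun m => if unpickle m is Some u then BE u else set0); split.
  move=> m; case: (unpickle m) => // -[[[n i] q] r] e ce [/= gn Bn Bi lt].
  have [W [chi [T BW]]] := gn; have cb := bproj_carr vE ce.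
  have H1 := smap_near_snbhs ce (bproj_near vE ce) (oB n _ cb Bn).
  have H2 := smap_near_snbhs ce (bproj_near vE ce) (oB i _ cb Bi).
  have sp := vt_psi_smooth T ce (BW _ cb Bn).
  have H3 : @snbhs R (euclidean R k) (Psi n e)
      [set a | `|a - map_mx ratr q| < r.+1%:R^-1].
    apply/snbhs_euclidean.
    have := @ball_open R 'rV[R]_k (map_mx ratr q) (r.+1%:R^-1).
    rewrite -ball_normE => oBall; apply: open_nbhs_nbhs; split.
      rewrite (_ : [set a | _] = [set y | `|map_mx ratr q - y| < r.+1%:R^-1]) //.
      by apply/seteqP; split => y /=; rewrite distrC.
    by [].
  have {}H3 := smap_near_snbhs ce ((smap_near_mx _ _).1 sp) H3.
  by move: H1 H2 H3; apply: filterS3 => f f1 f2 f3.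
move=> A e oA ce Ae; have cb := bproj_carr vE ce.
have [W0 [psi0 [chi0 [T0 W0e]]]] := vtriv_at vE cb.
have [n [Bn BW0]] := HB W0 _ (vt_open T0) cb W0e.
have gn : good n (Psi n).
  by apply: (@xgetPex _ (fun=> 0) [set psi | good n psi]); exists psi0, W0, chi0.
have [W [chi [T BW]]] := gn; have We := BW _ cb Bn.
(* in the trivialization, A contains a product neighbourhood *)
have An : @snbhs R (prod_space X (euclidean R k)) (bproj e, Psi n e)
    [set p | A (chi p.1 p.2)].
  apply: (@smap_near_snbhs R (prod_space X (euclidean R k)) E (fun p => chi p.1 p.2)
    (bproj e, Psi n e) A) => //.
    by apply: (vt_chi_smooth T) => //; [exact: smap_near_fst|exact: smooth_mx_snd].
  by rewrite /= (vt_psiK T) //; exact: oA.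
have [P [Q [xP aQ PQ]]] := snbhs_prod cb (I : @carr R (euclidean R k) (Psi n e)) An.
have [i [Bi BP]] : exists i, B i (bproj e) /\ forall y, carr y -> B i y -> snbhs y P.
  apply: (HB [set y | snbhs y P]) => // y cy /= yP; exact: snbhs_snbhs.
have /nbhs_normP[d /= d0 dQ] := (snbhs_euclidean _ _).1 aQ.
have [r rd] : exists r : nat, r.+1%:R^-1 < d / 2.
  have d20 : 0 < d / 2 by rewrite divr_gt0.
  have [N _ HN] := near_infty_natSinv_lt (PosNum d20).
  by exists N; exact: (HN N (leqnn _)).
have [q Hq] : exists q : 'rV[rat]_k, `|Psi n e - map_mx ratr q| < r.+1%:R^-1.
  by apply: rational_approx; rewrite invr_gt0.
exists (pickle ((n, i, q, r) : nat * nat * 'rV[rat]_k * nat)); rewrite pickleK.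
split; first by split.
move=> f cf [/= _ Bnf Bif qf]; have cbf := bproj_carr vE cf.
have Wf := BW _ cbf Bnf.
rewrite -(vt_psiK T cf Wf); apply: (PQ (bproj f) (Psi n f)) => //.
  exact: snbhs_self (BP _ cbf Bif).
apply: dQ => /=.
have -> : Psi n e - Psi n f = (Psi n e - map_mx ratr q) - (Psi n f - map_mx ratr q).
  by rewrite opprB addrA subrK.
apply: le_lt_trans (ler_normB _ _) _.
move: rd Hq qf; move: (r.+1%:R^-1) (`|_ - _|) (`|Psi n f - _|) => x y z; lra.
Qed.

Lemma vbundle_manifold : is_manifold X -> is_manifold E.
Proof.
move=> [hX sX [n lX]]; split.
- exact: (vbundle_hausdorff vE).
- exact: vbundle_second_countable.
- by exists (n + k)%N; exact: (vbundle_locally_euclidean vE).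
Qed.
End SecondCountable.

(** * Lifting curves through submersions *)

Lemma onto_right_inverse (F : fieldType) n m (A : 'M[F]_(n, m)) :
  (forall w : 'rV_m, exists a : 'rV_n, a *m A = w) -> exists C, C *m A = 1%:M.
Proof.
move=> H; have [r Hr] := boolp.choice H.
exists (\matrix_(l, i) r (delta_mx 0 l) 0 i).
apply/row_matrixP => l; rewrite row_mul row1 -[RHS]Hr; congr (_ *m _).
by apply/rowP => i; rewrite !mxE.
Qed.

Section CurveLift.
Variable R : realType.

Variables (G M : smoothSpace R) (n m : nat) (s : G -> M).
Hypotheses (lG : locally_euclidean n G) (lM : locally_euclidean m M).
Hypotheses (ss : smooth_map s) (sub : submersion s).

(** In charts, let a0 and xi be the initial point and velocity and let B be a right
inverse of the differential J0 of s at a0. The lift is a0 + t xi + z(t) B, where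
z(t) solves s(a0 + t xi + z B) = x(t). The solution is given by the local
inverse of (t, z) |-> (t, s(a0 + t xi + z B)), whose Jacobian at 0 is unitriangular. Its
initial velocity is xi since z has derivative 0: differentiate the equation. *)
Theorem curve_lift (x : R -> M) (v : tangent G) : germ_curve x -> carr v ->
  tmap s v = Vel x -> exists a : R -> G,
  [/\ germ_curve a, Vel a = v & \forall t \near (0 : R), s (a t) = x t].
Proof.
move=> gx cv sv; have cg0 := carr_base cv; have csg := ss.1 _ cg0.
have x0 : s v.1 = x 0 by have [] := sv.
have [Q [U [F [F' [C Qg]]]]] := (locally_euclideanP _ _).1 lG _ cg0.
have [Q1 [U1 [F1 [F1' [C1 Q1g]]]]] := (locally_euclideanP _ _).1 lM _ csg.
have sns g : carr g -> smap_near g s by exact: (smooth_map_near ss).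
pose Phi l (a : 'rV[R]_n) := F1 (s (F' a)) 0 l.
pose U2 := U `&` [set a | Q1 (s (F' a))].
have oU := chart_range_open C.
have oU2 : open U2.
  apply: (open_near (A := U) (B := fun a => Q1 (s (F' a)))) => // a [Ua Qa].
  have [ca Oa] := chart_carr C Ua; split; first exact: open_nbhs_nbhs.
  apply/snbhs_euclidean; apply: (@smap_near_snbhs R (euclidean R n) M (s \o F') a Q1 I).
    apply: (@smap_near_comp R (euclidean R n) G M F' s) => //; last exact: sns.
    exact: (chart_inv_smooth C).
  by apply: (chart_open C1) => //; exact: ss.1.
have CPhi l : Cinfty U2 (Phi l).
  apply: CinftyP => // a [Ua Qa]; have [ca Oa] := chart_carr C Ua.
  apply: (@smap_near_smooth R (euclidean R n) M (s \o F') a (fun y => F1 y 0 l) I).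
    apply: (@smap_near_comp R (euclidean R n) G M F' s) => //; last exact: sns.
    exact: (chart_inv_smooth C).
  by apply: (chart_coord_smooth C1) => //; exact: ss.1.
pose a0 := F v.1.
have Ua0 : U2 a0 by split; [exact: (chart_in C)|rewrite /= (chart_K C)].
pose J0 : 'M[R]_(n, m) := \matrix_(i, l) 'D_(delta_mx 0 i) (Phi l) a0.
pose vel (c : R -> G) : 'rV[R]_n := \row_i derive1 ((fun y => F y 0 i) \o c) 0.
(* J0 is the differential of s in the charts *)
have ds c l : germ_curve c -> c 0 = v.1 ->
    derive1 ((fun y => F1 y 0 l) \o (s \o c)) 0 = (vel c *m J0) 0 l.
  move=> gc c0; have rE y : \row_i F y 0 i = F y by apply/rowP => i; rewrite mxE.
  have sF i : smooth_near (c 0) (fun y => F y 0 i).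
    by rewrite c0; exact: (chart_coord_smooth C).
  have V0 : U2 (\row_i F (c 0) 0 i) by rewrite rE c0.
  have H : \forall y \near snbhs (c 0), ((fun y => F1 y 0 l) \o s) y = Phi l (\row_i F y 0 i).
    have cQ : snbhs (c 0) Q by rewrite c0; exact: (chart_open C).
    move: cQ (snbhs_carr (c 0)); apply: filterS2 => y Qy cy.
    by rewrite rE /Phi (chart_K C).
  rewrite -[X in derive1 X]/(((fun y => F1 y 0 l) \o s) \o c).
  rewrite (derive_germ gc sF oU2 V0 (CPhi l) H) mxE rE c0.
  by apply: eq_bigr => i _; rewrite !mxE.
have surj w : exists xi : 'rV[R]_n, xi *m J0 = w.
  pose y := F1' \o (fun t : R => F1 (s v.1) + t *: w).
  have U1s : U1 (F1 (s v.1) + 0 *: w) by rewrite scale0r addr0; exact: (chart_in C1).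
  have gy : germ_curve y by apply: (chart_germ C1 _ U1s); exact: germ_affine.
  have y0 : y 0 = s v.1 by rewrite /y /= scale0r addr0 (chart_K C1).
  have [v' [cv' v'0 sv']] := sub cg0 (carr_Vel gy) y0.
  have [c [gc v'E]] := carr_tangentP cv'.
  have c0 : c 0 = v.1 by rewrite -v'0 v'E.
  exists (vel c); apply/rowP => l; rewrite -ds //.
  have gsc : germ_curve (s \o c) by exact: germ_comp_smooth.
  rewrite (@Vel_local R M (s \o c) y (fun z => F1 z 0 l) gsc gy).
  - rewrite /y (derive_coord_chart C1) ?derive1_affine //; exact: germ_affine.
  - by rewrite -tmap_Vel // -v'E.
  - by rewrite /= c0; exact: (chart_coord_smooth C1).
have [B BJ] := onto_right_inverse surj.
have [c [gc vE]] := carr_tangentP cv.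
have c0 : c 0 = v.1 by rewrite vE.
pose xi := vel c.
have xiJ l : derive1 ((fun y => F1 y 0 l) \o x) 0 = (xi *m J0) 0 l.
  rewrite -ds //; have gsc : germ_curve (s \o c) by exact: germ_comp_smooth.
  symmetry; apply: Vel_local => //; first by rewrite -tmap_Vel // -vE.
  by rewrite /= c0; exact: (chart_coord_smooth C1).
(* b = (t, z), A b = a0 + t xi + z B and Om b = (t, s (A b)) *)
pose K : 'M[R]_(1 + m, n) := col_mx xi B.
pose A (b : 'rV[R]_(1 + m)) : 'rV[R]_n := a0 + b *m K.
pose Om (j : 'I_(1 + m)) (b : 'rV[R]_(1 + m)) : R :=
  match fintype.split j with inl _ => b 0 (lshift m 0) | inr l => Phi l (A b) end.
have AE b : \row_i A b 0 i = A b by apply/rowP => i; rewrite mxE.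
pose U3 := setT `&` [set b | U2 (\row_i A b 0 i)].
have oU3 : open U3.
  by apply: open_preimage_row => //; [exact: openT|move=> i; apply: Cinfty_affine; exact: openT].
have CPA l : Cinfty U3 (fun b => Phi l (A b)).
  have := Cinfty_comp oU3 (F := fun i b => A b 0 i) (phi := Phi l) (V := U2).
  under [X in _ -> _ -> _ -> Cinfty U3 X]eq_fun do rewrite AE.
  by apply => [b []//|i|]; [exact: Cinfty_affine|exact: CPhi].
have COm j : Cinfty U3 (Om j).
  rewrite /Om; case: (fintype.split j) => [i|l]; last exact: CPA.
  by move=> k; exact: Ck_coord.
have A0 : A 0 = a0 by rewrite /A mul0mx addr0.
have U30 : U3 0 by split=> //=; rewrite AE A0.
have Jac : jacobian_mx Om 0 = block_mx 1%:M (xi *m J0) 0 1%:M.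
  apply/matrixP => i j; rewrite mxE -(splitK j) /Om unsplitK.
  case: (fintype.split j) => [j'|l] /=.
    rewrite derive_coord -(splitK i); case: (fintype.split i) => i' /=.
      by rewrite block_mxEul !mxE !ord1 /=.
    by rewrite block_mxEdl !mxE /= ?eq_lrshift ?eq_rlshift.
  have dA k : differentiable (fun b => A b 0 k) 0 by apply: (Cinfty_affine a0 K k oU3 1%N).1.
  have dP : differentiable (Phi l) (\row_k A 0 0 k) by rewrite AE A0; exact: (CPhi l 1%N).1.
  have [_] := chain_rule (delta_mx 0 i) dA dP.
  under [X in derive X]eq_fun do rewrite AE.
  move=> ->; rewrite AE A0.
  have -> : \sum_k 'D_(delta_mx 0 i) (fun b => A b 0 k) 0 * 'D_(delta_mx 0 k) (Phi l) a0 =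
      (K *m J0) i l.
    rewrite mxE; apply: eq_bigr => k _; rewrite derive_affine -rowE !mxE; by [].
  rewrite mul_col_mx BJ -(splitK i); case: (fintype.split i) => i' /=.
    by rewrite col_mxEu block_mxEur.
  by rewrite col_mxEd block_mxEdr.
have dJ : \det (jacobian_mx Om 0) != 0.
  by rewrite Jac det_ublock !det1 mulr1 oner_neq0.
have [V [Psi [oV V0 Psi0 HPsi CPsi]]] := inverse_function oU3 U30 COm dJ.
pose gam (t : R) : 'rV[R]_(1 + m) := row_mx (t%:M : 'M[R]_1) (F1 (x t)).
have Ox : Q1 (x 0) by rewrite -x0.
have cx0 := germ_carr gx.
have ggam : @germ_curve R (euclidean R (1 + m)) gam.
  have Qx : \forall y \near snbhs (x 0), carr y /\ Q1 y.
    by apply: filterI; [exact: snbhs_carr|exact: (chart_open C1)].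
  have gF : @germ_curve R (euclidean R m) (F1 \o x).
    apply: germ_comp => //; move: Qx; apply: filterS => y [cy Qy].
    by apply/smap_near_mx; exact: (chart_smooth C1).
  move: gF; rewrite /germ_curve; apply: filterS => t /smap_near_mx sF; apply/smap_near_mx.
  apply: (@smooth_mx_row R (real_line R)) => // i j.
  have := @smooth_near_id R t; congr smooth_near.
  by apply/funext => u; rewrite mxE !ord1 mulr1n.
have gam0 : gam 0 = \row_j Om j 0.
  apply/rowP => j; rewrite mxE -(splitK j) /Om unsplitK /gam.
  case: (fintype.split j) => j' /=; first by rewrite row_mxEl !mxE ord1 mul0rn.
  by rewrite row_mxEr /Phi A0 (chart_K C) // x0.
have Vgam : \forall t \near (0 : R), V (gam t).
  apply: (germ_near ggam); apply/snbhs_euclidean; apply: open_nbhs_nbhs.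
  by rewrite gam0.
pose b t := Psi (gam t).
have gb : @germ_curve R (euclidean R (1 + m)) b.
  apply: (germ_comp ggam); apply/snbhs_euclidean.
  have : \forall z \near gam 0, V z by apply: open_nbhs_nbhs; rewrite gam0.
  apply: filterS => z Vz; apply/smap_near_mx => i j; rewrite (ord1 i).
  exact: (Cinfty_smooth_near oV Vz (CPsi j)).
have b0 : b 0 = 0 by rewrite /b gam0 Psi0.
have gAb : @germ_curve R (euclidean R n) (A \o b).
  apply: (germ_comp gb); apply: filterE => z; apply/smap_near_mx => i j; rewrite (ord1 i).
  exact: (Cinfty_smooth_near openT I (Cinfty_affine a0 K j openT)).
have UAb : U ((A \o b) 0) by rewrite /= b0 A0; case: Ua0.
pose a := F' \o (A \o b).
have ga : germ_curve a by exact: (chart_germ C).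
have a0E : a 0 = v.1 by rewrite /a /= b0 A0 (chart_K C).
have sa : \forall t \near (0 : R), s (a t) = x t.
  have Qx : \forall t \near (0 : R), carr (x t) /\ Q1 (x t).
    apply: (germ_near gx (P := fun y => carr y /\ Q1 y)).
    by apply: filterI; [exact: snbhs_carr|exact: (chart_open C1)].
  move: Vgam Qx; apply: filterS2 => t Vt [cxt Qxt].
  have [[_ /=]] := HPsi _ Vt; rewrite AE => -[Ut Qt] E.
  have [cat _] := chart_carr C Ut.
  rewrite -(chart_K C1 cxt Qxt) -[LHS](chart_K C1) //; last exact: ss.1.
  congr F1'; apply/rowP => l; have := congr1 (fun M : 'rV[R]_(1 + m) => M 0 (rshift 1 l)) E.
  by rewrite mxE /Om (unsplitK (inr l)) row_mxEr.
exists a; split => //; rewrite vE; apply: (Vel_chart C) => //.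
- by rewrite a0E.
- by rewrite a0E.
move=> i; rewrite (derive_coord_chart C) //.
have velE k : vel a 0 k = derive1 (fun t => (A \o b) t 0 k) 0.
  by rewrite mxE (derive_coord_chart C).
(* the velocity of b is (1, rsubmx be), and rsubmx be = 0 since s o a = x *)
pose be : 'rV[R]_(1 + m) := \row_j derive1 (fun t => b t 0 j) 0.
have velA : vel a = be *m K.
  apply/rowP => k; rewrite velE.
  have sb j : @smooth_near R (euclidean R (1 + m)) (b 0) (fun z => z 0 j).
    by apply: smooth_near_coords; exists j.
  have rE (z : 'rV[R]_(1 + m)) : \row_j z 0 j = z by apply/rowP => j; rewrite mxE.
  have H : @snbhs R (euclidean R (1 + m)) (b 0)
      (fun z => A z 0 k = (fun z => A z 0 k) (\row_j z 0 j)).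
    by apply: filterE => z; rewrite rE.
  have := @derive_germ R (euclidean R (1 + m)) b _ (fun j z => z 0 j) setT
    (fun z => A z 0 k) (fun z => A z 0 k) gb sb openT I (Cinfty_affine a0 K k openT) H.
  move=> E; apply: etrans E _; rewrite mxE; apply: eq_bigr => j _.
  by rewrite derive_affine -rowE !mxE.
have be1 : lsubmx be = 1%:M.
  apply/rowP => j; rewrite !mxE ord1 /=.
  have E : \forall t \near (0 : R), b t 0 (lshift m 0) = t.
    move: Vgam; apply: filterS => t Vt; have [_ E] := HPsi _ Vt.
    have := congr1 (fun M : 'rV[R]_(1 + m) => M 0 (lshift m 0)) E.
    by rewrite mxE /Om (unsplitK (inl 0)) row_mxEl mxE /= mulr1n.
  by rewrite derive1E (near_eq_derive (g := (id : R -> R)) 1 E) derive_id.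
have zeta : vel a = xi + rsubmx be *m B.
  by rewrite velA -[be]hsubmxK be1 mul_row_col mul1mx row_mxKr.
have z0 : rsubmx be = 0.
  apply/rowP => l; have := @ds a l ga a0E.
  have [gsa] := Vel_near gx (filterS (fun t (e : s (a t) = x t) => esym e) sa).
  move=> /(Vel_local gsa gx) => /(_ (fun y => F1 y 0 l)) => ->; last first.
    by rewrite /= a0E; exact: (chart_coord_smooth C1).
  rewrite xiJ zeta mulmxDl -mulmxA BJ mulmx1 [in RHS]mxE => /eqP.
  by rewrite -subr_eq0 opprD addNKr oppr_eq0 => /eqP ->; rewrite mxE.
by rewrite -velE zeta z0 mul0mx addr0 /xi mxE.
Qed.

End CurveLift.

(** * Fibrewise surjective bundle maps *)

(** D and B are coordinates on the kernel of A, which has dimension N - K, and their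
inverse: the factors of the projection 1 - A C onto this kernel. *)
Lemma kernel_splitting (F : fieldType) N K (A : 'M[F]_(N, K)) (C : 'M[F]_(K, N)) :
  C *m A = 1%:M -> exists (B : 'M[F]_(N - K, N)) (D : 'M[F]_(N, N - K)),
  [/\ B *m D = 1%:M, C *m D = 0, D *m B = 1%:M - A *m C & B *m A = 0].
Proof.
move=> CA; pose P := 1%:M - A *m C.
have PA : P *m A = 0 by rewrite mulmxBl mul1mx -mulmxA CA mulmx1 subrr.
have CP : C *m P = 0 by rewrite mulmxBr mulmx1 mulmxA CA mul1mx subrr.
have PP : P *m P = P by rewrite {2}/P mulmxBr mulmx1 mulmxA PA mul0mx subr0.
have rA : row_full A by apply/row_fullP; exists C.
have E : \rank P = (N - K)%N.
  have <- : \rank (kermx A) = (N - K)%N by rewrite mxrank_ker (eqP rA).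
  apply/eqP; rewrite eqn_leq; apply/andP; split; apply: mxrankS.
    exact/sub_kermxP.
  have -> : kermx A = kermx A *m P.
    by rewrite mulmxBr mulmx1 mulmxA mulmx_ker mul0mx subr0.
  exact: submxMl.
rewrite -E; exists (row_base P), (col_base P).
have DB : col_base P *m row_base P = P by exact: mulmx_base.
have fB : row_free (row_base P) by exact: row_base_free.
have fD : row_full (col_base P) by exact: col_base_full.
split => //.
- apply: (row_full_inj fD); apply: (row_free_inj fB).
  by rewrite mulmxA DB -mulmxA DB PP mulmx1 DB.
- by apply: (row_free_inj fB); rewrite mul0mx -mulmxA DB.
- by apply: (row_full_inj fD); rewrite mulmxA DB PA mulmx0.
Qed.

Section BundleMaps.
Variable R : realType.

Definition fibrewise_onto (G M : smoothSpace R) (V : vbundle G) (VM : vbundle M)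
    (S : V -> VM) (s : G -> M) :=
  forall g w, carr g -> carr w -> bproj w = s g ->
  exists v, [/\ carr v, bproj v = g & S v = w].

Section LocalMatrix.
Variables (G M : smoothSpace R) (N K : nat) (V : vbundle G) (VM : vbundle M).
Hypotheses (vV : is_vbundle N V) (vVM : is_vbundle K VM).
Variables (S : V -> VM) (s : G -> M).
Hypothesis mS : vb_morphism S s.

Variables (W : set G) (psi : V -> 'rV[R]_N) (chi : G -> 'rV[R]_N -> V).
Variables (W1 : set M) (psi1 : VM -> 'rV[R]_K) (chi1 : M -> 'rV[R]_K -> VM).
Hypotheses (T : vtriv W psi chi) (T1 : vtriv W1 psi1 chi1).

(** The matrix of S in the two trivializations, acting on row vectors. *)
Definition local_mx (g : G) : 'M[R]_(N, K) :=
  \matrix_(i, l) psi1 (S (chi g (delta_mx 0 i))) 0 l.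

Let S_near v : carr v -> smap_near v S.
Proof. by have [/smooth_mapP sS _ _ _ _] := mS; exact: sS. Qed.

Let S_carr v : carr v -> carr (S v).
Proof. by have [sS _ _ _ _] := mS; exact: sS.1. Qed.

Let S_bproj v : carr v -> bproj (S v) = s (bproj v).
Proof. by have [_ _ + _ _] := mS; exact. Qed.

Lemma local_mxE g a : carr g -> W g -> W1 (s g) ->
  psi1 (S (chi g a)) = a *m local_mx g.
Proof.
move=> cg Wg W1g; have [_ _ _ Sa Ss] := mS.
pose L (b : 'rV[R]_N) := psi1 (S (chi g b)).
have cc b : carr (chi g b) by have [] := vt_chi T b cg Wg.
have cb b : bproj (chi g b) = g by have [] := vt_chi T b cg Wg.
have LD b c : L (b + c) = L b + L c.
  rewrite /L (chi_add vV T) // Sa ?cb //.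
  by rewrite (vt_add T1) ?S_bproj ?cb //; exact: S_carr.
have LZ z b : L (z *: b) = z *: L b.
  rewrite /L (chi_scale vV T) // Ss ?cb //.
  by rewrite (vt_scale T1) ?S_bproj ?cb //; exact: S_carr.
have L0 : L 0 = 0 by rewrite -(scale0r 0) LZ scale0r.
rewrite -/(L a) {1}(row_sum_delta a) (big_morph L LD L0).
apply/rowP => l; rewrite summxE mxE; apply: eq_bigr => i _.
by rewrite LZ !mxE.
Qed.

Lemma local_mx_psi v : carr v -> W (bproj v) -> W1 (s (bproj v)) ->
  psi1 (S v) = psi v *m local_mx (bproj v).
Proof.
move=> cv Wv W1v; rewrite -local_mxE ?(vt_psiK T) //; exact: (bproj_carr vV).
Qed.

Lemma local_mx_smooth g : carr g -> W g -> W1 (s g) -> smooth_mx g local_mx.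
Proof.
move=> cg Wg W1g i l.
have -> : (fun g => local_mx g i l) = (fun g => psi1 (S (chi g (delta_mx 0 i))) 0 l).
  by apply/funext => z; rewrite mxE.
have [cc cb] := vt_chi T (delta_mx 0 i) cg Wg.
have sc : smap_near g (fun g => chi g (delta_mx 0 i)).
  apply: (vt_chi_smooth T (f := id)) => //; last exact: smooth_mx_cst.
  exact: (smooth_map_near (@smooth_map_id R G)).
have := smooth_mx_comp cg (smap_near_comp cg sc (S_near cc)) (A := psi1).
by apply; apply: (vt_psi_smooth T1); [exact: S_carr|rewrite /= S_bproj // cb].
Qed.

Lemma local_mx_onto g : fibrewise_onto S s -> carr g -> W g -> W1 (s g) ->
  exists C : 'M[R]_(K, N), C *m local_mx g = 1%:M.
Proof.
move=> oS cg Wg W1g; have csg : carr (s g) by have [_ ss _ _ _] := mS; exact: ss.1.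
apply: onto_right_inverse => w; have [c1 b1] := vt_chi T1 w csg W1g.
have [v [cv bv Sv]] := oS g _ cg c1 b1.
by exists (psi v); rewrite -bv -local_mx_psi ?bv // Sv (vt_chiK T1).
Qed.

End LocalMatrix.

Lemma unit_right_inverse m n (A : 'M[R]_(n, m)) (C : 'M[R]_(m, n)) :
  \det (C *m A) != 0 -> invmx (C *m A) *m C *m A = 1%:M.
Proof. by move=> d; rewrite -mulmxA mulVmx // unitmxE unitfE. Qed.

(** A vector x is recovered from its coordinates x D along the kernel of A0 and its
image x A, for A close to A0. *)
Lemma split_recover n m d (x : 'rV[R]_n) (A0 A : 'M[R]_(n, m)) (C : 'M[R]_(m, n))
    (D : 'M[R]_(n, d)) (B : 'M[R]_(d, n)) :
  D *m B = 1%:M - A0 *m C -> \det (C *m A) != 0 ->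
  x *m D *m B + (x *m A - x *m D *m B *m A) *m (invmx (C *m A) *m C) = x.
Proof.
move=> DB dA.
have -> : x *m D *m B = x - x *m A0 *m C by rewrite -mulmxA DB mulmxBr mulmx1 mulmxA.
rewrite [(x - _) *m A]mulmxBl opprB [x *m A + _]addrC subrK.
rewrite -(mulmxA (x *m A0) C A) -(mulmxA (x *m A0) (C *m A)) (mulmxA (C *m A)).
by rewrite mulmxV ?unitmxE ?unitfE // mul1mx subrK.
Qed.

Section Submersion.
Variables (G M : smoothSpace R) (n m N K : nat) (V : vbundle G) (VM : vbundle M).
Hypotheses (lG : locally_euclidean n G) (lM : locally_euclidean m M).
Hypotheses (vV : is_vbundle N V) (vVM : is_vbundle K VM).
Variables (S : V -> VM) (s : G -> M).
Hypotheses (mS : vb_morphism S s) (oS : fibrewise_onto S s) (sub : submersion s).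

(** Given a velocity of a curve w in VM, lift the projection of w to a curve a in G by
[curve_lift], start with constant fibre coordinates xi0 over a, and correct them
by the fibre coordinates of w minus their image, pulled back by a right inverse
of the matrix of S that depends smoothly on the point. The correction vanishes
at time 0. *)
Lemma bundle_submersion : submersion S.
Proof.
move=> v0 cv0 Wt cWt Wt0; have [sS ss Sb _ _] := mS.
have [w [gw WtE]] := carr_tangentP cWt.
have w0 : w 0 = S v0 by rewrite -Wt0 WtE.
pose x := @bproj _ M VM \o w.
have gx : germ_curve x by apply: germ_comp_smooth => //; exact: (bproj_smooth vVM).
have cg0 := bproj_carr vV cv0; set g0 := bproj v0 in cg0.
have x0 : x 0 = s g0 by rewrite /x /= w0 Sb.
have [v [cv v0E sv]] := sub cg0 (carr_Vel gx) x0.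
have [a [ga aE sa]] := curve_lift lG lM ss sub gx cv sv.
have a0 : a 0 = g0 by rewrite -v0E -aE.
have [W [psi [chi [T Wg]]]] := vtriv_at vV cg0.
have csg := ss.1 _ cg0.
have [W1 [psi1 [chi1 [T1 W1g]]]] := vtriv_at vVM csg.
pose A := local_mx S chi psi1.
(* C is a right inverse at g0, and (C A g)^-1 C one at all nearby g *)
have [C CA] := local_mx_onto vV mS T T1 oS cg0 Wg W1g.
have sA g : carr g -> W g -> W1 (s g) -> smooth_mx g A by exact: (local_mx_smooth mS T T1).
pose good g := [/\ carr g, W g, W1 (s g) & \det (C *m A g) != 0].
have ng0 : snbhs g0 good.
  have n1 : \forall g \near snbhs g0, carr g /\ W g.
    by apply: filterI; [exact: snbhs_carr|exact: (vt_open T)].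
  have n2 : \forall g \near snbhs g0, W1 (s g).
    apply: (smap_near_snbhs cg0 (smooth_map_near ss cg0)).
    exact: (vt_open T1).
  have n3 : \forall g \near snbhs g0, \det (C *m A g) != 0.
    apply: det_near => //; last by rewrite CA det1 oner_neq0.
    by apply: smooth_mx_mul => //; [exact: smooth_mx_cst|exact: sA].
  by move: n1 n2 n3; apply: filterS3 => g [].
have good_a : \forall t \near (0 : R), good (a t) by apply: (germ_near ga); rewrite a0.
pose xi0 := psi v0.
pose xi t := xi0 + (psi1 (w t) - xi0 *m A (a t)) *m (invmx (C *m A (a t)) *m C).
pose c t := chi (a t) (xi t).
have wW1 : \forall t \near (0 : R), carr (w t) /\ W1 (bproj (w t)).
  apply: (germ_near gw (P := fun z => carr z /\ W1 (bproj z))).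
  have cw0 := germ_carr gw.
  apply: filterI; first exact: snbhs_carr.
  apply: (smap_near_snbhs cw0 (bproj_near vVM cw0)).
  by apply: (vt_open T1); [exact: (bproj_carr vVM)|rewrite w0 Sb].
have gc : germ_curve c.
  move: ga gw; rewrite /germ_curve => ga' gw'.
  have gaw : \forall t \near (0 : R), @smap_near R (real_line R) G t a /\
      @smap_near R (real_line R) VM t w by move: ga' gw'; apply: filterS2.
  move: gaw good_a wW1; apply: filterS3 => t [sa_t sw_t] [cat Wat W1at dat] [cwt W1t].
  have ct : @carr R (real_line R) t by [].
  have sAa := smooth_mx_comp ct sa_t (sA _ cat Wat W1at).
  have sw1 := smooth_mx_comp ct sw_t (vt_psi_smooth T1 cwt W1t).
  have sc m' n' (Q : 'M[R]_(m', n')) := @smooth_mx_cst R (real_line R) t m' n' Q.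
  have sCA := smooth_mx_mul ct (sc _ _ C) sAa.
  apply: (vt_chi_smooth T) => //; apply: (smooth_mx_add ct (sc _ _ xi0)).
  apply: (smooth_mx_mul ct (smooth_mx_sub ct sw1 (smooth_mx_mul ct (sc _ _ xi0) sAa))).
  exact: (smooth_mx_mul ct (smooth_mx_inv ct sCA dat) (sc _ _ C)).
have Sc : \forall t \near (0 : R), S (c t) = w t.
  move: good_a wW1 sa; apply: filterS3 => t [cat Wat W1at dat] [cwt W1t] sat.
  have [cc cb] := vt_chi T (xi t) cat Wat.
  have bSc : bproj (S (c t)) = bproj (w t) by rewrite Sb // cb sat.
  apply: (vt_inj T1) => //; [exact: sS.1|by rewrite bSc|].
  rewrite /c (local_mxE vV mS T T1) // -/A /xi mulmxDl -mulmxA (unit_right_inverse dat).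
  by rewrite mulmx1 addrC subrK.
have c0 : c 0 = v0.
  rewrite /c /xi w0 a0 (local_mx_psi vV mS T T1) // subrr mul0mx addr0.
  exact: (vt_psiK T).
exists (Vel c); split => //; first exact: carr_Vel.
rewrite tmap_Vel // WtE.
have Sc' : {near (0 : R), w =1 S \o c} by move: Sc; apply: filterS => t /= ->.
by have [_ ->] := Vel_near gw Sc'.
Qed.

End Submersion.

Section FibreProduct.
Variables (G M : smoothSpace R) (g : gpd G M) (N K : nat).
Variables (V : vbundle G) (VM : vbundle M) (gV : gpd V VM).
Hypotheses (vV : is_vbundle N V) (vVM : is_vbundle K VM).
Hypotheses (mS : vb_morphism (gsrc gV) (gsrc g)) (mT : vb_morphism (gtgt gV) (gtgt g)).
Hypothesis oS : fibrewise_onto (gsrc gV) (gsrc g).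

Let S := gsrc gV.
Let T := gtgt gV.
Let s := gsrc g.
Let t := gtgt g.

Lemma composable_fst (X Y : smoothSpace R) (h : gpd X Y) (p : composable h) :
  smap_near p (fst : composable h -> X).
Proof. by apply: smap_near_from_sub; exact: smap_near_fst. Qed.

Lemma composable_snd (X Y : smoothSpace R) (h : gpd X Y) (p : composable h) :
  smap_near p (snd : composable h -> X).
Proof. by apply: smap_near_from_sub; exact: smap_near_snd. Qed.

Lemma composable_pair (X Y Z : smoothSpace R) (h : gpd X Y) (z : Z) (F F' : Z -> X) :
  smap_near z F -> smap_near z F' ->
  (\forall w \near snbhs z, gsrc h (F w) = gtgt h (F' w)) ->
  smap_near z ((fun w => (F w, F' w)) : Z -> composable h).
Proof.
by move=> sF sF' E; apply: smap_near_to_sub => //; exact: smap_near_pair.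
Qed.

Lemma composable_bproj p : @carr R (composable gV) p ->
  @carr R (composable g) (bproj p.1, bproj p.2).
Proof.
move=> [[c1 c2] e]; split; first by split; exact: (bproj_carr vV).
have [_ _ Sb _ _] := mS; have [_ _ Tb _ _] := mT.
by rewrite /= -Sb // -Tb // e.
Qed.

(** In trivializations a pair (xi, xi') is composable when xi A = xi' B, with A and
B the matrices of S and T. Coordinates on these pairs are (xi D, xi'), with D
from [kernel_splitting] at one base point, and xi is recovered by
[split_recover] near this point. *)
Lemma composable_vbundle : is_vbundle ((N - K) + N) (composable_vb g gV).
Proof.
have [sS ss Sb Sa Ss] := mS; have [sT st Tb Ta Ts] := mT.
apply/is_vbundleP; split.
- apply/smooth_mapP => p cp; have [[c1 c2] e] := cp.
  apply: composable_pair.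
  + apply: (@smap_near_comp R (composable gV) V G fst (@bproj _ G V)) => //.
      exact: composable_fst.
    exact: (bproj_near vV).
  + apply: (@smap_near_comp R (composable gV) V G snd (@bproj _ G V)) => //.
      exact: composable_snd.
    exact: (bproj_near vV).
  + have := @snbhs_carr R (composable gV) p; apply: filterS => q cq.
    by have [] := composable_bproj cq.
- move=> p q [[p1 p2] pe] [[q1 q2] qe] /= [b1 b2]; rewrite /= in pe qe.
  split; last by rewrite !(vadd_bproj vV).
  split; first by split; exact: (vadd_carr vV).
  by rewrite /= Sa // Ta // pe qe.
- move=> a p [[p1 p2] pe]; rewrite /= in pe; split; last by rewrite /= !(vscale_bproj vV).
  split; first by split; exact: (vscale_carr vV).
  by rewrite /= Ss // Ts // pe.
move=> [g0 g1] [[/= cg0 cg1] e01].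
have [W [psi [chi [T0 Wg]]]] := vtriv_at vV cg0.
have [W' [psi' [chi' [T' Wg']]]] := vtriv_at vV cg1.
have [W1 [psi1 [chi1 [T1 W1g]]]] := vtriv_at vVM (ss.1 _ cg0).
pose A := local_mx S chi psi1; pose B := local_mx T chi' psi1.
have [C CA] := local_mx_onto vV mS T0 T1 oS cg0 Wg W1g.
have [B0 [D [BD CD DB BA]]] := kernel_splitting CA.
have sA h : carr h -> W h -> W1 (s h) -> smooth_mx h A by exact: (local_mx_smooth mS T0 T1).
have sB h : carr h -> W' h -> W1 (t h) -> smooth_mx h B by exact: (local_mx_smooth mT T' T1).
pose good (p : composable g) := [/\ W p.1, W' p.2, W1 (s p.1) & \det (C *m A p.1) != 0].
pose xi (p : composable g) (a : 'rV[R]_((N - K) + N)) : 'rV[R]_N :=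
  lsubmx a *m B0 +
  (rsubmx a *m B p.2 - lsubmx a *m B0 *m A p.1) *m (invmx (C *m A p.1) *m C).
pose PSI (q : composable gV) : 'rV[R]_((N - K) + N) :=
  row_mx (psi q.1 *m D) (psi' q.2).
pose CHI (p : composable g) a : composable gV := (chi p.1 (xi p a), chi' p.2 (rsubmx a)).
exists good, PSI, CHI; split; last first.
  by split => //=; rewrite -/A CA det1 oner_neq0.
have og : is_open good.
  move=> p cp [w1 w2 w3 d]; have [[c1 c2] e] := cp.
  have n1 : @snbhs R (composable g) p (fun q => W q.1 /\ W1 (s q.1)).
    apply: (@smap_near_snbhs R (composable g) G fst p (fun h => W h /\ W1 (s h))) => //.
      exact: composable_fst.
    apply: filterI; first exact: (vt_open T0).
    by apply: (smap_near_snbhs c1 (smooth_map_near ss c1)); exact/(vt_open T1)/w3/ss.1.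
  have n2 : @snbhs R (composable g) p (fun q => W' q.2).
    apply: (@smap_near_snbhs R (composable g) G snd p W') => //.
      exact: composable_snd.
    exact: (vt_open T').
  have n3 : @snbhs R (composable g) p (fun q => \det (C *m A q.1) != 0).
    apply: (@smap_near_snbhs R (composable g) G fst p (fun h => \det (C *m A h) != 0)) => //.
      exact: composable_fst.
    by apply: det_near => //; apply: smooth_mx_mul => //; [exact: smooth_mx_cst|exact: sA].
  by move: n1 n2 n3; apply: filterS3 => q [].
have W1t p : @carr R (composable g) p -> good p -> W1 (t p.2).
  by move=> [_ e] [_ _ + _]; rewrite /s e.
have xiA p a : good p -> xi p a *m A p.1 = rsubmx a *m B p.2.
  move=> [_ _ _ d]; rewrite /xi mulmxDl -[X in _ + X]mulmxA (unit_right_inverse d) mulmx1.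
  by rewrite addrC subrK.
have xiD p a : good p -> xi p a *m D = lsubmx a.
  move=> [_ _ _ d]; rewrite /xi mulmxDl -!mulmxA CD !mulmx0 addr0 BD mulmx1; by [].
have cCHI p a : @carr R (composable g) p -> good p ->
    @carr R (composable gV) (CHI p a) /\ (bproj (CHI p a).1, bproj (CHI p a).2) = p.
  move=> cp gp; have [[c1 c2] e] := cp; have [w1 w2 w3 d] := gp.
  have [h1 h2] := vt_chi T0 (xi p a) c1 w1; have [h3 h4] := vt_chi T' (rsubmx a) c2 w2.
  split; last by rewrite /= h2 h4; case: (p).
  split; first by split.
  rewrite /=; apply: (vt_inj T1) => //; [exact: sS.1|exact: sT.1|by rewrite Sb // h2|..].
    by rewrite Sb // Tb // h2 h4.
  rewrite (local_mxE vV mS T0 T1) // (local_mxE vV mT T' T1) //; last exact: W1t.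
  by rewrite -/A xiA.
split.
- exact: og.
- move=> q cq [w1 w2 w3 d]; have [[c1 c2] e] := cq.
  apply: smooth_mx_row.
    apply: smooth_mx_mul => //; last exact: smooth_mx_cst.
    apply: (@smooth_mx_comp R (composable gV) V fst q _ _ psi) => //; first exact: composable_fst.
    exact: (vt_psi_smooth T0).
  apply: (@smooth_mx_comp R (composable gV) V snd q _ _ psi') => //; first exact: composable_snd.
  by apply: (vt_psi_smooth T') => //; exact: (composable_bproj cq).1.2.
- move=> p a cp gp; exact: cCHI.
- move=> p a cp gp; have [[c1 c2] e] := cp; have [w1 w2 w3 d] := gp.
  by rewrite /PSI /CHI /= (vt_chiK T0) // (vt_chiK T') // xiD // hsubmxK.
- move=> q cq gq; have [[c1 c2] e] := cq; have [w1 w2 w3 d] := gq.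
  have cbq := composable_bproj cq.
  rewrite /CHI /PSI /= row_mxKr (vt_psiK T') //.
  suff -> : xi (bproj q.1, bproj q.2) (row_mx (psi q.1 *m D) (psi' q.2)) = psi q.1.
    by rewrite (vt_psiK T0) //; case: (q).
  rewrite /xi /= row_mxKl row_mxKr.
  have <- : psi1 (T q.2) = psi' q.2 *m B (bproj q.2).
    by apply: (local_mx_psi vV mT T' T1) => //; exact: (W1t _ cbq gq).
  have <- : psi1 (S q.1) = psi1 (T q.2) by congr psi1; exact: e.
  rewrite (local_mx_psi vV mS T0 T1) // -/A.
  exact: (split_recover _ DB d).
- move=> Z z f a cz gf sf sa; have cp := snbhs_self cz sf.1.
  have [[c1 c2] e] := cp; have [w1 w2 w3 d] := gf.
  have s1 : smap_near z (fun w => (f w).1).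
    by apply: (@smap_near_comp R Z (composable g) G f fst) => //; exact: composable_fst.
  have s2 : smap_near z (fun w => (f w).2).
    by apply: (@smap_near_comp R Z (composable g) G f snd) => //; exact: composable_snd.
  have sr := smooth_mx_rsub sa; have sl := smooth_mx_lsub sa.
  have sAz := smooth_mx_comp cz s1 (sA _ c1 w1 w3).
  have sBz := smooth_mx_comp cz s2 (sB _ c2 w2 (W1t _ cp gf)).
  have sc m n (Q : 'M[R]_(m, n)) := @smooth_mx_cst R Z z m n Q.
  have slB := smooth_mx_mul cz sl (sc _ _ B0).
  have sCA := smooth_mx_mul cz (sc _ _ C) sAz.
  have sxi : smooth_mx z (fun w => xi (f w) (a w)).
    apply: (smooth_mx_add cz slB); apply: (smooth_mx_mul cz).
      exact: (smooth_mx_sub cz (smooth_mx_mul cz sr sBz) (smooth_mx_mul cz slB sAz)).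
    exact: (smooth_mx_mul cz (smooth_mx_inv cz sCA d) (sc _ _ C)).
  have gz := smap_near_snbhs cz sf (og _ cp gf).
  apply: composable_pair.
  + exact: (vt_chi_smooth T0).
  + exact: (vt_chi_smooth T').
  + by move: sf.1 gz; apply: filterS2 => w cw gw; have [[_ +] _] := cCHI (f w) (a w) cw gw.
- move=> p q cp cq gp b; have [[p1 p2] pe] := cp; have [[q1 q2] qe] := cq.
  have [b1 b2] := b; have [w1 w2 w3 d] := gp.
  by rewrite /PSI /= (vt_add T0) // (vt_add T') // mulmxDl add_row_mx.
- move=> a p cp gp; have [[p1 p2] pe] := cp; have [w1 w2 w3 d] := gp.
  by rewrite /PSI /= (vt_scale T0) // (vt_scale T') // -scalemxAl scale_row_mx.
Qed.

End FibreProduct.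
End BundleMaps.

(** * The tangent groupoid *)

Section TargetSubmersion.
Variables (R : realType) (G M : smoothSpace R) (g : gpd G M).
Hypotheses (laws : is_groupoid g) (sI : smooth_map (ginv g)).

Lemma inv_inv a : carr a -> ginv g (ginv g a) = a.
Proof.
move=> ca; set b := ginv g a; set c := ginv g b.
have cb : carr b by exact: sI.1.
have cc : carr c by exact: sI.1.
have e1 : gsrc g c = gtgt g b by rewrite (src_inv laws).
have e2 : gsrc g b = gtgt g a by rewrite (src_inv laws).
have e3 : gtgt g b = gsrc g a by rewrite (tgt_inv laws).
rewrite -(mul_unitr laws cc) e1 e3 -(mul_invl laws ca) -(mul_assoc laws) //.
by rewrite (mul_invl laws cb) e2 (mul_unitl laws ca).
Qed.

(** The target is the source after the inversion, which is an involution. *)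
Lemma target_submersion : smooth_map (gsrc g) -> smooth_map (gtgt g) ->
  submersion (gsrc g) -> submersion (gtgt g).
Proof.
move=> sS sT sub x cx w cw wx.
have [v [cv vx sv]] := sub (ginv g x) (sI.1 _ cx) w cw (etrans wx (esym (src_inv laws cx))).
exists (tmap (ginv g) v); split.
- exact: (tmap_carr sI).
- by rewrite -(inv_inv cx) -vx.
- rewrite (tmap_comp sI sT cv) -sv.
  apply: tmap_ext => //; last by move=> z cz; exact: (tgt_inv laws).
  exact: smooth_map_comp sI sT.
Qed.
End TargetSubmersion.

Section LieGroupoid.
Variables (R : realType) (G M : smoothSpace R) (g : gpd G M).
Hypothesis H : is_lie_groupoid g.

Let laws := groupoid_laws H.

Lemma carr_src a : carr a -> carr (gsrc g a). Proof. exact: (src_smooth H).1. Qed.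
Lemma carr_tgt a : carr a -> carr (gtgt g a). Proof. exact: (tgt_smooth H).1. Qed.
Lemma carr_unit x : carr x -> carr (gunit g x). Proof. exact: (unit_smooth H).1. Qed.
Lemma carr_inv a : carr a -> carr (ginv g a). Proof. exact: (inv_smooth H).1. Qed.
Lemma carr_mul a b : carr a -> carr b -> gsrc g a = gtgt g b -> carr (gmul g a b).
Proof. by move=> ca cb e; exact: ((mul_smooth H).1 (a, b) (conj (conj ca cb) e)). Qed.

Local Notation ds := (tmap (gsrc g)).
Local Notation dt := (tmap (gtgt g)).
Local Notation du := (tmap (gunit g)).
Local Notation di := (tmap (ginv g)).
Local Notation dm := (tangent_mul g).
Local Notation vaddT := (@vadd _ _ (tangent G)).
Local Notation vscaleT := (@vscale _ _ (tangent G)).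
Local Notation composable_curves a b :=
  (\forall t \near (0 : R), gsrc g (a t) = gtgt g (b t)).

Lemma pair_germ (a b : R -> G) : germ_curve a -> germ_curve b ->
  composable_curves a b ->
  @germ_curve R (composable g) (fun t => (a t, b t)).
Proof.
move=> ga gb E; have nE := near_join E.
move: ga gb nE; rewrite /germ_curve; apply: filterS3 => t sa sb Et.
by apply: (@composable_pair R G M (real_line R)) => //; exact/snbhs_real.
Qed.

Lemma composable_fst_smooth : @smooth_map R (composable g) G fst.
Proof. by apply/smooth_mapP => p _; exact: composable_fst. Qed.

Lemma composable_snd_smooth : @smooth_map R (composable g) G snd.
Proof. by apply/smooth_mapP => p _; exact: composable_snd. Qed.

(** The coordinates of the two factors generate those of the space of composable
pairs. *)
Lemma composable_tangent_eq (w w' : tangent (composable g)) : carr w -> carr w' ->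
  tmap (@gpr1 R G M g) w = tmap (@gpr1 R G M g) w' ->
  tmap (@gpr2 R G M g) w = tmap (@gpr2 R G M g) w' -> w = w'.
Proof.
move=> cw cw' [e1 E1] [e2 E2]; apply: tangent_eq => //.
  by rewrite [LHS]surjective_pairing [RHS]surjective_pairing; congr pair.
move=> _ [[h ch <-]|[h ch <-]].
- have := congr1 (fun f => f h) E1; rewrite /= asboolT //; exact: coords_smooth_fun.
- have := congr1 (fun f => f h) E2; rewrite /= asboolT //; exact: coords_smooth_fun.
Qed.

Lemma tmap_val (X Y : smoothSpace R) (F : X -> Y) (w : tangent X) (v : tangent Y) h :
  tmap F w = v -> coords h -> w.2 (h \o F) = v.2 h.
Proof. by move=> <- ch; rewrite /= asboolT //; exact: coords_smooth_fun. Qed.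

(** The vector w in the definition of [tangent_mul]. *)
Definition tangent_pair (v v' : tangent G) : tangent (composable g) :=
  get [set w : tangent (composable g) |
    [/\ carr w, tmap (@gpr1 _ _ _ g) w = v & tmap (@gpr2 _ _ _ g) w = v']].

Lemma tangent_mul_pair v v' :
  dm v v' = tmap (@gmul2 R G M g) (tangent_pair v v').
Proof. by []. Qed.

Lemma tangent_pair_Vel (a b : R -> G) : germ_curve a -> germ_curve b ->
  composable_curves a b ->
  tangent_pair (Vel a) (Vel b) = @Vel R (composable g) (fun t => (a t, b t)).
Proof.
move=> ga gb E; have gab := pair_germ ga gb E; have cab := carr_Vel gab.
have E1 : tmap (@gpr1 R G M g) (@Vel R (composable g) (fun t => (a t, b t))) = Vel a.
  by rewrite tmap_Vel //; exact: composable_fst_smooth.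
have E2 : tmap (@gpr2 R G M g) (@Vel R (composable g) (fun t => (a t, b t))) = Vel b.
  by rewrite tmap_Vel //; exact: composable_snd_smooth.
have [] := @getI _ [set w : tangent (composable g) |
    [/\ carr w, tmap (@gpr1 _ _ _ g) w = Vel a & tmap (@gpr2 _ _ _ g) w = Vel b]] _
    (And3 cab E1 E2).
rewrite -/(tangent_pair (Vel a) (Vel b)) => c w1 w2.
by apply: composable_tangent_eq => //; rewrite ?w1 ?w2.
Qed.

(** The key to the tangent groupoid: along curves the product of velocities is the
velocity of the product. *)
Lemma tangent_mul_Vel (a b : R -> G) : germ_curve a -> germ_curve b ->
  composable_curves a b ->
  dm (Vel a) (Vel b) = Vel (fun t => gmul g (a t) (b t)).
Proof.
move=> ga gb E; rewrite tangent_mul_pair tangent_pair_Vel // tmap_Vel //.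
exact: (mul_smooth H).
Qed.

Lemma mul_germ (a b : R -> G) : germ_curve a -> germ_curve b ->
  composable_curves a b ->
  germ_curve (fun t => gmul g (a t) (b t)).
Proof.
move=> ga gb E.
exact: (@germ_comp_smooth R (composable g) G _ _ (pair_germ ga gb E) (mul_smooth H)).
Qed.

Lemma lift_source (b : R -> G) (v : tangent G) : germ_curve b -> carr v ->
  ds v = dt (Vel b) -> exists a : R -> G,
  [/\ germ_curve a, Vel a = v & composable_curves a b].
Proof.
move=> gb cv e; have [_ _ [n lG]] := arrows_manifold H.
have [_ _ [m lM]] := objects_manifold H.
apply: (curve_lift lG lM (src_smooth H) (src_submersion H)) => //.
  exact: (germ_comp_smooth gb (tgt_smooth H)).
by rewrite e tmap_Vel //; exact: (tgt_smooth H).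
Qed.

Lemma lift_target (b : R -> G) (v : tangent G) : germ_curve b -> carr v ->
  ds (Vel b) = dt v -> exists c : R -> G,
  [/\ germ_curve c, Vel c = v & composable_curves b c].
Proof.
move=> gb cv e; have [_ _ [n lG]] := arrows_manifold H.
have [_ _ [m lM]] := objects_manifold H.
have [|c [gc vc E]] := @curve_lift R G M n m _ lG lM (tgt_smooth H) (tgt_submersion H)
    (gsrc g \o b) v (germ_comp_smooth gb (src_smooth H)) cv.
  by rewrite -e tmap_Vel //; exact: (src_smooth H).
by exists c; split => //; move: E; apply: filterS => t ->.
Qed.

(** Represent v' by a curve b and lift t(b) through s. *)
Lemma tangent_composable v v' : carr v -> carr v' ->
  ds v = dt v' -> exists a b : R -> G,
  [/\ germ_curve a, germ_curve b, v = Vel a, v' = Vel b &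
    composable_curves a b].
Proof.
move=> cv /carr_tangentP[b [gb ->]] e.
by have [a [ga <- E]] := lift_source gb cv e; exists a, b.
Qed.

Lemma tangent_pairP v v' : carr v -> carr v' -> ds v = dt v' ->
  [/\ carr (tangent_pair v v'), tmap (@gpr1 R G M g) (tangent_pair v v') = v &
    tmap (@gpr2 R G M g) (tangent_pair v v') = v'].
Proof.
move=> cv cv' e; have [a [b [ga gb -> -> E]]] := tangent_composable cv cv' e.
rewrite tangent_pair_Vel //; split; first exact/carr_Vel/pair_germ.
- by rewrite tmap_Vel //; exact: composable_fst_smooth.
- by rewrite tmap_Vel //; exact: composable_snd_smooth.
Qed.

Lemma tangent_pair_base v v' : carr v -> carr v' -> ds v = dt v' ->
  (tangent_pair v v').1 = (v.1, v'.1).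
Proof.
move=> cv cv' e; have [_ e1 e2] := tangent_pairP cv cv' e.
have h1 : (tangent_pair v v').1.1 = v.1 := congr1 fst e1.
have h2 : (tangent_pair v v').1.2 = v'.1 := congr1 fst e2.
by rewrite -h1 -h2 -surjective_pairing.
Qed.

Lemma tangent_mul_carr v v' : carr v -> carr v' -> ds v = dt v' ->
  carr (dm v v').
Proof.
move=> cv cv' e; rewrite tangent_mul_pair; apply: (tmap_carr (mul_smooth H)).
by have [] := tangent_pairP cv cv' e.
Qed.

Lemma tangent_mul_base v v' : carr v -> carr v' -> ds v = dt v' ->
  (dm v v').1 = gmul g v.1 v'.1.
Proof. by move=> cv cv' e; rewrite tangent_mul_pair /= tangent_pair_base. Qed.

Lemma Vel_congr (X : smoothSpace R) (c c' : R -> X) : germ_curve c ->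
  (\forall t \near (0 : R), c t = c' t) -> Vel c = Vel c'.
Proof. by move=> gc E; have [_ ->] := Vel_near gc E. Qed.

Lemma near_carr (X : smoothSpace R) (c : R -> X) : germ_curve c ->
  \forall t \near (0 : R), carr (c t).
Proof. by move=> gc; apply: (germ_near gc); exact: snbhs_carr. Qed.

Lemma tangent_src_mul v v' : carr v -> carr v' -> ds v = dt v' ->
  ds (dm v v') = ds v'.
Proof.
move=> cv cv' e; have [a [b [ga gb -> -> E]]] := tangent_composable cv cv' e.
have ss := src_smooth H.
rewrite tangent_mul_Vel // !tmap_Vel //; apply: Vel_congr.
  by apply: germ_comp_smooth => //; exact: mul_germ.
by move: E (near_carr ga) (near_carr gb); apply: filterS3 => t; intros; exact: (src_mul laws).
Qed.

Lemma tangent_tgt_mul v v' : carr v -> carr v' -> ds v = dt v' ->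
  dt (dm v v') = dt v.
Proof.
move=> cv cv' e; have [a [b [ga gb -> -> E]]] := tangent_composable cv cv' e.
have ss := tgt_smooth H.
rewrite tangent_mul_Vel // !tmap_Vel //; apply: Vel_congr.
  by apply: germ_comp_smooth => //; exact: mul_germ.
by move: E (near_carr ga) (near_carr gb); apply: filterS3 => t; intros; exact: (tgt_mul laws).
Qed.

(** Represent v and v' by composable curves and lift once more to represent v''. *)
Lemma tangent_mul_assoc v v' v'' : carr v -> carr v' -> carr v'' ->
  ds v = dt v' -> ds v' = dt v'' ->
  dm (dm v v') v'' = dm v (dm v' v'').
Proof.
move=> cv cv' cv'' e e'; have [a [b [ga gb va vb E]]] := tangent_composable cv cv' e.
have [|c [gc <- E']] := lift_target gb cv''; first by rewrite -vb.
have cE : \forall t \near (0 : R), [/\ carr (a t), carr (b t) & carr (c t)].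
  by move: (near_carr ga) (near_carr gb) (near_carr gc); apply: filterS3.
have E1 : \forall t \near (0 : R), gsrc g (gmul g (a t) (b t)) = gtgt g (c t).
  by move: E E' cE; apply: filterS3 => t e1 e2 [c1 c2 c3]; rewrite (src_mul laws).
have E2 : \forall t \near (0 : R), gsrc g (a t) = gtgt g (gmul g (b t) (c t)).
  by move: E E' cE; apply: filterS3 => t e1 e2 [c1 c2 c3]; rewrite (tgt_mul laws).
rewrite va vb !tangent_mul_Vel //; try exact: mul_germ.
apply: Vel_congr; first by apply: mul_germ => //; exact: mul_germ.
by move: E E' cE; apply: filterS3 => t e1 e2 [c1 c2 c3]; exact: (mul_assoc laws).
Qed.

Lemma tangent_src_unit w : carr w -> ds (du w) = w.
Proof.
move=> cw; rewrite (tmap_comp (unit_smooth H) (src_smooth H)) // -[RHS]tmap_id //.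
apply: tmap_ext => //; [|exact: smooth_map_id|exact: (src_unit laws)].
exact: smooth_map_comp (unit_smooth H) (src_smooth H).
Qed.

Lemma tangent_tgt_unit w : carr w -> dt (du w) = w.
Proof.
move=> cw; rewrite (tmap_comp (unit_smooth H) (tgt_smooth H)) // -[RHS]tmap_id //.
apply: tmap_ext => //; [|exact: smooth_map_id|exact: (tgt_unit laws)].
exact: smooth_map_comp (unit_smooth H) (tgt_smooth H).
Qed.

Lemma tangent_src_inv v : carr v -> ds (di v) = dt v.
Proof.
move=> cv; rewrite (tmap_comp (inv_smooth H) (src_smooth H)) //.
apply: tmap_ext => //; [|exact: (tgt_smooth H)|exact: (src_inv laws)].
exact: smooth_map_comp (inv_smooth H) (src_smooth H).
Qed.

Lemma tangent_tgt_inv v : carr v -> dt (di v) = ds v.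
Proof.
move=> cv; rewrite (tmap_comp (inv_smooth H) (tgt_smooth H)) //.
apply: tmap_ext => //; [|exact: (src_smooth H)|exact: (tgt_inv laws)].
exact: smooth_map_comp (inv_smooth H) (tgt_smooth H).
Qed.

(** The remaining laws involve one arrow only, and differentiate equations between
smooth functions of it. *)
Lemma tangent_mul_map (F F' F'' : G -> G) v :
  smooth_map F -> smooth_map F' ->
  (forall a, carr a -> gsrc g (F a) = gtgt g (F' a)) ->
  (forall a, carr a -> gmul g (F a) (F' a) = F'' a) -> smooth_map F'' ->
  carr v -> dm (tmap F v) (tmap F' v) = tmap F'' v.
Proof.
move=> sF sF' e m sF'' /carr_tangentP[a [ga ->]].
have gF := germ_comp_smooth ga sF; have gF' := germ_comp_smooth ga sF'.
rewrite !tmap_Vel // tangent_mul_Vel //; last first.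
  by have := near_carr ga; apply: filterS => t; exact: e.
apply: Vel_congr; last by have := near_carr ga; apply: filterS => t; exact: m.
by apply: mul_germ => //; have := near_carr ga; apply: filterS => t; exact: e.
Qed.

Let sid := @smooth_map_id R G.
Let sus := smooth_map_comp (src_smooth H) (unit_smooth H).
Let sut := smooth_map_comp (tgt_smooth H) (unit_smooth H).

Lemma tangent_mul_unitr v : carr v -> dm v (du (ds v)) = v.
Proof.
move=> cv; rewrite (tmap_comp (src_smooth H) (unit_smooth H)) //.
rewrite -[X in dm X _](tmap_id cv) -[RHS](tmap_id cv).
apply: tangent_mul_map => // a ca; last exact: (mul_unitr laws).
by rewrite /= (tgt_unit laws) //; exact: carr_src.
Qed.

Lemma tangent_mul_unitl v : carr v -> dm (du (dt v)) v = v.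
Proof.
move=> cv; rewrite (tmap_comp (tgt_smooth H) (unit_smooth H)) //.
rewrite -[X in dm _ X](tmap_id cv) -[RHS](tmap_id cv).
apply: tangent_mul_map => // a ca; last exact: (mul_unitl laws).
by rewrite /= (src_unit laws) //; exact: carr_tgt.
Qed.

Lemma tangent_mul_invr v : carr v -> dm v (di v) = du (dt v).
Proof.
move=> cv; rewrite (tmap_comp (tgt_smooth H) (unit_smooth H)) //.
rewrite -[X in dm X _](tmap_id cv).
apply: tangent_mul_map (inv_smooth H) _ _ _ _ => // a ca; last exact: (mul_invr laws).
by rewrite (tgt_inv laws).
Qed.

Lemma tangent_mul_invl v : carr v -> dm (di v) v = du (ds v).
Proof.
move=> cv; rewrite (tmap_comp (src_smooth H) (unit_smooth H)) //.
rewrite -[X in dm _ X](tmap_id cv).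
apply: tangent_mul_map (inv_smooth H) _ _ _ _ _ => // a ca; last exact: (mul_invl laws).
by rewrite (src_inv laws).
Qed.

(** The coordinates of the tangent vector with components v and v' are those of v
and of v'. *)
Lemma tangent_mul_smooth (Z : smoothSpace R) (z : Z) (F F' : Z -> tangent G) : carr z ->
  @smap_near R Z (tangent G) z F -> @smap_near R Z (tangent G) z F' ->
  (\forall w \near snbhs z, ds (F w) = dt (F' w)) ->
  @smap_near R Z (tangent G) z (fun w => dm (F w) (F' w)).
Proof.
move=> cz sF sF' E.
have ok : \forall w \near snbhs z, [/\ carr (F w), carr (F' w) &
    ds (F w) = dt (F' w)].
  by move: sF.1 sF'.1 E; apply: filterS3.
have sP : @smap_near R Z (tangent (composable g)) z (fun w => tangent_pair (F w) (F' w)).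
  split; first by move: ok; apply: filterS => w [c1 c2 e]; have [] := tangent_pairP c1 c2 e.
  have base h : coords h -> smooth_near z (fun w => h (F w).1) /\
      smooth_near z (fun w => h (F' w).1).
    by move=> ch; split; [apply: (sF.2 (fun v => h v.1))|apply: (sF'.2 (fun v => h v.1))];
      left; exists h.
  have vert h : coords h -> smooth_near z (fun w => (F w).2 h) /\
      smooth_near z (fun w => (F' w).2 h).
    by move=> ch; split; [apply: (sF.2 (fun v => v.2 h))|apply: (sF'.2 (fun v => v.2 h))];
      right; exists h.
  move=> _ [[_ [[h ch <-]|[h ch <-]] <-]|[_ [[h ch <-]|[h ch <-]] <-]].
  - apply: smooth_near_ext (base h ch).1; move: ok; apply: filterS => w [c1 c2 e].
    by rewrite /= tangent_pair_base.
  - apply: smooth_near_ext (base h ch).2; move: ok; apply: filterS => w [c1 c2 e].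
    by rewrite /= tangent_pair_base.
  - apply: smooth_near_ext (vert h ch).1; move: ok; apply: filterS => w [c1 c2 e].
    have [_ e1 _] := tangent_pairP c1 c2 e.
    by rewrite -[F w in LHS]e1 /= asboolT //; exact: coords_smooth_fun.
  - apply: smooth_near_ext (vert h ch).2; move: ok; apply: filterS => w [c1 c2 e].
    have [_ _ e1] := tangent_pairP c1 c2 e.
    by rewrite -[F' w in LHS]e1 /= asboolT //; exact: coords_smooth_fun.
apply: (@smap_near_comp R Z (tangent (composable g)) (tangent G)
  (fun w => tangent_pair (F w) (F' w)) (tmap (@gmul2 R G M g))) => //.
apply: (smooth_map_near (tmap_smooth (mul_smooth H))).
exact: (snbhs_self cz sP.1).
Qed.

(** The product is the differential of m, which is linear, on a tangent vector whose
coordinates depend linearly on v and v'. *)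
Lemma tangent_mul_add (v w v' w' : tangent G) : carr v -> carr w -> carr v' -> carr w' ->
  v.1 = w.1 -> v'.1 = w'.1 ->
  carr (vaddT v w) -> carr (vaddT v' w') ->
  ds v = dt v' -> ds w = dt w' ->
  dm (vaddT v w) (vaddT v' w') =
  vaddT (dm v v') (dm w w').
Proof.
move=> cv cw cv' cw' b b' cs cs' e e'.
have es : ds (vaddT v w) =
    dt (vaddT v' w') by rewrite !tmap_add e e'.
rewrite !tangent_mul_pair -tmap_add; congr tmap.
have [c1 p1 q1] := tangent_pairP cv cv' e; have [c2 p2 q2] := tangent_pairP cw cw' e'.
have [c3 p3 q3] := tangent_pairP cs cs' es.
have b1 := tangent_pair_base cv cv' e; have b2 := tangent_pair_base cw cw' e'.
have b3 := tangent_pair_base cs cs' es; rewrite /= in b3.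
apply: tangent_vaddE => //; [by rewrite b3|by rewrite b3 b2 b b'|].
move=> _ [[h ch <-]|[h ch <-]].
- exact: (etrans (tmap_val p3 ch) (esym (f_equal2 +%R (tmap_val p1 ch) (tmap_val p2 ch)))).
- exact: (etrans (tmap_val q3 ch) (esym (f_equal2 +%R (tmap_val q1 ch) (tmap_val q2 ch)))).
Qed.

Lemma tangent_mul_scale x (v v' : tangent G) : carr v -> carr v' ->
  carr (vscaleT x v) -> carr (vscaleT x v') ->
  ds v = dt v' ->
  dm (vscaleT x v) (vscaleT x v') =
  vscaleT x (dm v v').
Proof.
move=> cv cv' cs cs' e.
have es : ds (vscaleT x v) =
    dt (vscaleT x v') by rewrite !tmap_scale e.
rewrite !tangent_mul_pair -tmap_scale; congr tmap.
have [c1 p1 q1] := tangent_pairP cv cv' e.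
have [c3 p3 q3] := tangent_pairP cs cs' es.
have b1 := tangent_pair_base cv cv' e.
have b3 := tangent_pair_base cs cs' es; rewrite /= in b3.
apply: tangent_vscaleE => //; first by rewrite b3.
move=> _ [[h ch <-]|[h ch <-]].
- exact: (etrans (tmap_val p3 ch) (esym (congr1 ( *%R x) (tmap_val p1 ch)))).
- exact: (etrans (tmap_val q3 ch) (esym (congr1 ( *%R x) (tmap_val q1 ch)))).
Qed.

End LieGroupoid.

(** * Line bundle groupoids and multiplicative forms *)

Definition in_fibre (R : realType) (X : smoothSpace R) (E : vbundle X) (x : X) (e : E) :=
  carr e /\ bproj e = x.

Section FibreAlgebra.
Variables (R : realType) (X : smoothSpace R) (k : nat) (E : vbundle X).
Hypothesis vE : is_vbundle k E.
Implicit Types (e f h l : E) (x : X).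

Lemma in_fibre_base x e : in_fibre x e -> carr x.
Proof. by move=> [ce <-]; exact: (bproj_carr vE). Qed.

Lemma in_fibre_add x e f : in_fibre x e -> in_fibre x f -> in_fibre x (vadd e f).
Proof.
move=> [ce be] [cf bf]; have b : bproj e = bproj f by rewrite be bf.
by split; [exact: (vadd_carr vE)|rewrite (vadd_bproj vE)].
Qed.

Lemma in_fibre_scale x a e : in_fibre x e -> in_fibre x (vscale a e).
Proof. by move=> [ce be]; split; [exact: (vscale_carr vE)|rewrite (vscale_bproj vE)]. Qed.

(** Identities in a fibre are transported from 'rV_k, where they are identities of
modules. *)
Lemma fibre_coordinates x : carr x -> exists psi : E -> 'rV[R]_k,
  [/\ forall e f, in_fibre x e -> in_fibre x f -> psi e = psi f -> e = f,
      forall e f, in_fibre x e -> in_fibre x f -> psi (vadd e f) = psi e + psi f,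
      forall a e, in_fibre x e -> psi (vscale a e) = a *: psi e &
      forall a, exists2 e, in_fibre x e & psi e = a].
Proof.
move=> cx; have [W [psi [chi [T Wx]]]] := vtriv_at vE cx; exists psi; split.
- by move=> e f [ce be] [cf bf]; apply: (vt_inj T); rewrite ?be ?bf.
- by move=> e f [ce be] [cf bf]; apply: (vt_add T); rewrite ?be ?bf.
- by move=> a e [ce be]; apply: (vt_scale T); rewrite ?be.
- by move=> a; exists (chi x a); [exact: (vt_chi T)|exact: (vt_chiK T)].
Qed.

Local Ltac fibre := by auto using in_fibre_add, in_fibre_scale.
Lemma fibre_addC x e f : in_fibre x e -> in_fibre x f -> vadd e f = vadd f e.
Proof.
move=> fe ff; have [psi [inj add sc _]] := fibre_coordinates (in_fibre_base fe).
by apply: inj; try fibre; rewrite !(add, sc); try fibre; rewrite addrC.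
Qed.

Lemma fibre_addA x e f h : in_fibre x e -> in_fibre x f -> in_fibre x h ->
  vadd e (vadd f h) = vadd (vadd e f) h.
Proof.
move=> fe ff fh; have [psi [inj add sc _]] := fibre_coordinates (in_fibre_base fe).
by apply: inj; try fibre; rewrite !(add, sc); try fibre; rewrite addrA.
Qed.

Lemma fibre_addACA x e f h l : in_fibre x e -> in_fibre x f -> in_fibre x h ->
  in_fibre x l -> vadd (vadd e f) (vadd h l) = vadd (vadd e h) (vadd f l).
Proof.
move=> fe ff fh fl; have [psi [inj add sc _]] := fibre_coordinates (in_fibre_base fe).
by apply: inj; try fibre; rewrite !(add, sc); try fibre; rewrite addrACA.
Qed.

Lemma fibre_scaleDr x a e f : in_fibre x e -> in_fibre x f ->
  vadd (vscale a e) (vscale a f) = vscale a (vadd e f).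
Proof.
move=> fe ff; have [psi [inj add sc _]] := fibre_coordinates (in_fibre_base fe).
by apply: inj; try fibre; rewrite !(add, sc); try fibre; rewrite scalerDr.
Qed.

Lemma fibre_add0 x e f : in_fibre x e -> in_fibre x f -> vadd e (vscale 0 f) = e.
Proof.
move=> fe ff; have [psi [inj add sc _]] := fibre_coordinates (in_fibre_base fe).
by apply: inj; try fibre; rewrite !(add, sc); try fibre; rewrite scale0r addr0.
Qed.

Lemma fibre_zero_eq x e f : in_fibre x e -> in_fibre x f -> vscale 0 e = vscale 0 f.
Proof.
move=> fe ff; have [psi [inj add sc _]] := fibre_coordinates (in_fibre_base fe).
by apply: inj; try fibre; rewrite !(add, sc); try fibre; rewrite !scale0r.
Qed.

Lemma fibre_add_idem x e f : in_fibre x e -> in_fibre x f -> f = vadd e f ->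
  e = vscale 0 f.
Proof.
move=> fe ff E1; have [psi [inj add sc _]] := fibre_coordinates (in_fibre_base fe).
apply: inj; try fibre; rewrite sc // scale0r.
by apply: (addIr (psi f)); rewrite add0r -add // -E1.
Qed.

Lemma fibre_add_cancel x e a b : in_fibre x e -> in_fibre x a -> in_fibre x b ->
  vscale 0 e = vadd a b -> vadd (vadd e b) a = e.
Proof.
by move=> fe fa fb z; rewrite -(fibre_addA fe fb fa) (fibre_addC fb fa) -z (fibre_add0 fe fe).
Qed.
End FibreAlgebra.

Section LineBundles.
Variables (R : realType) (X Y : smoothSpace R) (E : vbundle X) (E' : vbundle Y).
Hypotheses (vE : is_vbundle 1 E) (vE' : is_vbundle 1 E').
Variables (F : E -> E') (f : X -> Y).
Hypothesis mF : vb_morphism F f.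

(** An injective linear map between lines is onto: the image of the basis vector e
has a nonzero coordinate, by which one divides. *)
Lemma line_onto x : carr x ->
  (forall e e', in_fibre x e -> in_fibre x e' -> F e = F e' -> e = e') ->
  forall w, in_fibre (f x) w -> exists e, [/\ carr e, bproj e = x & F e = w].
Proof.
move=> cx injF w fw; have [sF sf Fb Fa Fs] := mF.
have [psi [inj add sc onto]] := fibre_coordinates vE cx.
have [psi' [inj' add' sc' onto']] := fibre_coordinates vE' (sf.1 _ cx).
have [e fe pe] := onto 1; have [ce be] := fe.
have fFe : in_fibre (f x) (F e) by split; [exact: sF.1|rewrite Fb // be].
have fsFe a := in_fibre_scale vE' a fFe; have fse a := in_fibre_scale vE a fe.
have nz : psi' (F e) 0 0 != 0.
  apply/eqP => z; have : psi e = psi (vscale 0 e).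
    congr psi; apply: injF => //; rewrite Fs //; apply: inj' => //.
    by rewrite sc' // scale0r; apply/rowP => i; rewrite ord1 z mxE.
  rewrite sc // scale0r pe => /rowP/(_ 0); rewrite !mxE /= => /eqP.
  by rewrite oner_eq0.
pose a := psi' w 0 0 / psi' (F e) 0 0.
exists (vscale a e); have [c b] := fse a; split => //.
rewrite Fs //; apply: inj' => //.
by rewrite sc' //; apply/rowP => i; rewrite ord1 mxE /a divfK.
Qed.
End LineBundles.

Section FibreInverse.
Variables (R : realType) (X Y : smoothSpace R) (k : nat) (E : vbundle X) (E' : vbundle Y).
Hypotheses (vE : is_vbundle k E) (vE' : is_vbundle k E').
Variables (F : E -> E') (f : X -> Y).
Hypothesis mF : vb_morphism F f.
Hypothesis injF : forall e e', carr e -> carr e' -> bproj e = bproj e' -> F e = F e' -> e = e'.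
Hypothesis ontoF : fibrewise_onto F f.

Lemma fibre_invP x w : carr x -> carr w -> bproj w = f x ->
  [/\ carr (fibre_inv F x w), bproj (fibre_inv F x w) = x & F (fibre_inv F x w) = w].
Proof.
move=> cx cw b; have [e He] := ontoF cx cw b.
exact: (@getI _ [set e : E | [/\ carr e, bproj e = x & F e = w]] e He).
Qed.

Lemma fibre_invE e : carr e -> fibre_inv F (bproj e) (F e) = e.
Proof.
move=> ce; have [sF sf Fb Fa Fs] := mF.
have [c b EF] := fibre_invP (bproj_carr vE ce) (sF.1 _ ce) (Fb _ ce).
by apply: injF.
Qed.

(** In trivializations the inverse is the product with the inverse of the matrix of
F, which is a square matrix because both bundles have rank k. *)
Lemma fibre_inv_smooth (Z : smoothSpace R) (z : Z) (x : Z -> X) (w : Z -> E') : carr z ->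
  smap_near z x -> smap_near z w -> (\forall u \near snbhs z, bproj (w u) = f (x u)) ->
  smap_near z (fun u => fibre_inv F (x u) (w u)).
Proof.
move=> cz sx sw E0; have [sF sf Fb Fa Fs] := mF.
have cx := snbhs_self cz sx.1; have cw := snbhs_self cz sw.1.
have Ez := snbhs_self cz E0.
have [W [psi [chi [T Wx]]]] := vtriv_at vE cx.
have [W' [psi' [chi' [T' Wx']]]] := vtriv_at vE' (sf.1 _ cx).
pose A := local_mx F chi psi'.
have sA h : carr h -> W h -> W' (f h) -> smooth_mx h A by exact: (local_mx_smooth mF T T').
have unitA h : carr h -> W h -> W' (f h) -> \det (A h) != 0.
  move=> ch Wh Wh'; have [C CA] := local_mx_onto vE mF T T' ontoF ch Wh Wh'.
  by have := congr1 determinant CA; rewrite det_mulmx det1 => d; apply: contra_eq_neq d => ->;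
    rewrite mulr0 eq_sym oner_neq0.
have S : smap_near z (fun u => chi (x u) (psi' (w u) *m invmx (A (x u)))).
  have bw : W' (bproj (w z)) by rewrite Ez.
  apply: (vt_chi_smooth T) => //.
  apply: (smooth_mx_mul cz (smooth_mx_comp cz sw (vt_psi_smooth T' cw bw))).
  apply: (smooth_mx_inv cz); first by apply: (smooth_mx_comp cz sx); exact: sA.
  exact: unitA.
apply: smap_near_ext S.
have Wn : \forall u \near snbhs z, W (x u) /\ W' (f (x u)).
  apply: (@smap_near_snbhs R Z X x z (fun h => W h /\ W' (f h))) => //.
  apply: filterI; first exact: (vt_open T).
  by apply: (smap_near_snbhs cx (smooth_map_near sf cx)); apply: (vt_open T') => //; exact: sf.1.
have cn : \forall u \near snbhs z, carr (x u) /\ carr (w u) by move: sx.1 sw.1; apply: filterS2.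
move: Wn cn E0; apply: filterS3 => u [Wu Wu'] [cxu cwu] eu.
have [c b EF] := fibre_invP cxu cwu eu.
apply: (vt_inj T) => //.
- by have [] := vt_chi T (psi' (w u) *m invmx (A (x u))) cxu Wu.
- by have [_ ->] := vt_chi T (psi' (w u) *m invmx (A (x u))) cxu Wu.
- by have [_ ->] := vt_chi T (psi' (w u) *m invmx (A (x u))) cxu Wu; rewrite b.
have E1 : psi' (w u) = psi (fibre_inv F (x u) (w u)) *m A (x u).
  by rewrite -{1}EF (local_mx_psi vE mF T T') ?b.
rewrite (vt_chiK T) // E1 -mulmxA mulmxV ?mulmx1 // unitmxE unitfE.
exact: unitA.
Qed.

End FibreInverse.

Section LineGroupoid.
Variables (R : realType) (G M : smoothSpace R) (g : gpd G M).
Variables (L : vbundle G) (LM : vbundle M) (gL : gpd L LM).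
Hypothesis hL : is_lbg g gL.

Let vbg : is_vbg g gL. Proof. by have [] := hL. Qed.
Let vL : is_vbundle 1 L. Proof. by have [] := hL. Qed.
Let vLM : is_vbundle 1 LM. Proof. by have [] := hL. Qed.
Let HG : is_lie_groupoid g := vbg_base vbg.
Let HL : is_lie_groupoid gL := vbg_total vbg.
Let lG := groupoid_laws HG.
Let lL := groupoid_laws HL.
Let mS := vbg_src vbg.
Let mT := vbg_tgt vbg.
Let mU := vbg_unit vbg.
Let mI := vbg_inv vbg.
Let mM := vbg_mul vbg.

Lemma line_src_bproj l : carr l -> bproj (gsrc gL l) = gsrc g (bproj l).
Proof. by have [_ _ + _ _] := mS; exact. Qed.
Lemma line_tgt_bproj l : carr l -> bproj (gtgt gL l) = gtgt g (bproj l).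
Proof. by have [_ _ + _ _] := mT; exact. Qed.
Lemma line_inv_bproj l : carr l -> bproj (ginv gL l) = ginv g (bproj l).
Proof. by have [_ _ + _ _] := mI; exact. Qed.
Lemma line_mul_bproj l l' : carr l -> carr l' -> gsrc gL l = gtgt gL l' ->
  bproj (gmul gL l l') = gmul g (bproj l) (bproj l').
Proof.
by move=> c c' e; have [_ _ Hb _ _] := mM; exact: (Hb (l, l') (conj (conj c c') e)).
Qed.

(** The unit map is injective on fibres, being a section of the source, hence onto
by [line_onto]: every element of L over a unit is a unit. *)
Lemma line_unit_fibre x l : carr x -> carr l -> bproj l = gunit g x ->
  l = gunit gL (gsrc gL l).
Proof.
move=> cx cl bl.
have [|e [ce be <-]] := line_onto vLM vL mU cx _ (conj cl bl); last by rewrite (src_unit lL).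
by move=> e e' [ce _] [ce' _] E; rewrite -(src_unit lL ce) E (src_unit lL).
Qed.

(** l' l^-1 lies over a unit, hence is a unit, and l' = (l' l^-1) l. *)
Lemma line_src_inj l l' : carr l -> carr l' -> bproj l = bproj l' ->
  gsrc gL l = gsrc gL l' -> l = l'.
Proof.
move=> cl cl' b e; have ci := carr_inv HL cl.
have e1 : gsrc gL l' = gtgt gL (ginv gL l) by rewrite (tgt_inv lL).
have c1 := carr_mul HL cl' ci e1.
have ct := carr_tgt HG (bproj_carr vL cl).
have b1 : bproj (gmul gL l' (ginv gL l)) = gunit g (gtgt g (bproj l)).
  rewrite line_mul_bproj // line_inv_bproj // -b (mul_invr lG) //.
  exact: (bproj_carr vL).
have u1 := line_unit_fibre ct c1 b1.
have e2 : gsrc gL (ginv gL l) = gtgt gL l by rewrite (src_inv lL).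
rewrite -(mul_unitr lL cl') -e -(mul_invl lL cl) -(mul_assoc lL) // u1.
by rewrite (src_mul lL) // e2 (mul_unitl lL).
Qed.

(** The source is injective on fibres, which are lines. *)
Lemma line_src_onto : fibrewise_onto (gsrc gL) (gsrc g).
Proof.
move=> h w ch cw b; apply: (line_onto vL vLM mS ch) => // e e' [ce be] [ce' be'].
by apply: line_src_inj => //; rewrite be.
Qed.

Lemma line_tgt_onto : fibrewise_onto (gtgt gL) (gtgt g).
Proof.
move=> h w ch cw b; have ci := carr_inv HG ch.
have [|l [cl bl sl]] := line_src_onto ci cw; first by rewrite (src_inv lG).
exists (ginv gL l); split; first exact: (carr_inv HL).
- by rewrite line_inv_bproj // bl (inv_inv lG (inv_smooth HG)).
- by rewrite (tgt_inv lL).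
Qed.

Variable theta : tangent G -> L.
Hypothesis mult : multiplicative1 g gL theta.

Let mTh : vb_morphism theta id. Proof. by have [] := mult. Qed.

Lemma form_carr v : carr v -> carr (theta v).
Proof. by have [[H _] _ _ _ _] := mTh; exact: H. Qed.
Lemma form_bproj v : carr v -> bproj (theta v) = v.1.
Proof. by have [_ _ + _ _] := mTh; exact. Qed.

(** Multiplicativity evaluated on the tangent vector of the space of composable
pairs with components v and v', read through source and target: theta(v v') is
the product of theta v + l1 and l2 + theta v'. *)
Lemma form_mul v v' : carr v -> carr v' -> tmap (gsrc g) v = tmap (gtgt g) v' ->
  exists l1 l2 : L,
  [/\ [/\ carr l1, carr l2, bproj l1 = v.1 & bproj l2 = v'.1],
      gsrc gL l1 = gtgt gL (theta v'), gsrc gL (theta v) = gtgt gL l2,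
      gsrc gL (theta (tangent_mul g v v')) = vadd (gsrc gL l2) (gsrc gL (theta v')) &
      gtgt gL (theta (tangent_mul g v v')) = vadd (gtgt gL (theta v)) (gtgt gL l1)].
Proof.
move=> cv cv' e.
have [cw w1 w2] := tangent_pairP HG cv cv' e; have wb := tangent_pair_base HG cv cv' e.
have [_ /(_ _ cw)] := mult.
rewrite /pullback1 w1 w2 -tangent_mul_pair /= wb.
have cg : carr v.1 by exact: carr_base.
have cg' : carr v'.1 by exact: carr_base.
have egg : gsrc g v.1 = gtgt g v'.1 by have [] := e.
have cth := form_carr cv; have cth' := form_carr cv'.
have cm := tangent_mul_carr HG cv cv' e; have cthm := form_carr cm.
have bm : bproj (theta (tangent_mul g v v')) = gmul g v.1 v'.1.
  by rewrite form_bproj // tangent_mul_base.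
(* Elements on which m, pr_1 and pr_2 take the prescribed values, so that the
   three fibre inverses in the pullbacks are defined. *)
have [l2 [cl2 bl2 tl2]] : exists l, [/\ carr l, bproj l = v'.1 & gtgt gL l = gsrc gL (theta v)].
  apply: line_tgt_onto => //; first exact: (carr_src HL).
  by rewrite line_src_bproj // form_bproj.
have [l1 [cl1 bl1 sl1]] : exists l, [/\ carr l, bproj l = v.1 & gsrc gL l = gtgt gL (theta v')].
  apply: line_src_onto => //; first exact: (carr_tgt HL).
  by rewrite line_tgt_bproj // form_bproj.
have [q2 [cq2 bq2 sq2]] : exists l, [/\ carr l, bproj l = v'.1 &
    gsrc gL l = gsrc gL (theta (tangent_mul g v v'))].
  apply: line_src_onto => //; first exact: (carr_src HL).
  by rewrite line_src_bproj // bm (src_mul lG).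
have [q1 [cq1 bq1 sq1]] : exists l, [/\ carr l, bproj l = v.1 & gsrc gL l = gtgt gL q2].
  apply: line_src_onto => //; first exact: (carr_tgt HL).
  by rewrite line_tgt_bproj // bq2.
have mq : gmul gL q1 q2 = theta (tangent_mul g v v').
  apply: line_src_inj => //; first exact: (carr_mul HL).
    by rewrite line_mul_bproj // bm bq1 bq2.
  by rewrite (src_mul lL).
set pm := fibre_inv _ _ _; set p1 := fibre_inv _ _ _; set p2 := fibre_inv _ _ _ => E.
have Hm : [/\ @carr R (composable gL) pm, (bproj pm.1, bproj pm.2) = (v.1, v'.1) &
    gmul gL pm.1 pm.2 = theta (tangent_mul g v v')].
  apply: (@getI _ [set q : composable_vb g gL | [/\ carr q, bproj q = (v.1, v'.1) &
    gmul2 q = theta (tangent_mul g v v')]] (q1, q2)).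
  by split => //=; rewrite bq1 bq2.
have H1 : [/\ @carr R (composable gL) p1, (bproj p1.1, bproj p1.2) = (v.1, v'.1) &
    p1.1 = theta v].
  apply: (@getI _ [set q : composable_vb g gL | [/\ carr q, bproj q = (v.1, v'.1) &
    gpr1 q = theta v]] (theta v, l2)).
  by split => //=; rewrite form_bproj // bl2.
have H2 : [/\ @carr R (composable gL) p2, (bproj p2.1, bproj p2.2) = (v.1, v'.1) &
    p2.2 = theta v'].
  apply: (@getI _ [set q : composable_vb g gL | [/\ carr q, bproj q = (v.1, v'.1) &
    gpr2 q = theta v']] (l1, theta v')).
  by split => //=; rewrite form_bproj // bl1.
clearbody pm p1 p2; clear l1 cl1 bl1 sl1 l2 cl2 bl2 tl2.
have [[[c11 c12] e1] [b11 b12] t1] := H1; have [[[c21 c22] e2] [b21 b22] t2] := H2.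
have [[[cm1 cm2] em] _ tm] := Hm; rewrite /= in e1 e2 em.
exists p2.1, p1.2; split => //.
- by rewrite e2 t2.
- by rewrite -e1 t1.
- rewrite -tm (src_mul lL) // E /=; have [_ _ _ Sa _] := mS.
  by rewrite Sa // ?b12 ?b22 // t2.
- rewrite -tm (tgt_mul lL) // E /=; have [_ _ _ Ta _] := mT.
  by rewrite Ta // ?b11 ?b21 // t1.
Qed.

(** For v = u(w) the product of v with itself is v and l2 is a unit with the source
of theta v, so that s(theta v) = s(theta v) + s(theta v). *)
Lemma form_unit w : carr w ->
  theta (tmap (gunit g) w) = vscale 0 (theta (tmap (gunit g) w)).
Proof.
move=> cw; set v := tmap (gunit g) w.
have cv : carr v by exact: (tmap_carr (unit_smooth HG)).
have e : tmap (gsrc g) v = tmap (gtgt g) v.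
  by rewrite (tangent_src_unit HG) // (tangent_tgt_unit HG).
have vv : tangent_mul g v v = v.
  by have := tangent_mul_unitr HG cv; rewrite (tangent_src_unit HG).
have [l1 [l2 [[cl1 cl2 bl1 bl2] _ tl2]]] := form_mul cv cv e; rewrite vv => sE _.
have cth := form_carr cv; have bth := form_bproj cv.
have cx := carr_base cw; have [sS _ Sb _ Ss] := mS.
have ul2 := line_unit_fibre cx cl2 bl2.
have s2 : gsrc gL l2 = gsrc gL (theta v).
  by rewrite tl2 [in RHS]ul2 (tgt_unit lL) //; exact: (carr_src HL).
have cs := carr_src HL cth.
apply: line_src_inj => //; [exact: (vscale_carr vL)|by rewrite (vscale_bproj vL)|].
by rewrite Ss //; apply: (fibre_add_idem vLM (conj cs erefl) (conj cs erefl)); rewrite {1}sE s2.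
Qed.

(** Apply [form_mul] to v^-1 and v, whose product is a unit; the element l1 is then
the inverse of theta v. *)
Lemma form_inv v : carr v ->
  vadd (gtgt gL (theta (tmap (ginv g) v))) (gsrc gL (theta v)) =
  vscale 0 (gsrc gL (theta v)).
Proof.
move=> cv; have ci := tmap_carr (inv_smooth HG) cv.
have e : tmap (gsrc g) (tmap (ginv g) v) = tmap (gtgt g) v by rewrite (tangent_src_inv HG).
have [l1 [l2 [[cl1 cl2 bl1 bl2] sl1 _ _ tE]]] := form_mul ci cv e.
have cth := form_carr cv; have bth := form_bproj cv.
have l1E : l1 = ginv gL (theta v).
  apply: line_src_inj => //; first exact: (carr_inv HL).
    by rewrite line_inv_bproj // bth bl1.
  by rewrite (src_inv lL).
have <- : gtgt gL l1 = gsrc gL (theta v) by rewrite l1E (tgt_inv lL).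
rewrite -tE (tangent_mul_invl HG) // form_unit; last exact: (tmap_carr (src_smooth HG)).
have cu : carr (tmap (gunit g) (tmap (gsrc g) v)).
  by apply: (tmap_carr (unit_smooth HG)); exact: (tmap_carr (src_smooth HG)).
have [sT _ Tb _ Ts] := mT; have cthu := form_carr cu.
have cg := carr_base cv; have csg := carr_src HG cg.
rewrite Ts //; apply: (fibre_zero_eq vLM (x := gsrc g v.1)).
  split; [exact: (carr_tgt HL)|by rewrite line_tgt_bproj // form_bproj //= (tgt_unit lG)].
by split; [exact: (carr_tgt HL)|rewrite line_tgt_bproj // bl1 /= (tgt_inv lG)].
Qed.

End LineGroupoid.

(** * The Morita kernel *)

Section Morphisms.
Variable R : realType.
Implicit Types X Y Z : smoothSpace R.

Lemma vb_morphism_comp X Y Z (E : vbundle X) (E' : vbundle Y) (E'' : vbundle Z)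
    (F : E -> E') (F' : E' -> E'') (f : X -> Y) (f' : Y -> Z) :
  vb_morphism F f -> vb_morphism F' f' -> vb_morphism (F' \o F) (f' \o f).
Proof.
move=> [sF sf Fb Fa Fs] [sF' sf' Fb' Fa' Fs']; split.
- exact: smooth_map_comp sF sF'.
- exact: smooth_map_comp sf sf'.
- by move=> e ce; rewrite /= Fb' ?Fb //; exact: sF.1.
- move=> e e' ce ce' b; rewrite /= Fa // Fa' ?Fb ?b //; exact: sF.1.
- by move=> a e ce; rewrite /= Fs // Fs' //; exact: sF.1.
Qed.

Lemma vb_morphism_ext k X Y (E : vbundle X) (E' : vbundle Y) (F F' : E -> E') (f : X -> Y) :
  is_vbundle k E -> (forall e, carr e -> F e = F' e) ->
  vb_morphism F f -> vb_morphism F' f.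
Proof.
move=> vE FF' [sF sf Fb Fa Fs]; split => //.
- exact: smooth_map_ext sF.
- by move=> e ce; rewrite -FF' // Fb.
- move=> e e' ce ce' b; rewrite -!FF' ?Fa //; exact: (vadd_carr vE).
- move=> a e ce; rewrite -!FF' ?Fs //; exact: (vscale_carr vE).
Qed.

Lemma whitney_snd_morphism k X (E E' : vbundle X) : is_vbundle k E' ->
  @vb_morphism R X X (whitney_sum E E') E' snd id.
Proof.
move=> vE'; split => //.
- by apply/smooth_mapP => p _; exact: whitney_snd.
- exact: smooth_map_id.
- by move=> p [].
Qed.

(** The source, target, unit and inversion of the Morita kernel are of this form. *)
Lemma pair_morphism X Y (E : vbundle X) (E' : vbundle Y)
    (f : X -> Y) (h : whitney_sum (tangent X) E -> E') : vb_morphism h f ->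
  @vb_morphism R X Y (whitney_sum (tangent X) E) (whitney_sum (tangent Y) E')
    (fun p => (tmap f p.1, h p)) f.
Proof.
move=> [sh sf hb ha hs]; split => //.
- apply/smooth_mapP => p cp; have [[c1 c2] e] := cp; apply: whitney_pair.
  + apply: (@smap_near_comp R (whitney_sum (tangent X) E) (tangent X) (tangent Y) fst
      (tmap f)) => //.
      exact: whitney_fst.
    exact: (smooth_map_near (tmap_smooth sf)).
  + exact: (smooth_map_near sh).
  + by have := snbhs_carr p; apply: filterS => q cq; rewrite hb.
- by move=> p q cp cq b; rewrite ha //; congr pair; exact: tmap_add.
- by move=> a p cp; rewrite hs //; congr pair; exact: tmap_scale.
Qed.
End Morphisms.

Section MoritaKernelVBG.
Variables (R : realType) (G M : smoothSpace R) (g : gpd G M).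
Variables (L : vbundle G) (LM : vbundle M) (gL : gpd L LM) (theta : tangent G -> L).
Hypotheses (hL : is_lbg g gL) (mult : multiplicative1 g gL theta).

Variables n m : nat.
Hypotheses (dimG : locally_euclidean n G) (dimM : locally_euclidean m M).

Let vbg : is_vbg g gL. Proof. by have [] := hL. Qed.
Let vL : is_vbundle 1 L. Proof. by have [] := hL. Qed.
Let vLM : is_vbundle 1 LM. Proof. by have [] := hL. Qed.
Let HG : is_lie_groupoid g := vbg_base vbg.
Let HL : is_lie_groupoid gL := vbg_total vbg.
Let lG := groupoid_laws HG.
Let lL := groupoid_laws HL.
Let mS := vbg_src vbg.
Let mT := vbg_tgt vbg.
Let mU := vbg_unit vbg.
Let mI := vbg_inv vbg.
Let mTh : vb_morphism theta id. Proof. by have [] := mult. Qed.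

Local Notation V := (whitney_sum (tangent G) L).
Local Notation VM := (whitney_sum (tangent M) LM).
Local Notation mk := (morita_kernel g gL theta).
Local Notation sinv := (fibre_inv (gsrc gL)).

Let vV : is_vbundle (n + 1) V := whitney_vbundle (tangent_vbundle dimG) vL.
Let vVM : is_vbundle (m + 1) VM := whitney_vbundle (tangent_vbundle dimM) vLM.

(** The line component that the target and the inversion use in place of l. *)
Definition twist (p : V) : L := vadd p.2 (theta p.1).

Lemma mk_srcE p : gsrc mk p = (tmap (gsrc g) p.1, gsrc gL p.2). Proof. by case: p. Qed.
Lemma mk_tgtE p : gtgt mk p = (tmap (gtgt g) p.1, gtgt gL (twist p)). Proof. by case: p. Qed.
Lemma mk_unitE p : gunit mk p = (tmap (gunit g) p.1, gunit gL p.2). Proof. by case: p. Qed.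
Lemma mk_mulE p q : gmul mk p q =
  (tangent_mul g p.1 q.1, sinv (gmul g p.1.1 q.1.1) (gsrc gL q.2)).
Proof. by case: p; case: q. Qed.

Section Element.
Variable p : V.
Hypothesis cp : carr p.
Lemma el_vect : carr p.1. Proof. by have [[]] := cp. Qed.
Lemma el_line : carr p.2. Proof. by have [[]] := cp. Qed.
Lemma el_base : p.1.1 = bproj p.2. Proof. by have [_] := cp. Qed.
Lemma el_arrow : carr p.1.1. Proof. exact/carr_base/el_vect. Qed.
Let bp : bproj p.2 = bproj (theta p.1).
Proof. by rewrite (form_bproj mult) ?el_base //; exact: el_vect. Qed.
Lemma twist_carr : carr (twist p).
Proof. by apply: (vadd_carr vL) bp; [exact: el_line|exact/(form_carr mult)/el_vect]. Qed.
Lemma twist_bproj : bproj (twist p) = p.1.1.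
Proof.
rewrite (vadd_bproj vL) ?bp ?el_base //; [exact: el_line|exact/(form_carr mult)/el_vect].
Qed.
End Element.

Lemma twist_morphism : vb_morphism twist id.
Proof.
have [sth _ thb tha ths] := mTh; split; [|exact: smooth_map_id|exact: twist_bproj|..].
- apply/smooth_mapP => p cp; apply: (vadd_smooth_near vL) => //.
  + exact: whitney_snd.
  + apply: (@smap_near_comp R V (tangent G) L fst theta) => //; first exact: whitney_fst.
    exact: (smooth_map_near sth (el_vect cp)).
  + by have := snbhs_carr p; apply: filterS => q [[c1 c2] e]; rewrite thb.
- move=> p q cp cq b; have [c1 c2] := (el_vect cp, el_vect cq).
  have [bp bq] := (el_base cp, el_base cq); rewrite /twist /= tha //.
  apply: (fibre_addACA vL (x := p.1.1)); split; rewrite ?thb -?bp -?bq //.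
  + exact: el_line.
  + exact: el_line.
  + exact: sth.1.
  + exact: sth.1.
- move=> a p cp; have c := el_vect cp; rewrite /twist /= ths //.
  apply: (fibre_scaleDr vL (x := p.1.1)); split; rewrite ?thb -?el_base //.
  + exact: el_line.
  + exact: sth.1.
Qed.

Lemma line_src_inj' e e' : carr e -> carr e' -> bproj e = bproj e' ->
  gsrc gL e = gsrc gL e' -> e = e'.
Proof. exact: (line_src_inj hL). Qed.

Lemma mk_invE (p : V) : carr p -> ginv mk p = (tmap (ginv g) p.1, ginv gL (twist p)).
Proof.
case: p => v l cp; congr pair; have cs := twist_carr cp; have ci := carr_inv HL cs.
rewrite -[RHS](fibre_invE vL mS line_src_inj' (line_src_onto hL) ci).
rewrite (src_inv lL) // (line_inv_bproj hL) // twist_bproj //.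
Qed.

Lemma mk_src_morphism : vb_morphism (gsrc mk) (gsrc g).
Proof.
have -> : gsrc mk = (fun p => (tmap (gsrc g) p.1, (gsrc gL \o snd) p)).
  by apply/funext => p; rewrite mk_srcE.
have mh : vb_morphism (gsrc gL \o snd : V -> LM) (gsrc g) :=
  vb_morphism_comp (whitney_snd_morphism (tangent G) vL) mS.
exact: (pair_morphism mh).
Qed.

Lemma mk_tgt_morphism : vb_morphism (gtgt mk) (gtgt g).
Proof.
have -> : gtgt mk = (fun p => (tmap (gtgt g) p.1, (gtgt gL \o twist) p)).
  by apply/funext => p; rewrite mk_tgtE.
have mh : vb_morphism (gtgt gL \o twist : V -> LM) (gtgt g) :=
  vb_morphism_comp twist_morphism mT.
exact: (pair_morphism mh).
Qed.

Lemma mk_unit_morphism : vb_morphism (gunit mk) (gunit g).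
Proof.
have -> : gunit mk = (fun p => (tmap (gunit g) p.1, (gunit gL \o snd) p)).
  by apply/funext => p; rewrite mk_unitE.
have mh : vb_morphism (gunit gL \o snd : VM -> L) (gunit g) :=
  vb_morphism_comp (whitney_snd_morphism (tangent M) vLM) mU.
exact: (pair_morphism mh).
Qed.

Lemma mk_inv_morphism : vb_morphism (ginv mk) (ginv g).
Proof.
apply: (vb_morphism_ext vV (fun p cp => esym (mk_invE cp))).
have mh : vb_morphism (ginv gL \o twist : V -> L) (ginv g) := vb_morphism_comp twist_morphism mI.
exact: (pair_morphism mh).
Qed.

Section Composable.
Variables p q : V.
Hypothesis cpq : @carr R (composable mk) (p, q).
Lemma comp_left : carr p. Proof. by have [[]] := cpq. Qed.
Lemma comp_right : carr q. Proof. by have [[]] := cpq. Qed.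
Let comp_eq : gsrc mk p = gtgt mk q. Proof. by have [] := cpq. Qed.
Lemma comp_vect : tmap (gsrc g) p.1 = tmap (gtgt g) q.1.
Proof. by move: comp_eq; rewrite mk_srcE mk_tgtE => -[] e1 e2 _; congr pair. Qed.
Lemma comp_line : gsrc gL p.2 = gtgt gL (twist q).
Proof. by move: comp_eq; rewrite mk_srcE mk_tgtE => -[]. Qed.
Lemma comp_arrow : gsrc g p.1.1 = gtgt g q.1.1.
Proof. by have [] := comp_vect. Qed.
Lemma mul_arrow : carr (gmul g p.1.1 q.1.1).
Proof.
by apply: (carr_mul HG) comp_arrow; apply: el_arrow; [exact: comp_left|exact: comp_right].
Qed.
Lemma mul_line_spec : let l := sinv (gmul g p.1.1 q.1.1) (gsrc gL q.2) in
  [/\ carr l, bproj l = gmul g p.1.1 q.1.1 & gsrc gL l = gsrc gL q.2].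
Proof.
have cq := comp_right; have c2 := el_line cq.
apply: (fibre_invP (line_src_onto hL)); [exact: mul_arrow|exact: (carr_src HL)|].
rewrite (line_src_bproj hL) // -el_base // (src_mul lG) //; last exact: comp_arrow.
- exact/el_arrow/comp_left.
- exact/el_arrow.
Qed.
Lemma mul_vect_carr : carr (tangent_mul g p.1 q.1).
Proof.
by apply: (tangent_mul_carr HG) comp_vect; apply: el_vect; [exact: comp_left|exact: comp_right].
Qed.
Lemma mul_vect_base : (tangent_mul g p.1 q.1).1 = gmul g p.1.1 q.1.1.
Proof.
by apply: (tangent_mul_base HG) comp_vect; apply: el_vect; [exact: comp_left|exact: comp_right].
Qed.
Lemma mk_mul_carr : carr (gmul mk p q).
Proof.
have [c b e] := mul_line_spec; rewrite mk_mulE; split; first by split => //; exact: mul_vect_carr.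
by rewrite /= b; exact: mul_vect_base.
Qed.
End Composable.

Lemma mk_mul_morphism :
  @vb_morphism R _ _ (composable_vb g mk) V (@gmul2 _ _ _ mk) (@gmul2 _ _ _ g).
Proof.
have [sS ss Sb Sa Ss] := mS; split; last first.
- move=> a [p q] cpq; have cp := comp_left cpq; have cq := comp_right cpq.
  have c' : @carr R (composable mk) (vscale a p, vscale a q).
    split; first by split; exact: (vscale_carr vV).
    have [_ _ _ _ MSs] := mk_src_morphism; have [_ _ _ _ MTs] := mk_tgt_morphism.
    have e : gsrc mk p = gtgt mk q by have [] := cpq.
    change (gsrc mk (vscale a p) = gtgt mk (vscale a q)).
    by rewrite MSs // MTs // e.
  have [k1 b1 e1] := mul_line_spec c'; have [k2 b2 e2] := mul_line_spec cpq.
  change (gmul mk (vscale a p) (vscale a q) = vscale a (gmul mk p q)).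
  rewrite !mk_mulE /=; congr pair.
    rewrite (tangent_mul_scale HG) //; [exact: el_vect|exact: el_vect|..].
    + exact: (vscale_carr (tangent_vbundle dimG)) (el_vect cp).
    + exact: (vscale_carr (tangent_vbundle dimG)) (el_vect cq).
    + exact: comp_vect cpq.
  apply: line_src_inj' => //; first exact: (vscale_carr vL).
    by rewrite (vscale_bproj vL) // b1 b2.
  by rewrite e1 Ss // e2 /= Ss //; exact: el_line.
- move=> [p q] [p' q'] cpq cpq' [b b'].
  have cp := comp_left cpq; have cq := comp_right cpq.
  have cp' := comp_left cpq'; have cq' := comp_right cpq'.
  have c' : @carr R (composable mk) (vadd p p', vadd q q').
    split; first by split; exact: (vadd_carr vV).
    have [_ _ _ MSa _] := mk_src_morphism; have [_ _ _ MTa _] := mk_tgt_morphism.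
    have e : gsrc mk p = gtgt mk q by have [] := cpq.
    have e' : gsrc mk p' = gtgt mk q' by have [] := cpq'.
    change (gsrc mk (vadd p p') = gtgt mk (vadd q q')).
    by rewrite MSa // MTa // e e'.
  have [k1 b1 e1] := mul_line_spec c'; have [k2 b2 e2] := mul_line_spec cpq.
  have [k3 b3 e3] := mul_line_spec cpq'.
  change (gmul mk (vadd p p') (vadd q q') = vadd (gmul mk p q) (gmul mk p' q')).
  rewrite !mk_mulE /=; congr pair.
    rewrite (tangent_mul_add HG) //; try exact: el_vect.
    + exact: (vadd_carr (tangent_vbundle dimG)) (el_vect cp) (el_vect cp') b.
    + exact: (vadd_carr (tangent_vbundle dimG)) (el_vect cq) (el_vect cq') b'.
    + exact: comp_vect cpq.
    + exact: comp_vect cpq'.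
  have bb : gmul g p.1.1 q.1.1 = gmul g p'.1.1 q'.1.1 by congr gmul; [exact: b|exact: b'].
  have bl : bproj q.2 = bproj q'.2 by rewrite -!el_base.
  have b23 : bproj (sinv (gmul g p.1.1 q.1.1) (gsrc gL q.2)) =
      bproj (sinv (gmul g p'.1.1 q'.1.1) (gsrc gL q'.2)) by rewrite b2 b3.
  apply: line_src_inj' => //; first exact: (vadd_carr vL).
    by rewrite (vadd_bproj vL) // b1 b2.
  rewrite e1 Sa // e2 e3 /= Sa //; exact: el_line.
- move=> [p q] cpq; change (bproj (gmul mk p q) = gmul g p.1.1 q.1.1).
  by rewrite mk_mulE /=; exact: mul_vect_base.
- exact: (mul_smooth HG).
- have -> : @gmul2 _ _ _ mk = (fun z : composable mk => (tangent_mul g z.1.1 z.2.1,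
      sinv (gmul g z.1.1.1 z.2.1.1) (gsrc gL z.2.2)) : V).
    by apply/funext => -[p q]; rewrite /gmul2 mk_mulE.
  apply/smooth_mapP => -[p q] cpq; have cp := comp_left cpq; have cq := comp_right cpq.
  have nc := @snbhs_carr R (composable mk) (p, q).
  have s1 := @smap_near_comp R (composable mk) V (tangent G) fst fst _ cpq
    (composable_fst _) (whitney_fst _).
  have s2 := @smap_near_comp R (composable mk) V (tangent G) snd fst _ cpq
    (composable_snd _) (whitney_fst _).
  have s3 := @smap_near_comp R (composable mk) V L snd snd _ cpq
    (composable_snd _) (whitney_snd _).
  have s4 := @smap_near_comp R (composable mk) (tangent G) G _ fst _ cpq s1
    (smap_near_bproj _).
  have s5 := @smap_near_comp R (composable mk) (tangent G) G _ fst _ cpq s2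
    (smap_near_bproj _).
  have s6 : @smap_near R (composable mk) G (p, q) (fun z => gmul g z.1.1.1 z.2.1.1).
    apply: (@smap_near_comp R (composable mk) (composable g) G
      (fun z => (z.1.1.1, z.2.1.1)) (@gmul2 R G M g)) => //.
      apply: composable_pair => //; move: nc; apply: filterS => -[x y] cz; exact: (comp_arrow cz).
    apply: (smooth_map_near (mul_smooth HG)); split; first by split; exact: el_arrow.
    exact: comp_arrow cpq.
  apply: whitney_pair.
  + apply: (tangent_mul_smooth HG) => //.
    by move: nc; apply: filterS => -[x y] cz; exact: (comp_vect cz).
  + apply: (@fibre_inv_smooth R G M 1 L LM vL vLM (gsrc gL) (gsrc g) mS
      (line_src_onto hL) (composable mk)) => //.
      apply: (@smap_near_comp R (composable mk) L LM (fun z => z.2.2) (gsrc gL)) => //.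
      exact: (smooth_map_near sS (el_line cq)).
    move: nc; apply: filterS => -[x y] cz; have [k1 b1 <-] := mul_line_spec cz.
    by rewrite Sb // b1.
  + move: nc; apply: filterS => -[x y] cz /=; have [_ -> _] := mul_line_spec cz.
    exact: (mul_vect_base cz).
Qed.

(** The source of G is a submersion and that of L is onto on fibres. *)
Lemma mk_src_onto : fibrewise_onto (gsrc mk) (gsrc g).
Proof.
move=> h w ch [[c1 c2] e] b.
have [v [cv bv sv]] := src_submersion HG ch c1 b.
have [l [cl bl sl]] := line_src_onto hL ch c2 (etrans (esym e) b).
exists (v, l); split => //.
- by split => //=; rewrite bl.
- by rewrite mk_srcE /= sv sl; case: (w).
Qed.

(** Let p = (v, l) and q = (v', l') be composable. The line component of p q is
m1 l' with m1 over the arrow of p, and composability means l = m1 + l1 with l1 from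
[form_mul]. So t(m1 l') + t(theta(v v')) = t(m1) + t(theta v) + t(l1), which is
t(l + theta v). *)
Lemma mk_tgt_mul (p q : V) : carr p -> carr q -> gsrc mk p = gtgt mk q ->
  gtgt mk (gmul mk p q) = gtgt mk p.
Proof.
move=> cp cq e; have cpq : @carr R (composable mk) (p, q) by [].
have [_ _ Tb Ta _] := mT; have [_ _ Sb Sa _] := mS.
have [k b es] := mul_line_spec cpq; have cm := mk_mul_carr cpq.
have v1 := el_vect cp; have v2 := el_vect cq; have ev := comp_vect cpq.
have a1 := el_arrow cp; have a2 := el_arrow cq; have ea := comp_arrow cpq.
rewrite !mk_tgtE; rewrite mk_mulE /twist /=; congr pair.
  exact: (tangent_tgt_mul HG).
have [l1 [l2 [[cl1 cl2 bl1 bl2] sl1 _ _ tE]]] := form_mul hL mult v1 v2 ev.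
have cth := form_carr mult v1; have bth := form_bproj mult v1.
have cth2 := form_carr mult v2; have bth2 := form_bproj mult v2.
have cthm := form_carr mult (mul_vect_carr cpq).
have bthm := form_bproj mult (mul_vect_carr cpq).
set kk := sinv _ _ in k b es *.
have cq2 := el_line cq; have cp2 := el_line cp.
have bq2 := el_base cq; have bp2 := el_base cp.
have [m1 [cm1 bm1 sm1]] : exists l, [/\ carr l, bproj l = p.1.1 & gsrc gL l = gtgt gL q.2].
  apply: (line_src_onto hL) => //; first exact: (carr_tgt HL).
  by rewrite Tb // -bq2.
have kE : kk = gmul gL m1 q.2.
  apply: line_src_inj' => //; first exact: (carr_mul HL).
    by rewrite (line_mul_bproj hL) // bm1 -bq2.
  by rewrite (src_mul lL).
have mlE : vadd m1 l1 = p.2.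
  have bml : bproj m1 = bproj l1 by rewrite bm1 bl1.
  apply: line_src_inj' => //; first exact: (vadd_carr vL).
    by rewrite (vadd_bproj vL) // bm1.
  rewrite Sa // sm1 sl1 (comp_line cpq) /twist Ta //.
  by rewrite bth2 -bq2.
rewrite Ta //; last by rewrite b bthm (mul_vect_base cpq).
have -> : gtgt gL kk = gtgt gL m1 by rewrite kE (tgt_mul lL).
rewrite tE -mlE Ta //; last first.
- by rewrite (vadd_bproj vL) ?bm1 ?bl1 ?bth.
- exact: (vadd_carr vL) cm1 cl1 (etrans bm1 (esym bl1)).
rewrite Ta //; last by rewrite bm1 bl1.
have ct1 := carr_tgt HL cm1; have ct2 := carr_tgt HL cl1; have ct3 := carr_tgt HL cth.
have d1 : bproj (gtgt gL m1) = gtgt g p.1.1 by rewrite Tb // bm1.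
have d2 : bproj (gtgt gL l1) = gtgt g p.1.1 by rewrite Tb // bl1.
have d3 : bproj (gtgt gL (theta p.1)) = gtgt g p.1.1 by rewrite Tb // bth.
rewrite (fibre_addC vLM (conj ct3 d3) (conj ct2 d2)).
exact: (fibre_addA vLM (conj ct1 d1) (conj ct2 d2) (conj ct3 d3)).
Qed.

(** Sources of products are immediate, so that associativity, units and inverses
follow from the tangent groupoid once the targets of products, units and
inverses are known, by [mk_tgt_mul], [form_unit] and [form_inv]. *)
Lemma mk_groupoid : is_groupoid mk.
Proof.
have [sS ss Sb Sa Ss] := mS; have [sT st Tb Ta Ts] := mT; have [sU su Ub Ua Us] := mU.
have Cs (p : V) : carr p -> carr (gsrc mk p) by have [[+ _] _ _ _ _] := mk_src_morphism; exact.
have Ct (p : V) : carr p -> carr (gtgt mk p) by have [[+ _] _ _ _ _] := mk_tgt_morphism; exact.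
have Cu (p : VM) : carr p -> carr (gunit mk p) by have [[+ _] _ _ _ _] := mk_unit_morphism; exact.
have Ci (p : V) : carr p -> carr (ginv mk p) by have [[+ _] _ _ _ _] := mk_inv_morphism; exact.
have src_mul' (p q : V) : carr p -> carr q -> gsrc mk p = gtgt mk q ->
    gsrc mk (gmul mk p q) = gsrc mk q.
  move=> cp cq e; have cpq : @carr R (composable mk) (p, q) by [].
  have [k b es] := mul_line_spec cpq.
  rewrite !mk_srcE mk_mulE /= es; congr pair.
  by apply: (tangent_src_mul HG) (comp_vect cpq); exact: el_vect.
have src_unit' (w : VM) : carr w -> gsrc mk (gunit mk w) = w.
  move=> [[c1 c2] e]; rewrite mk_srcE mk_unitE /= (src_unit lL) //.
  by rewrite (tangent_src_unit HG) //; case: (w).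
have tgt_unit' (w : VM) : carr w -> gtgt mk (gunit mk w) = w.
  move=> [[c1 c2] e]; rewrite mk_tgtE mk_unitE /twist /=.
  have cu := tmap_carr su c1.
  have fl : in_fibre (gunit g w.1.1) (gunit gL w.2).
    by split; [exact: (carr_unit HL)|rewrite Ub // -e].
  have fth : in_fibre (gunit g w.1.1) (theta (tmap (gunit g) w.1)).
    by split; [exact: (form_carr mult)|rewrite (form_bproj mult)].
  rewrite (form_unit hL mult c1) (fibre_add0 vL fl fth).
  by rewrite (tgt_unit lL) // (tangent_tgt_unit HG) //; case: (w).
have src_inv' (p : V) : carr p -> gsrc mk (ginv mk p) = gtgt mk p.
  move=> cp; rewrite mk_srcE mk_invE // mk_tgtE /= (src_inv lL); last exact: twist_carr.
  by rewrite (tangent_src_inv HG) //; exact: el_vect.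
have tgt_inv' (p : V) : carr p -> gtgt mk (ginv mk p) = gsrc mk p.
  move=> cp; have v1 := el_vect cp; have l1 := el_line cp; have c3 := twist_carr cp.
  have vi := tmap_carr (inv_smooth HG) v1; have ci := carr_inv HL c3.
  have cth := form_carr mult v1; have bth := form_bproj mult v1.
  have bp2 := el_base cp.
  rewrite mk_tgtE mk_invE // mk_srcE {1}/twist /= (tangent_tgt_inv HG) //; congr pair.
  have bi : bproj (ginv gL (twist p)) = bproj (theta (tmap (ginv g) p.1)).
    by rewrite (line_inv_bproj hL) // twist_bproj // (form_bproj mult).
  rewrite Ta //; last exact: (form_carr mult).
  rewrite (tgt_inv lL) // {1}/twist Sa //; last by rewrite bth.
  have cs1 := carr_src HL l1; have cs2 := carr_src HL cth.
  have ct := carr_tgt HL (form_carr mult vi).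
  have e1 : bproj (gsrc gL p.2) = gsrc g p.1.1 by rewrite Sb // bp2.
  have e2 : bproj (gsrc gL (theta p.1)) = gsrc g p.1.1 by rewrite Sb // bth.
  have e3 : bproj (gtgt gL (theta (tmap (ginv g) p.1))) = gsrc g p.1.1.
    rewrite Tb; last exact: (form_carr mult).
    by rewrite (form_bproj mult vi) /=; exact: (tgt_inv lG (el_arrow cp)).
  apply: (fibre_add_cancel vLM (conj cs1 e1) (conj ct e3) (conj cs2 e2)).
  rewrite (form_inv hL mult v1).
  exact: (fibre_zero_eq vLM (conj cs1 e1) (conj cs2 e2)).
(* An arrow is determined by its vector and the source of its line component,
   which reduces the remaining laws to those of TG. *)
have ext (p q : V) : carr p -> carr q -> p.1 = q.1 -> gsrc gL p.2 = gsrc gL q.2 -> p = q.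
  move=> cp cq e1 e2; rewrite [LHS]surjective_pairing [RHS]surjective_pairing e1; congr pair.
  by apply: line_src_inj' => //; [exact: el_line|exact: el_line|rewrite -!el_base // e1].
have cm (p q : V) : carr p -> carr q -> gsrc mk p = gtgt mk q -> carr (gmul mk p q).
  by move=> cp cq e; exact: (@mk_mul_carr p q).
have s2 (p q : V) : gsrc mk p = gsrc mk q -> gsrc gL p.2 = gsrc gL q.2.
  by rewrite !mk_srcE => -[].
have mk_mul1 (p q : V) : (gmul mk p q).1 = tangent_mul g p.1 q.1 by rewrite mk_mulE.
split => //.
- exact: mk_tgt_mul.
- move=> a b c ca cb cc e e'.
  have e1 : gsrc mk (gmul mk a b) = gtgt mk c by rewrite src_mul'.
  have e2 : gsrc mk a = gtgt mk (gmul mk b c) by rewrite mk_tgt_mul.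
  apply: ext; [by apply: (cm) => //; exact: cm|by apply: (cm) => //; exact: cm| |].
    rewrite !mk_mul1; apply: (tangent_mul_assoc HG); try exact: el_vect.
      exact: (@comp_vect a b).
    exact: (@comp_vect b c).
  by apply: s2; rewrite !src_mul' //; exact: cm.
- move=> a ca; have cu := Cu _ (Cs _ ca).
  have e : gsrc mk a = gtgt mk (gunit mk (gsrc mk a)) by rewrite tgt_unit' //; exact: Cs.
  apply: ext => //; first exact: cm.
    rewrite mk_mul1 mk_unitE mk_srcE /=; apply: (tangent_mul_unitr HG); exact: el_vect.
  by apply: s2; rewrite src_mul' // src_unit' //; exact: Cs.
- move=> a ca; have cu := Cu _ (Ct _ ca).
  have e : gsrc mk (gunit mk (gtgt mk a)) = gtgt mk a by rewrite src_unit' //; exact: Ct.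
  apply: ext => //; first exact: cm.
    rewrite mk_mul1 mk_unitE mk_tgtE /=; apply: (tangent_mul_unitl HG); exact: el_vect.
  by apply: s2; rewrite src_mul'.
- move=> a ca; have ci := Ci _ ca.
  have e : gsrc mk a = gtgt mk (ginv mk a) by rewrite tgt_inv'.
  apply: ext => //; [exact: cm|exact/Cu/Ct| |].
    rewrite mk_mul1 mk_invE // mk_unitE mk_tgtE /=; apply: (tangent_mul_invr HG); exact: el_vect.
  by apply: s2; rewrite src_mul' // src_unit' ?src_inv' //; exact: Ct.
- move=> a ca; have ci := Ci _ ca.
  have e : gsrc mk (ginv mk a) = gtgt mk a by rewrite src_inv'.
  apply: ext => //; [exact: cm|exact/Cu/Cs| |].
    rewrite mk_mul1 mk_invE // mk_unitE mk_srcE /=; apply: (tangent_mul_invl HG); exact: el_vect.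
  by apply: s2; rewrite src_mul' // src_unit' //; exact: Cs.
Qed.

Lemma mk_lie_groupoid : is_lie_groupoid mk.
Proof.
have sub : submersion (gsrc mk).
  exact: (bundle_submersion dimG dimM vV vVM mk_src_morphism mk_src_onto (src_submersion HG)).
have sS : smooth_map (gsrc mk) by have [] := mk_src_morphism.
have sT : smooth_map (gtgt mk) by have [] := mk_tgt_morphism.
have sI : smooth_map (ginv mk) by have [] := mk_inv_morphism.
split => //.
- exact: (vbundle_manifold vV (arrows_manifold HG)).
- exact: (vbundle_manifold vVM (objects_manifold HG)).
- exact: (target_submersion mk_groupoid sI sS sT sub).
- by have [] := mk_mul_morphism.
- by have [] := mk_unit_morphism.
- exact: mk_groupoid.
Qed.

Lemma mk_vbg : is_vbg g mk.
Proof.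
split.
- exact: HG.
- exact: mk_lie_groupoid.
- by exists (n + 1)%N.
- by exists (m + 1)%N.
- exists ((n + 1) - (m + 1) + (n + 1))%N.
  exact: (composable_vbundle vV vVM mk_src_morphism mk_tgt_morphism mk_src_onto).
- exact: mk_src_morphism.
- exact: mk_tgt_morphism.
- exact: mk_mul_morphism.
- exact: mk_unit_morphism.
- exact: mk_inv_morphism.
Qed.

End MoritaKernelVBG.

Theorem mainTheorem11 (R : realType) (G M : smoothSpace R) (g : gpd G M)
  (L : vbundle G) (LM : vbundle M) (gL : gpd L LM) (theta : tangent G -> L)
  (hL : is_lbg g gL) (htheta : multiplicative1 g gL theta) :
  is_vbg g (morita_kernel g gL theta).
Proof.
have [vbg _ _] := hL.
have [_ _ [n dimG]] := arrows_manifold (vbg_base vbg).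
have [_ _ [m dimM]] := objects_manifold (vbg_base vbg).
exact: (mk_vbg hL htheta dimG dimM).
Qed.
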